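(* Let $G=(\mathbb{V},E)$ be an infinite, connected, locally finite, quasi-transitive graph and let $p\in[0,1]$ and $q\ge1$. Let $\phi^0_{p,q}$ and $\phi^1_{p,q}$ be the free and wired infinite-volume random-cluster measures on $\{0,1\}^E$, regarded as laws of random fields on the vertex set $E$ of the line graph of $G$. (i) If $G$ is amenable and $\phi^0_{p,q}\ne\phi^1_{p,q}$, then $\phi^1_{p,q}$ is not $\Gamma$-ffiid, for any group $\Gamma$ acting quasi-transitively on $E$ by automorphisms of the line graph of $G$. (ii) If $G$ is c-amenable and $\phi^0_{p,q}\ne\phi^1_{p,q}$, then $\phi^0_{p,q}$ is not $\Gamma$-ffiid, for any group $\Gamma$ acting quasi-transitively on $E$ by automorphisms of the line graph of $G$.
   Context: **Amenability.** For $V\subset\mathbb{V}$, $\partial V:=\{u\in\mathbb{V}:\mathrm{dist}(u,\mathbb{V}\setminus V)=1\}$, where $\mathrm{dist}$ is the graph distance in $G$. $G$ is amenable if there is a sequence $(F_n)_n$ of non-empty finite subsets of $\mathbb{V}$ with $|\partial F_n|/|F_n|\to0$. $G$ is c-amenable if there is a sequence $(F_n,H_n)_n$ of pairs of non-empty finite subsets of $\mathbb{V}$ such that $H_n$ is connected (in $G$), $\partial F_n\subset H_n$, and $|H_n|/|F_n|\to0$ as $n\to\infty$. **Random-cluster model.** For a finite induced subgraph $G'=(V',E')$ of $G$, let $\partial V'$ be the set of vertices of $V'$ having a neighbor in $\mathbb{V}\setminus V'$. For $i\in\{0,1\}$ the random-cluster measure is $$\phi^i_{G',p,q}(\omega)=\frac{p^{o(\omega)}(1-p)^{c(\omega)}q^{k^i(\omega)}}{Z^i(G',p,q)},\qquad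 \omega\in\{0,1\}^{E'},$$ where $o(\omega)$ and $c(\omega)$ are the numbers of open ($\omega_e=1$) and closed ($\omega_e=0$) edges, $k^0(\omega)$ is the number of open clusters (connected components of the graph with vertex set $V'$ and the open edges), $k^1(\omega)$ is the number of open clusters that do not intersect $\partial V'$, and $Z^i$ is the normalizing constant. For $q\ge1$, $\phi^i_{G',p,q}$ converges weakly, as $G'$ increases to $G$, to a probability measure $\phi^i_{p,q}$ on $\{0,1\}^E$, invariant under all automorphisms; $\phi^0_{p,q}$ is the free measure and $\phi^1_{p,q}$ the wired measure. **Codings.** Let $H$ be a locally finite graph with countable vertex set $W$ and graph distance $\mathrm{dist}$ (here $H$ is the line graph of $G$ and $W=E$). A group action is quasi-transitive if it has finitely many orbits. Let $\Gamma$ act quasi-transitively on $W$ by automorphisms of $H$; it acts on configurations by $(\gamma\omega)_v=\omega_{\gamma^{-1}v}$. All probability spaces are standard. A coding from a $\Gamma$-invariant $T$-valued random field $Y=(Y_v)_{v\in W}$ to a $\Gamma$-invariant $S$-valued random field $X=(X_v)_{v\in W}$ is a measurable map $\varphi:T^W\to S^W$ such that $\varphi(Y)$ has the law of $X$ and $\varphi$ commutes with every element of $\Gamma$ on a $\Gamma$-invariant set of full measure. The coding radius $R_v(y)\in\{0,1,2,\dots\}\cup\{\infty\}$ is the minimal $r$ such that $\varphi(y)_v=\varphi(y')_v$ for every $y'$ with $y'_w=y_w$ for all $w$ with $\mathrm{dist}(v,w)\le r$ (up to modification on null sets). The coding is finitary if $R_v(Y)<\infty$ almost surely for all $v$. $X$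 (or its law) is $\Gamma$-ffiid if there is a finitary coding from some i.i.d. process $Y$ (the $Y_v$ independent and identically distributed) to $X$. *)

(* Defs.v *)
From HB Require Import structures.
From mathcomp Require Import all_boot all_order all_algebra.
From mathcomp Require Import finmap.
From mathcomp Require Import all_classical all_reals all_analysis.
Import Order.TTheory GRing.Theory Num.Theory.
Import numFieldNormedType.Exports.

Set Implicit Arguments.
Unset Strict Implicit.
Unset Printing Implicit Defensive.

Local Open Scope classical_set_scope.
Local Open Scope ring_scope.

Section GraphDistance.
Context (R : realType) (W : eqType) (H : rel W).

(* Values in \bar R: the infimum over an empty set of walks (or of points) is
   +oo, so points in different components are at distance +oo. *)
Definition gdist (u v : W) : \bar R :=
  ereal_inf [set ((size s)%:R)%:E | s in [set s | path H u s /\ last u s = v]].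

Definition gdist_set (u : W) (A : set W) : \bar R :=
  ereal_inf [set gdist u v | v in A].

Definition vboundary (A : set W) : set W :=
  [set u | gdist_set u (~` A) = 1%:E].

End GraphDistance.

Section Graphs.
Context {W : eqType} (H : rel W).

Definition connected_on (A : set W) :=
  forall u v, A u -> A v ->
    exists s, [/\ path H u s, last u s = v & forall x, x \in s -> A x].

Definition locally_finite := forall u, finite_set [set v | H u v].

Definition automorphism (f : W -> W) :=
  bijective f /\ forall u v, H (f u) (f v) = H u v.

Definition quasi_transitive :=
  finite_set
    (range (fun u => [set v | exists2 f, automorphism f & f u = v])).

End Graphs.

Section Amenability.
Context (R : realType) (V : choiceType) (G : rel V).

(* [fset_set] is only applied below to the boundary of a finite set, which is a
   subset of that set. *)
Definition amenable := exists F : nat -> {fset V},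
  (forall n, F n != fset0) /\
  (fun n => #|` fset_set (vboundary R G [set` F n])|%:R / #|` F n|%:R : R)
    @ \oo --> (0 : R).

Definition c_amenable := exists F K : nat -> {fset V},
  [/\ forall n, F n != fset0 /\ K n != fset0,
      forall n, connected_on G [set` K n],
      forall n, vboundary R G [set` F n] `<=` [set` K n] &
      (fun n => #|` K n|%:R / #|` F n|%:R : R) @ \oo --> (0 : R)].

End Amenability.

Record sgraph (V : choiceType) := SGraph {
  adj :> rel V;
  adj_sym : symmetric adj;
  adj_irr : irreflexive adj }.

Section Edges.
Context {V : choiceType} (G : sgraph V).

Definition is_edge (e : {fset V}) : bool :=
  (#|` e| == 2)%N && [forall u : e, forall v : e, (u != v) ==> G (val u) (val v)].

Definition edge := {e : {fset V} | is_edge e}.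

HB.instance Definition _ := Choice.on edge.

Definition line_graph : rel edge :=
  fun e f => (e != f) && (val e `&` val f != fset0)%fset.

(* Edges of the subgraph of G induced on L. *)
Definition edges_in (L : {fset V}) : {fset edge} :=
  [fset e in pmap (insub : {fset V} -> option edge) (fpowerset L)]%fset.

Lemma in_edges_in (L : {fset V}) (e : edge) :
  (e \in edges_in L) = (val e `<=` L)%fset.
Proof.
rewrite /edges_in inE mem_pmap_sub; exact: fpowersetE.
Qed.

End Edges.

Section RandomCluster.
Context {R : realType} {V : choiceType} (G : sgraph V).

Section FiniteVolume.
Context (wired : bool) (p q : R) (L : {fset V}).

Definition open_adj (w : {ffun edges_in G L -> bool}) : rel L :=
  fun u v => [exists e, w e && (val (val e) == [fset val u; val v]%fset)].

Definition clusters (w : {ffun edges_in G L -> bool}) : {set {set L}} :=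
  [set [set v | connect (open_adj w) u v] | u : L]%SET.

Definition inner_boundary : {set L} :=
  [set u : L | `[< exists2 v, v \notin L & G (val u) v >]]%SET.

(* k^0 (all clusters) or, if [wired], k^1 (clusters avoiding the boundary). *)
Definition num_clusters (w : {ffun edges_in G L -> bool}) : nat :=
  #|[set C in clusters w | wired ==> [disjoint C & inner_boundary]]%SET|.

Definition rc_weight (w : {ffun edges_in G L -> bool}) : R :=
  p ^+ #|[set e | w e]%SET| * (1 - p) ^+ #|[set e | ~~ w e]%SET|
  * q ^+ num_clusters w.

Definition rc_prob (w : {ffun edges_in G L -> bool}) : R :=
  rc_weight w / \sum_(w' : {ffun edges_in G L -> bool}) rc_weight w'.

(* Edges outside L are closed in the free case and open in the wired case; the
   weak limit does not depend on this choice. *)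
Definition extend (w : {ffun edges_in G L -> bool}) : edge G -> bool :=
  fun e => oapp w wired (insub e).

Definition rc_mean (f : (edge G -> bool) -> R) : R :=
  \sum_(w : {ffun edges_in G L -> bool}) rc_prob w * f (extend w).

End FiniteVolume.

End RandomCluster.

Section RandomFields.
Context (W : choiceType) (d : measure_display) (T : measurableType d).

Definition coord_events : set (set (W -> T)) :=
  [set C | exists w, exists2 A, measurable A & C = [set y | A (y w)]].

(* T^W with the product sigma-algebra. *)
Definition config := g_sigma_algebraType coord_events.

HB.instance Definition _ := Measurable.on config.

End RandomFields.

(* Finite subsets of V directed by inclusion. *)
Definition exhaustion (V : choiceType) : set_system {fset V} :=
  filter_from [set: {fset V}] (fun A => [set L | (A `<=` L)%fset]).

(* Weak convergence on {0,1}^E along the finite induced subgraphs; {0,1}^E is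
   compact, so every continuous test function is bounded. *)
Definition is_rc_measure (R : realType) (V : choiceType) (G : sgraph V)
    (wired : bool) (p q : R) (phi : probability (config (edge G) bool) R) :=
  forall f : {ptws edge G -> bool} -> R, continuous f ->
    rc_mean wired p q L f @[L --> @exhaustion V]
      --> Rintegral phi setT f.

Definition standard_borel (R : realType) (d : measure_display)
    (T : measurableType d) :=
  exists f : T -> measurableTypeR R,
    [/\ measurable_fun setT f, injective f &
        forall A, measurable A -> measurable (f @` A)].

Section Actions.
Context {Gam : groupType} {W : choiceType} (act : Gam -> W -> W).

Definition acts_by_automorphisms (H : rel W) :=
  [/\ forall v, act 1%g v = v,
      forall g h v, act (g * h)%g v = act g (act h v) &
      forall g, automorphism H (act g)].

Definition acts_quasi_transitively :=
  finite_set (range (fun v => [set act g v | g in [set: Gam]])).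

Definition config_act {T : Type} (g : Gam) (y : W -> T) : W -> T :=
  fun v => y (act g^-1%g v).

End Actions.

Section Codings.
Context {R : realType} {W : choiceType}.

Definition iid {d : measure_display} {T : measurableType d}
    (mu : probability (config W T) R) :=
  (forall v w (A : set T), measurable A ->
     mu [set y | A (y v)] = mu [set y | A (y w)]) /\
  (forall (F : {fset W}) (A : W -> set T), (forall w, measurable (A w)) ->
     mu [set y | forall w, w \in F -> A w (y w)]
       = (\prod_(w <- F) mu [set y | A w (y w)])%E).

Context {Gam : groupType} (act : Gam -> W -> W).

Definition invariant_law {d : measure_display} {T : measurableType d}
    (mu : probability (config W T) R) :=
  forall g (A : set (config W T)), measurable A ->
    mu (config_act act g @^-1` A) = mu A.

Context {d d' : measure_display} {T : measurableType d} {S : measurableType d'}.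
Implicit Types (mu : probability (config W T) R)
  (P : probability (config W S) R) (phi : config W T -> config W S).

Definition coding mu P phi :=
  [/\ invariant_law mu, invariant_law P, measurable_fun setT phi,
      forall A, measurable A -> pushforward mu phi A = P A &
      exists Om : set (config W T),
        [/\ forall g, config_act act g @^-1` Om = Om,
            {ae mu, forall y, Om y} &
            forall g y, Om y ->
              phi (config_act act g y) = config_act act g (phi y)]].

Definition coding_radius (H : rel W) phi (v : W) (y : config W T) : \bar R :=
  ereal_inf [set (r%:R)%:E | r in [set r : nat |
    forall y' : config W T,
      (forall w, (gdist R H v w <= (r%:R)%:E)%E -> y' w = y w) ->
      phi y v = phi y' v]].

(* The radius is that of a version phi' of phi: coding radii are only defined
   up to modification of the coding on a null set. *)
Definition finitary (H : rel W) mu phi :=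
  exists2 phi', {ae mu, forall y, phi' y = phi y} &
    forall v, {ae mu, forall y, (coding_radius H phi' v y < +oo)%E}.

End Codings.

Definition ffiid (R : realType) (W : choiceType) (H : rel W)
    (Gam : groupType) (act : Gam -> W -> W)
    (d' : measure_display) (S : measurableType d')
    (P : probability (config W S) R) :=
  exists (d : measure_display) (T : measurableType d)
    (mu : probability (config W T) R) (phi : config W T -> config W S),
    [/\ standard_borel R T, iid mu, coding act mu P phi & finitary H mu phi].

(* Main.v *)
(* Suppose the wired measure phi1 is a finitary factor of an iid process and let
   e0 be an edge whose phi0- and phi1-probabilities a < b of being open differ;
   it exists because phi1 dominates phi0 (FKG). In a Folner set F choose a
   positive density of Aut(G)-translates of e0 forming a set S with disjoint
   r-balls in the line graph.
   Closing the edges crossing the boundary of F costs a factor exponential in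
   its size and leaves the free measure in F, which is dominated by phi0; so
   E exp(-t sum_S w_e) is at least exp(-C |boundary| - t a |S|) under phi1.
   On the other hand w_e is bounded below, up to a small error in mean, by an
   event depending on the r-ball of e only, and these are independent for e in
   S; so the same expectation is at most (1 - (1 - exp(-t)) (b - eps))^|S|. For
   small t this contradicts |boundary| / |F| -> 0.
   For phi0 open and closed are exchanged: opening all edges of the connected
   set containing the boundary of F leaves a measure dominating phi1 in F. *)

Require Import Defs.
From HB Require Import structures.
From mathcomp Require Import all_boot all_order all_algebra.
From mathcomp Require Import finmap.
From mathcomp Require Import all_classical all_reals all_analysis.
From mathcomp Require Import measurable_realfun zify ring lra.
Import Order.TTheory GRing.Theory Num.Theory.
Import numFieldNormedType.Exports.

Set Implicit Arguments.
Unset Strict Implicit.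
Unset Printing Implicit Defensive.

Local Open Scope classical_set_scope.
Local Open Scope ring_scope.

(** * The four functions theorem and the FKG inequality *)

(** Two symmetry groups are at work. Automorphisms of G make the translates of [e0] equally likely
    to be open and supply a positive density of them in F. The group [Gam] of the coding acts on the
    line graph and is not assumed to come from automorphisms of G; it only serves to find one radius
    r that works for all edges. That distinct laws already differ on a single edge is more than
    domination: the number of open edges of a finite set minus the indicator that all of them are
    open is increasing, so a discrepancy on any cylinder forces one on some edge. All comparisons
    are inequalities between unnormalized sums over configurations in a finite volume L, and only
    expectations of local functions pass to the limit; no conditioning takes place in infinite
    volume. Closing an edge costs a factor built from 1 - p, opening one a factor built from p / q.
    These vanish at p = 1 and p = 0, where both measures give every edge the same probability.
    Connectedness of the opened set makes F see the wired condition: separate boundary pieces might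
    or might not be joined outside F, and the weight would not factor. *)

Section SubsetSums.
Local Open Scope fset_scope.
Context (R : realFieldType) (K : choiceType).
Implicit Types (X Y A B : {fset K}) (f g w a b c d : {fset K} -> R).

Lemma big_fpowersetU1 (M : nmodType) X (x : K) (f : {fset K} -> M) :
  x \notin X ->
  \sum_(A <- fpowerset (x |` X)) f A =
  \sum_(A <- fpowerset X) (f A + f (x |` A)).
Proof.
move=> xX; rewrite big_split /=.
rewrite -(big_map (fun A => x |` A) xpredT f) -big_cat.
apply: perm_big; apply: uniq_perm; first exact: fset_uniq.
  rewrite cat_uniq fset_uniq /= map_inj_in_uniq ?fset_uniq ?andbT.
    apply/hasPn => _ /mapP[A _ ->]; apply/negP.
    rewrite fpowersetE => /fsubsetP /(_ x); rewrite fset1U1 => /(_ isT).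
    by rewrite (negPf xX).
  move=> A B; rewrite !fpowersetE => AX BX eqAB.
  have notin C : C `<=` X -> x \notin C by move=> /fsubsetP CX; apply: contra xX; apply: CX.
  by rewrite -(fsetU1K (notin _ AX)) eqAB fsetU1K // notin.
move=> A; rewrite mem_cat !fpowersetE; apply/idP/orP => [AX|[AX|/mapP[B]]].
- have [xA|xA] := boolP (x \in A).
    right; apply/mapP; exists (A `\ x); last by rewrite fsetD1K.
    by rewrite fpowersetE fsubDset.
  left; apply/fsubsetP => y yA; have := fsubsetP AX y yA.
  by rewrite in_fset1U => /orP[/eqP yx|//]; rewrite -yx yA in xA.
- exact: fsubset_trans AX (fsubsetU1 _ _).
- by rewrite fpowersetE => BX ->; exact: fsetUS.
Qed.

Lemma big_fpowersetU (M : nmodType) X Y (f : {fset K} -> M) : [disjoint X & Y] ->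
  \sum_(A <- fpowerset (X `|` Y)) f A =
  \sum_(A <- fpowerset X) \sum_(B <- fpowerset Y) f (A `|` B).
Proof.
elim/fset1U_rect: X f => [|x X xX IH] f XY.
  rewrite fset0U fpowerset0 big_seq_fset1; apply: eq_bigr => B _.
  by rewrite fset0U.
have [xY XY'] : x \notin Y /\ [disjoint X & Y].
  move: XY; rewrite fdisjointUX fdisjoint1X => /andP[? ?].
  by split.
rewrite -fsetUA big_fpowersetU1 ?inE ?negb_or ?xX //.
rewrite (IH _ XY') big_fpowersetU1 //; apply: eq_bigr => A _.
by rewrite -big_split /=; apply: eq_bigr => B _; rewrite fsetUA.
Qed.

(** The one-point case. Put u = c1 d0. From (u - a0 b1)(u - a1 b0) >= 0 and (a0 b0)(a1 b1) <= (c0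
    d0)(c1 d1) = u c0 d1 one gets a0 b1 + a1 b0 <= u + c0 d1 after division by u. *)
Lemma four_functions1 (a0 a1 b0 b1 c0 c1 d0 d1 : R) :
  0 <= a0 -> 0 <= a1 -> 0 <= b0 -> 0 <= b1 ->
  0 <= c0 -> 0 <= c1 -> 0 <= d0 -> 0 <= d1 ->
  a0 * b0 <= c0 * d0 -> a0 * b1 <= c1 * d0 ->
  a1 * b0 <= c1 * d0 -> a1 * b1 <= c1 * d1 ->
  (a0 + a1) * (b0 + b1) <= (c0 + c1) * (d0 + d1).
Proof.
move=> a0p a1p b0p b1p c0p c1p d0p d1p h00 h01 h10 h11.
(* If u = 0 both mixed products on the left vanish, and the diagonal ones are bounded directly. *)
have [u0|un0] := eqVneq (c1 * d0) 0.
  have := mulr_ge0 c0p d1p; have := mulr_ge0 a0p b1p; have := mulr_ge0 a1p b0p.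
  rewrite u0 in h01 h10; nra.
have up : 0 < c1 * d0 by rewrite lt_def un0 mulr_ge0.
rewrite -(ler_pM2l up).
have h1 : 0 <= (c1 * d0 - a0 * b1) * (c1 * d0 - a1 * b0).
  by apply: mulr_ge0; rewrite subr_ge0.
have h2 : (a0 * b0) * (a1 * b1) <= (c0 * d0) * (c1 * d1).
  by apply: ler_pM => //; apply: mulr_ge0.
have h3 : c1 * d0 * (a0 * b0) <= c1 * d0 * (c0 * d0) by rewrite ler_pM2l.
have h4 : c1 * d0 * (a1 * b1) <= c1 * d0 * (c1 * d1) by rewrite ler_pM2l.
lra.
Qed.

(** The Ahlswede-Daykin inequality, by induction on the ground set: each function is replaced by its
    sum over the two states of [x], and the one-point case shows that these sums satisfy the
    hypothesis again. *)
Lemma four_functions X a b c d :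
  (forall A, 0 <= a A) -> (forall A, 0 <= b A) ->
  (forall A, 0 <= c A) -> (forall A, 0 <= d A) ->
  (forall A B, A `<=` X -> B `<=` X ->
     a A * b B <= c (A `|` B) * d (A `&` B)) ->
  (\sum_(A <- fpowerset X) a A) * (\sum_(A <- fpowerset X) b A) <=
  (\sum_(A <- fpowerset X) c A) * (\sum_(A <- fpowerset X) d A).
Proof.
elim/fset1U_rect: X a b c d => [|x X xX IH] a b c d a0 b0 c0 d0 abcd.
  rewrite fpowerset0 !big_seq_fset1.
  by have := abcd fset0 fset0; rewrite fsetU0 fsetI0; apply.
rewrite !big_fpowersetU1 //; apply: IH => [A|A|A|A|A B AX BX].
1-4: exact: addr_ge0.
have sub C : C `<=` X -> C `<=` x |` X /\ x |` C `<=` x |` X.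
  by move=> CX; split; [exact: fsubset_trans CX (fsubsetU1 _ _)|exact: fsetUS].
have [[A1 A2] [B1 B2]] := (sub _ AX, sub _ BX).
have xA : x \notin A by apply: contra xX; apply: (fsubsetP AX).
have xB : x \notin B by apply: contra xX; apply: (fsubsetP BX).
apply: four_functions1 => //; first exact: abcd.
- have := abcd _ _ A1 B2; rewrite fsetUCA.
  suff -> : A `&` (x |` B) = A `&` B by [].
  apply/fsetP => y; rewrite !inE; case: eqP => [->|//].
  by rewrite (negPf xA).
- have := abcd _ _ A2 B1; rewrite -fsetUA.
  suff -> : (x |` A) `&` B = A `&` B by [].
  apply/fsetP => y; rewrite !inE; case: eqP => [->|//].
  by rewrite (negPf xB) !andbF.
- have := abcd _ _ A2 B2; rewrite -fsetUIr.
  suff -> : (x |` A) `|` (x |` B) = x |` (A `|` B) by [].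
  by rewrite fsetUACA fsetUid.
Qed.

Definition increasing_on X f :=
  forall A B, A `<=` B -> B `<=` X -> f A <= f B.

Definition log_supermodular X w :=
  forall A B, A `<=` X -> B `<=` X ->
    w A * w B <= w (A `|` B) * w (A `&` B).

(** The four functions theorem for w f, w g, w f g and w. Leaving the weight unnormalized spares
    divisions in the applications. *)
Lemma fkg X w f g :
  (forall A, 0 <= w A) -> (forall A, 0 <= f A) -> (forall A, 0 <= g A) ->
  log_supermodular X w -> increasing_on X f -> increasing_on X g ->
  (\sum_(A <- fpowerset X) w A * f A) * (\sum_(A <- fpowerset X) w A * g A) <=
  (\sum_(A <- fpowerset X) w A * (f A * g A)) * (\sum_(A <- fpowerset X) w A).
Proof.
move=> w0 f0 g0 wsup fi gi; apply: four_functions => // [A|A|A|A B AX BX].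
1-3: by rewrite !mulr_ge0.
have ABX : A `|` B `<=` X by rewrite fsubUset AX.
have fgAB : f A * g B <= f (A `|` B) * g (A `|` B).
  by rewrite ler_pM // ?fi ?gi // ?fsubsetUl ?fsubsetUr.
have := ler_pM (mulr_ge0 (w0 A) (w0 B)) (mulr_ge0 (f0 A) (g0 B)) (wsup _ _ AX BX) fgAB.
nra.
Qed.

(** This is [fkg] for the increasing function 1 - g, whence the bound g <= 1. *)
Lemma fkg_decreasing X w f g :
  (forall A, 0 <= w A) -> (forall A, 0 <= f A) ->
  (forall A, 0 <= g A <= 1) ->
  log_supermodular X w -> increasing_on X f ->
  (forall A B, A `<=` B -> B `<=` X -> g B <= g A) ->
  (\sum_(A <- fpowerset X) w A * (f A * g A)) * (\sum_(A <- fpowerset X) w A) <=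
  (\sum_(A <- fpowerset X) w A * f A) * (\sum_(A <- fpowerset X) w A * g A).
Proof.
move=> w0 f0 g01 wsup fi gd.
have := @fkg X w f (fun A => 1 - g A) w0 f0.
have sumB h : \sum_(A <- fpowerset X) w A * (h A * (1 - g A)) =
    \sum_(A <- fpowerset X) w A * h A - \sum_(A <- fpowerset X) w A * (h A * g A).
  by rewrite -sumrB; apply: eq_bigr => A _; ring.
rewrite sumB.
have -> : \sum_(A <- fpowerset X) w A * (1 - g A) =
    \sum_(A <- fpowerset X) w A - \sum_(A <- fpowerset X) w A * g A.
  by rewrite -sumrB; apply: eq_bigr => A _; ring.
rewrite mulrBr mulrBl => /(_ _ wsup fi); rewrite lerD2l lerN2; apply.
  by move=> A; have /andP[_ ?] := g01 A; rewrite subr_ge0.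
by move=> A B AB BX; rewrite lerD2l lerN2 gd.
Qed.

End SubsetSums.

(** * Open clusters *)

Section Clusters.
Context (V : choiceType) (G : sgraph V).
Local Open Scope fset_scope.
Implicit Types (A : {fset edge G}) (L F : {fset V}) (B U C : set V).

Lemma edgeP (e : edge G) : exists u v, G u v /\ val e = [fset u; v].
Proof.
case: e => e /= /andP[/eqP e2 /forallP eG].
have /fset0Pn[u ue] : e != fset0 by rewrite -cardfs_gt0 e2.
have := cardfsD1 u e; rewrite ue e2 add1n => -[/esym/eqP/cardfs1P[v ev]].
have vD : v \in e `\ u by rewrite ev in_fset1.
move: vD; rewrite in_fsetD1 => /andP[vu ve]; exists u, v; split.
  by have /forallP /(_ [` ve]) /implyP := eG [` ue]; apply; rewrite eq_sym.
by rewrite -ev fsetD1K.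
Qed.

(** Connectivity lives on all of [V] with the set of open edges as an argument, so that clusters in
    different volumes can be compared without casts; [connect_conn] relates it to the relation on
    the finite type of vertices of [L]. *)
Inductive conn A (u : V) : V -> Prop :=
| conn_refl : conn A u u
| conn_step x y e : conn A u x -> e \in A -> val e = [fset x; y] -> conn A u y.

Lemma conn1 A e x y : e \in A -> val e = [fset x; y] -> conn A x y.
Proof. exact/conn_step/conn_refl. Qed.

Lemma conn_trans A u v w : conn A u v -> conn A v w -> conn A u w.
Proof. by move=> uv; elim=> // x y e _ ux; exact: conn_step. Qed.

Lemma conn_sym A u v : conn A u v -> conn A v u.
Proof.
elim=> [|x y e _ xu eA exy]; first exact: conn_refl.
by apply: conn_trans xu; apply: conn1 eA _; rewrite exy fsetUC.
Qed.

Lemma connS A A' u v : A `<=` A' -> conn A u v -> conn A' u v.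
Proof.
move=> /fsubsetP AA'; elim=> [|x y e _ ux /AA' eA']; first exact: conn_refl.
exact: conn_step eA'.
Qed.

Lemma conn_in A L u v : A `<=` edges_in G L -> u \in L -> conn A u v -> v \in L.
Proof.
move=> /fsubsetP AL uL; elim=> // x y e _ xL /AL; rewrite in_edges_in => /fsubsetP eL ee.
by apply: eL; rewrite ee fset22.
Qed.

Definition component A u : set V := [set v | conn A u v].

Lemma component_refl A u : component A u u. Proof. exact: conn_refl. Qed.

Lemma eq_component A u v : conn A u v -> component A u = component A v.
Proof.
move=> uv; apply/seteqP; split=> w /=; last exact: conn_trans.
by move/(conn_trans (conn_sym uv)).
Qed.

Lemma component_conn A u v : component A u = component A v -> conn A u v.
Proof. by move=> uv; rewrite -[conn A u v]/(component A u v) uv; exact: component_refl. Qed.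

Definition components_in A L : {fset set V} := [fset component A u | u in L].

(** One count covers k^0, k^1 and the partial counts into which they split when boundary conditions
    on a subset are compared. *)
Definition knum A L U B : nat :=
  #|` [fset C in components_in A L | `[< C `&` U !=set0 /\ C `&` B = set0 >]%classic ]|.

Lemma components_inP A L C :
  reflect (exists2 u, u \in L & C = component A u) (C \in components_in A L).
Proof. by apply: (iffP (imfsetP _ _ _ _)) => -[u uL ->]; exists u. Qed.

Lemma knum_memP A L U B C :
  reflect (exists u, [/\ u \in L, C = component A u, (C `&` U !=set0)%classic &
    (C `&` B = set0)%classic])
   (C \in [fset C in components_in A L | `[< C `&` U !=set0 /\ C `&` B = set0 >]%classic ]).
Proof.
rewrite !inE /=; apply: (iffP andP) => [[/components_inP[u uL ->] /asboolP[? ?]]|[u [uL -> ? ?]]].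
  by exists u.
by split; [apply/components_inP; exists u|apply/asboolP].
Qed.

Lemma leq_knum A L U B : (knum A L U B <= #|` L|)%N.
Proof.
apply: (@leq_trans #|` components_in A L|); last exact: leq_imfset_card.
by apply: fsubset_leq_card; apply/fsubsetP => C; rewrite !inE => /andP[].
Qed.

(* A component of A' is charged to the A-component of a point of U that it
   contains. *)
Lemma leq_knum_conn A A' L U B : A' `<=` edges_in G L ->
  (forall u v, U u -> U v \/ B v -> conn A u v -> conn A' u v) ->
  (knum A' L U B <= knum A L U B)%N.
Proof.
move=> AL AA'; have [->|/fset0Pn[x0 _]] := eqVneq L fset0.
  by have := leq_knum A' fset0 U B; rewrite cardfs0 leqn0 => /eqP ->.
pose pt C := xget x0 (C `&` U)%classic.
have ptP C : C \in [fset C in components_in A' L |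
    `[< C `&` U !=set0 /\ C `&` B = set0 >]%classic ] ->
  exists u, [/\ u \in L, conn A' u (pt C), U (pt C), C = component A' u &
  (C `&` B = set0)%classic].
  move=> /knum_memP[u [uL CE CU CB]]; exists u.
  have [ptC ptU] : (C `&` U)%classic (pt C).
    by case: CU => x Cx; exact: (xgetI x0 Cx).
  by split=> //; move: ptC; rewrite [X in X _]CE.
have inj : {in [fset C in components_in A' L |
    `[< C `&` U !=set0 /\ C `&` B = set0 >]%classic ] &, injective (fun C => component A (pt C))}.
  move=> C D /ptP[u [uL upt Upt CE CB]] /ptP[v [vL vpt Vpt DE DB]].
  move=> /component_conn /(AA' _ _ Upt (or_introl Vpt)) pq.
  rewrite CE DE; apply: eq_component; apply: conn_trans upt _.
  exact: conn_trans pq (conn_sym vpt).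
rewrite {1}/knum -(card_in_imfset imfset_key inj).
apply: fsubset_leq_card; apply/fsubsetP => _ /imfsetP[C /= /ptP[u [uL upt Upt CE CB]] ->].
apply/knum_memP; exists (pt C); split => //.
- exact: conn_in upt.
- by exists (pt C); split=> //; exact: component_refl.
- rewrite -subset0 => w [Cw Bw]; rewrite -CB; split=> //; rewrite CE.
  by apply: conn_trans upt _; apply: AA' => //; right.
Qed.

Lemma knum_anti A A' L U B : A `<=` A' -> A' `<=` edges_in G L ->
  (knum A' L U B <= knum A L U B)%N.
Proof. by move=> AA' AL; apply: leq_knum_conn => // u v _ _; exact: connS. Qed.

(* This is k^0 for B empty and k^1 for B the inner boundary of L. *)
Definition ktot A L B := knum A L setT B.

Lemma ktot_split A L U B :
  ktot A L B = (knum A L U B + ktot A L (U `|` B))%N.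
Proof.
rewrite /ktot /knum.
set X := [fset C in _ | `[< C `&` setT !=set0 /\ C `&` B = set0 >]%classic].
rewrite -(cardfsID [fset C in X | `[< C `&` U !=set0 >]%classic] X).
congr addn; apply: (congr1 (fun Y : {fset set V} => #|` Y|)); apply/fsetP => C;
  rewrite !inE setIT.
  case: (C \in components_in A L) => //=.
  apply/idP/idP => [/andP[/asboolP[? ?] /andP[_ /asboolP ?]]|/asboolP[[x [Cx Ux]] ?]].
    exact/asboolP.
  have CB : (C !=set0 /\ C `&` B = set0)%classic by split=> //; exists x.
  by rewrite asboolT//= asboolT //; exists x.
case: (C \in components_in A L) => //=.
apply/idP/idP => [/andP[+ /asboolP[C0 CB]]|/asboolP[C0 CUB]].
  rewrite asboolT //= => /asboolPn /set0P/negP; rewrite negbK => /eqP CU.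
  by apply/asboolP; split=> //; rewrite setIUr CU CB setU0.
have [CU CB] : (C `&` U = set0 /\ C `&` B = set0)%classic.
  by move: CUB; rewrite setIUr setU_eq0.
apply/andP; split; last by apply/asboolP.
by rewrite asboolT //=; apply/asboolPn; rewrite CU => -[].
Qed.

Lemma ktotE A L B :
  ktot A L B = #|` [fset C in components_in A L | `[< C `&` B = set0 >]%classic ]|.
Proof.
rewrite /ktot /knum; congr size; congr enum_fset; apply/fsetP => C.
rewrite !inE setIT /=; apply/andP/andP => -[CA /asboolP CP]; split=> //.
  by apply/asboolP; case: CP.
case/components_inP: CA => u _ CE; apply/asboolP; split=> //.
by exists u; rewrite CE; exact: component_refl.
Qed.

Lemma conn_add A e u v x y : val e = [fset u; v] ->
  conn (e |` A) x y =
  (conn A x y \/ (conn A x u \/ conn A x v) /\ (conn A y u \/ conn A y v)).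
Proof.
move=> euv; apply/propext.
have AeA : A `<=` e |` A by exact: fsubsetU1.
have uv : conn (e |` A) u v by apply: conn1 euv; exact: fset1U1.
have to_u z : conn A z u \/ conn A z v -> conn (e |` A) z u.
  by move=> [/(connS AeA)//|/(connS AeA) zv]; exact: conn_trans zv (conn_sym uv).
split; last first.
  move=> [|[/to_u xu /to_u yu]]; first exact: connS.
  exact: conn_trans xu (conn_sym yu).
elim=> [|{}y z f _ IH fA fyz]; first by left; exact: conn_refl.
move: fA fyz; have [->|fe] := eqVneq f e => fA fyz.
  have yuv : y \in [fset u; v] by rewrite -euv fyz fset21.
  have zuv : z \in [fset u; v] by rewrite -euv fyz fset22.
  have end_ w : w \in [fset u; v] -> conn A w u \/ conn A w v.
    by rewrite !inE => /orP[/eqP ->|/eqP ->]; [left|right]; exact: conn_refl.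
  right; split; last exact: end_.
  case: IH => [xy|[]//]; move: yuv; rewrite !inE => /orP[/eqP yE|/eqP yE].
    by left; rewrite -yE.
  by right; rewrite -yE.
have yz : conn A y z.
  by apply: conn1 fyz; move: fA; rewrite in_fset1U (negPf fe).
case: IH => [xy|[xuv yuv]]; first by left; exact: conn_trans xy yz.
by right; split=> //; case: yuv => /(conn_trans (conn_sym yz)); [left|right].
Qed.

(** The loss in the count when the edge uv is opened. Two counted clusters become one, or a counted
    cluster is absorbed by one that meets [B]; merging two clusters that both meet [B] loses
    nothing. *)
Definition kdrop A B u v : bool :=
  `[< ~ conn A u v /\ (component A u `&` B = set0 \/ component A v `&` B = set0)%classic >].

Lemma ktot_add A L B e u v : u \in L -> v \in L -> val e = [fset u; v] ->
  ktot A L B = (ktot (e |` A) L B + kdrop A B u v)%N.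
Proof.
move=> uL vL euv; rewrite !ktotE.
have [uv|nuv] := pselect (conn A u v).
  rewrite /kdrop asboolF ?addn0; last by case.
  congr size; congr enum_fset; apply/fsetP => C; rewrite !inE; congr (_ && _).
  suff clE x : component (e |` A) x = component A x.
    by apply/components_inP/components_inP => -[x xL ->]; exists x => //; rewrite clE.
  apply/seteqP; split=> y; rewrite /component /= (conn_add _ _ _ euv); last by left.
  have vu := conn_sym uv.
  have to_u z : conn A z u \/ conn A z v -> conn A z u.
    by move=> [//|zv]; exact: conn_trans zv vu.
  by move=> [//|[/to_u xu /to_u /conn_sym]]; exact: conn_trans.
set X := [fset C in components_in A L | _]; set X' := [fset C in components_in (e |` A) L | _].
pose Cu := component A u; pose Cv := component A v; pose D := (Cu `|` Cv)%classic.
have CuvN : Cu != Cv by apply/eqP => /component_conn.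
have clD x : conn A x u \/ conn A x v -> component (e |` A) x = D.
  move=> xuv; apply/seteqP; split=> y; rewrite /component /= (conn_add _ _ _ euv).
    move=> [xy|[_ [yu|yv]]]; [|by left; exact: conn_sym|by right; exact: conn_sym].
    by case: xuv => [xu|xv]; [left|right]; apply: conn_trans xy; exact: conn_sym.
  by move=> [uy|vy]; right; split=> //; [left|right]; exact: conn_sym.
have clN x : ~ (conn A x u \/ conn A x v) -> component (e |` A) x = component A x.
  move=> xuv; apply/seteqP; split=> y; rewrite /component /= (conn_add _ _ _ euv); last by left.
  by move=> [//|[]].
(* Opening the edge changes only [Cu] and [Cv], which are replaced by their union [D]. *)
have YE : X' `\ D = X `\ Cu `\ Cv.
  apply/fsetP => C; rewrite !inE; apply/idP/idP.
    move=> /and3P[/eqP CD /components_inP[x xL CE] Cav].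
    have xuv : ~ (conn A x u \/ conn A x v) by move=> /clD; rewrite -CE.
    rewrite clN // in CE; rewrite Cav andbT; apply/and3P; split.
    - by apply/eqP => CCv; apply: xuv; right; apply: component_conn; rewrite -CE.
    - by apply/eqP => CCu; apply: xuv; left; apply: component_conn; rewrite -CE.
    - by apply/components_inP; exists x.
  move=> /and4P[/eqP CCv /eqP CCu /components_inP[x xL CE] Cav]; rewrite Cav andbT.
  have xuv : ~ (conn A x u \/ conn A x v).
    by move=> [/eq_component xE|/eq_component xE]; [apply: CCu|apply: CCv]; rewrite CE.
  apply/andP; split; last by apply/components_inP; exists x; rewrite // clN.
  apply/eqP => CD; apply: xuv; left.
  have : D u by left; exact: component_refl.
  by rewrite -CD CE.
rewrite (cardfsD1 Cu X) (cardfsD1 Cv (X `\ Cu)) (cardfsD1 D X') YE.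
have -> : Cu \in X = `[< Cu `&` B = set0 >]%classic.
  by rewrite !inE /= (introT (components_inP _ _ _)) //; exists u.
have -> : Cv \in X `\ Cu = `[< Cv `&` B = set0 >]%classic.
  by rewrite !inE /= eq_sym CuvN (introT (components_inP _ _ _)) //; exists v.
have -> : D \in X' = `[< Cu `&` B = set0 >]%classic && `[< Cv `&` B = set0 >]%classic.
  rewrite !inE /= (introT (components_inP _ _ _)) ?andTb; last first.
    by exists u => //; rewrite clD //; left; exact: conn_refl.
  by rewrite /D setIUl setU_eq0 asbool_and.
have -> : kdrop A B u v = `[< Cu `&` B = set0 >]%classic || `[< Cv `&` B = set0 >]%classic.
  by rewrite /kdrop asbool_and (asboolT nuv) asbool_or.
by move: `[< Cu `&` B = set0 >]%classic `[< Cv `&` B = set0 >]%classic => [] [] /=; lia.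
Qed.

Lemma kdrop_anti A A' B u v : A `<=` A' -> (kdrop A' B u v <= kdrop A B u v)%N.
Proof.
move=> AA'; rewrite /kdrop; case: asboolP => //= -[nuv CB]; rewrite asboolT //.
have sub x : (component A x `<=` component A' x)%classic by move=> y; exact: connS.
split; first by move=> /(connS AA').
by case: CB => CB; [left|right]; rewrite -subset0 -CB; apply: setSI; exact: sub.
Qed.

(** Since [kdrop] is antitone in the configuration, opening the edges of [S] one at a time loses at
    most as many clusters over [A'] as over [A]. *)
Lemma ktot_supermodular A A' L B S :
  A `<=` A' -> S `<=` edges_in G L ->
  (ktot A L B + ktot (S `|` A') L B >= ktot (S `|` A) L B + ktot A' L B)%N.
Proof.
move=> AA'; elim/fset1U_rect: S => [|e S eS IH] SL; first by rewrite !fset0U addnC.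
have [u [v [_ euv]]] := edgeP e.
have /fsubsetP eL : val e `<=` L.
  by rewrite -in_edges_in; apply: (fsubsetP SL); exact: fset1U1.
have uL : u \in L by apply: eL; rewrite euv fset21.
have vL : v \in L by apply: eL; rewrite euv fset22.
have := IH (fsubset_trans (fsubsetU1 _ _) SL).
rewrite (ktot_add (S `|` A) _ uL vL euv) (ktot_add (S `|` A') _ uL vL euv) !fsetUA.
have := @kdrop_anti (S `|` A) (S `|` A') B u v (fsetUS _ AA').
move: (nat_of_bool _) (nat_of_bool _) => d d'.
move: (ktot _ _ _) (ktot _ _ _) (ktot _ _ _) (ktot _ _ _) => *; lia.
Qed.

Lemma ktot_setUI A A' L B : A `<=` edges_in G L ->
  (ktot A L B + ktot A' L B <= ktot (A `|` A') L B + ktot (A `&` A') L B)%N.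
Proof.
move=> AL; have := @ktot_supermodular (A `&` A') A' L B A (fsubsetIr _ _) AL.
by rewrite (fsetUidPl _ _ (fsubsetIl _ _)); lia.
Qed.

End Clusters.

(** * Splitting the cluster count along a finite vertex set *)

Section Decompositions.
Context (V : choiceType) (G : sgraph V).
Local Open Scope fset_scope.
Implicit Types (A : {fset edge G}) (L F : {fset V}) (B U C : set V).

Lemma leq_ktot_add A L B S : S `<=` edges_in G L ->
  (ktot A L B <= ktot (S `|` A) L B + #|` S|)%N.
Proof.
elim/fset1U_rect: S => [|e S eS IH] SL; first by rewrite fset0U leq_addr.
have [u [v [_ euv]]] := edgeP e.
have /fsubsetP eL : val e `<=` L.
  by rewrite -in_edges_in; apply: (fsubsetP SL); exact: fset1U1.
have uL : u \in L by apply: eL; rewrite euv fset21.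
have vL : v \in L by apply: eL; rewrite euv fset22.
have := IH (fsubset_trans (fsubsetU1 _ _) SL).
rewrite (ktot_add (S `|` A) _ uL vL euv) -fsetUA cardfsU1 eS add1n.
have := leq_b1 (kdrop (S `|` A) B u v).
move: (nat_of_bool _) => d. move: (#|` _|) (ktot _ _ _) (ktot _ _ _) => *. lia.
Qed.

Definition crossing L F : {fset edge G} :=
  [fset e in edges_in G L | (val e `&` F != fset0) && ~~ (val e `<=` F)].

Lemma in_crossing L F e : (e \in crossing L F) =
  [&& val e `<=` L, val e `&` F != fset0 & ~~ (val e `<=` F)].
Proof. by rewrite -in_edges_in /crossing inE. Qed.

Lemma conn_eq_in A A' (X : set V) u v : X u ->
  (forall x y (e : edge G), X x -> e \in A -> val e = [fset x; y] -> e \in A' /\ X y) ->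
  conn A u v -> conn A' u v /\ X v.
Proof.
move=> Xu AA'; elim; first by split=> //; exact: conn_refl.
move=> x y e _ [ux Xx] eA exy; have [eA' Xy] := AA' _ _ _ Xx eA exy.
by split=> //; exact: conn_step exy.
Qed.

Lemma eq_component_in A A' (X : set V) u : A' `<=` A -> X u ->
  (forall x y (e : edge G), X x -> e \in A -> val e = [fset x; y] -> e \in A' /\ X y) ->
  component A u = component A' u.
Proof.
move=> AA' Xu H; apply/seteqP; split=> v; last exact: connS.
by case/(conn_eq_in Xu H).
Qed.

(** With the crossing edges closed, no cluster has vertices on both sides. As [B] misses F, the
    clusters in F are all counted: F sees the free condition whatever the condition on L is. *)
Lemma ktot_no_crossing A1 A2 L F B : F `<=` L ->
  A1 `<=` edges_in G F -> A2 `<=` edges_in G L `\` edges_in G F ->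
  [disjoint A2 & crossing L F] -> (forall x, x \in F -> ~ B x) ->
  ktot (A1 `|` A2) L B = (ktot A1 F set0 + ktot A2 (L `\` F) B)%N.
Proof.
move=> FL /fsubsetP A1F /fsubsetP A2L /fdisjointP A2c BF.
have A2F e x y : e \in A2 -> val e = [fset x; y] -> x \notin F.
  move=> eA2 exy; have := A2L _ eA2; rewrite in_fsetD !in_edges_in => /andP[eF eL].
  have := A2c _ eA2; rewrite in_crossing eL eF andbT /= negbK => /eqP e0.
  by apply/negP => xF; have := in_fset0 x; rewrite -e0 inE exy fset21 xF.
have A1in e x y : e \in A1 -> val e = [fset x; y] -> x \in F.
  move=> /A1F; rewrite in_edges_in => /fsubsetP eF exy; apply: eF.
  by rewrite exy fset21.
have cl1 x : x \in F -> component (A1 `|` A2) x = component A1 x.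
  move=> xF; apply: (@eq_component_in _ _ [set x | x \in F]) => //; first exact: fsubsetUl.
  move=> {xF}x y e /= xF; rewrite inE => /orP[eA1 exy|eA2 /(A2F _ _ _ eA2)].
    by split=> //; apply: (A1in e y x eA1); rewrite fsetUC.
  by rewrite xF.
have cl2 x : x \notin F -> component (A1 `|` A2) x = component A2 x.
  move=> xF; apply: (@eq_component_in _ _ [set x | x \notin F]) => //; first exact: fsubsetUr.
  move=> {xF}x y e /= xF; rewrite inE => /orP[eA1 /(A1in _ _ _ eA1)|eA2 exy].
    by rewrite (negPf xF).
  by split=> //; apply: (A2F e y x eA2); rewrite fsetUC.
have clF x y : x \in F -> component A1 x y -> y \in F.
  by move=> xF; apply: conn_in xF; apply/fsubsetP.
rewrite !ktotE; set X := [fset C in _ | _]; set X1 := [fset C in _ | _]; set X2 := [fset C in _ | _].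
have -> : X = X1 `|` X2.
  apply/fsetP => C; rewrite !inE; apply/idP/idP.
    move=> /andP[/components_inP[x xL ->] avB].
    have [xF|xF] := boolP (x \in F); last first.
      apply/orP; right; rewrite avB andbT cl2 //; apply/components_inP; exists x => //.
      by rewrite in_fsetD xF.
    apply/orP; left; rewrite cl1 //; apply/andP; split; first by apply/components_inP; exists x.
    by apply/asboolP; rewrite setI0.
  move=> /orP[|] /andP[/components_inP[x xF ->] avB]; apply/andP; split.
  - by apply/components_inP; exists x; rewrite ?cl1 //; apply: (fsubsetP FL).
  - apply/asboolP; rewrite -subset0 => y [/(clF _ _ xF) yF /BF]; exact.
  - move: xF; rewrite inE => /andP[xF xL].
    by apply/components_inP; exists x; rewrite ?cl2.
  - by [].
rewrite -cardfsUI; suff -> : X1 `&` X2 = fset0 by rewrite cardfs0 addn0.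
apply/fsetP => C; rewrite !inE; apply/negP.
move=> /andP[/andP[/components_inP[x xF ->] _] /andP[/components_inP[y]]].
rewrite inE => /andP[yF yL] xy _.
have := component_refl A2 y; rewrite -xy => /(clF _ _ xF).
by rewrite (negPf yF).
Qed.

Definition inner_bd L : set V := [set u | u \in L /\ exists2 v, v \notin L & G u v].

Lemma inner_edge F A e x y : x \in F -> ~ inner_bd F x -> val e = [fset x; y] ->
  e \in edges_in G F.
Proof.
move=> xF xbd exy; rewrite in_edges_in; apply/fsubsetP => z.
rewrite exy !inE => /orP[/eqP -> //|/eqP ->]; apply/negPn/negP => yF.
apply: xbd; split=> //; exists y => //.
have [u [v [uv]]] := edgeP e; rewrite exy => xyE.
have /fset2P[xE|xE] : x \in [fset u; v] by rewrite -xyE fset21.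
  have /fset2P[yE|->] : y \in [fset u; v] by rewrite -xyE fset22.
    by move: yF; rewrite yE -xE xF.
  by rewrite xE.
have /fset2P[->|yE] : y \in [fset u; v] by rewrite -xyE fset22.
  by rewrite xE adj_sym.
by move: yF; rewrite yE -xE xF.
Qed.

(** A cluster that avoids the complement and the inner boundary of F uses only edges inside F, so it
    is one of those counted by k^1 in F. *)
Lemma ktot_avoid_outside A L F U : F `<=` L -> A `<=` edges_in G L ->
  (forall x, x \in L -> U x <-> (x \notin F \/ inner_bd F x)) ->
  ktot A L U = ktot (A `&` edges_in G F) F (inner_bd F).
Proof.
move=> FL AL UE; rewrite !ktotE; congr size; congr enum_fset; apply/fsetP => C.
have notU x : x \in L -> ~ U x -> x \in F /\ ~ inner_bd F x.
  move=> xL; rewrite UE // => /not_orP[/negP]; rewrite negbK; by split.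
have Fedge x y e : x \in F -> ~ inner_bd F x -> e \in A -> val e = [fset x; y] ->
    e \in A `&` edges_in G F /\ y \in F.
  move=> xF xbd eA exy; have eF := inner_edge A xF xbd exy.
  rewrite inE eA eF; split=> //.
  by move: eF; rewrite in_edges_in => /fsubsetP; apply; rewrite exy fset22.
rewrite !inE; apply/andP/andP => -[/components_inP[x xL ->] /asboolP av].
  have clU y : component A x y -> ~ U y.
    by move=> xy Uy; have : (component A x `&` U)%classic y by []; rewrite av.
  have [xF xbd] := notU _ xL (clU _ (component_refl A x)).
  have clE : component A x = component (A `&` edges_in G F) x.
    apply/seteqP; split=> y; last exact/connS/fsubsetIl.
    elim=> [|{}y z e xy IH eA eyz]; first exact: conn_refl.
    have yL := conn_in AL xL xy.
    have [yF ybd] := notU _ yL (clU _ xy).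
    have [eF _] := Fedge _ _ _ yF ybd eA eyz; exact: conn_step IH eF eyz.
  split; first by apply/components_inP; exists x.
  apply/asboolP; rewrite -subset0 => y [xy [yF ybd]].
  by apply: (clU _ xy); rewrite UE; [right|exact: (conn_in AL xL xy)].
have clbd y : component (A `&` edges_in G F) x y -> y \in F /\ ~ inner_bd F y.
  move=> xy; split; first by apply: conn_in xL xy; exact: fsubsetIr.
  by move=> ybd; have : (component (A `&` edges_in G F)%fset x `&` inner_bd F)%classic y by [];
    rewrite av.
have clE : component A x = component (A `&` edges_in G F) x.
  apply: (@eq_component_in _ _ (component (A `&` edges_in G F) x)); first exact: fsubsetIl.
    exact: component_refl.
  move=> y z e xy eA eyz; have [yF ybd] := clbd _ xy.
  have [eAF zF] := Fedge _ _ _ yF ybd eA eyz; split=> //.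
  exact: conn_step eyz.
split; first by apply/components_inP; exists x => //; exact: (fsubsetP FL).
apply/asboolP; rewrite -subset0 => y [/clbd[yF ybd]].
by rewrite UE ?(fsubsetP FL) // yF => -[].
Qed.

Definition outside F : set V := [set x | x \notin F \/ inner_bd F x].

Lemma ktot_wired_split A L F : F `<=` L -> A `<=` edges_in G L ->
  ktot A L (inner_bd L) =
  (knum A L (outside F) (inner_bd L) +
   ktot (A `&` edges_in G F) F (inner_bd F))%N.
Proof.
move=> FL AL; rewrite (ktot_split _ _ (outside F)) (ktot_avoid_outside FL AL) //.
move=> x xL; split=> [[//|[_ [v vL xv]]]|]; last by left.
have [xF|] := boolP (x \in F); last by left.
by right; split=> //; exists v => //; apply: contra vL; apply: (fsubsetP FL).
Qed.

Lemma conn_connected (K : {fset V}) A u v : connected_on G [set` K] ->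
  edges_in G K `<=` A -> u \in K -> v \in K -> conn A u v.
Proof.
move=> Kc KA uK vK; have [s [us <- sK]] := Kc u v uK vK.
elim: s u us uK sK {vK} => [|x s IH] u /=; first by move=> *; exact: conn_refl.
move=> /andP[ux xs] uK sK.
have xK : x \in K by apply: sK; rewrite inE eqxx.
have uxE : is_edge G [fset u; x].
  have uNx : u != x by apply/eqP => uE; move: ux; rewrite uE adj_irr.
  rewrite /is_edge cardfs2 uNx eqxx /=; apply/'forall_forallP => a b.
  apply/implyP => ab; move: (valP a) (valP b); rewrite !inE.
  move=> /orP[/eqP aE|/eqP aE] /orP[/eqP bE|/eqP bE]; rewrite ?aE ?bE //.
  - by move: ab; rewrite -val_eqE /= aE bE eqxx.
  - by rewrite adj_sym.
  - by move: ab; rewrite -val_eqE /= aE bE eqxx.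
apply: (@conn_trans _ _ _ _ x).
  apply: (@conn1 _ _ _ (Sub [fset u; x] uxE : edge G)) => //.
  apply: (fsubsetP KA); rewrite in_edges_in; apply/fsubsetP => z.
  by rewrite !inE => /orP[/eqP ->|/eqP ->].
by apply: IH => // y ys; apply: sK; rewrite inE ys orbT.
Qed.

(* An excursion inside F between two points outside its interior starts and
   ends in the inner boundary, hence can be replaced by a path in K. *)
Lemma ktot_connected_open A1 A2 L F (K : {fset V}) : F `<=` L ->
  A1 `<=` edges_in G F -> A2 `<=` edges_in G L `\` edges_in G F ->
  connected_on G [set` K] -> (inner_bd F `<=` [set` K])%classic ->
  edges_in G K `<=` A1 `|` A2 ->
  ktot (A1 `|` A2) L set0 =
  (ktot A1 F (inner_bd F) +
   knum (edges_in G K `|` A2) L (outside F) set0)%N.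
Proof.
move=> FL A1F A2L Kc FK KA.
have ELF : edges_in G F `<=` edges_in G L.
  by apply/fsubsetP => e; rewrite !in_edges_in => /fsubset_trans; apply.
have AL : A1 `|` A2 `<=` edges_in G L.
  by rewrite fsubUset (fsubset_trans A1F ELF) (fsubset_trans A2L) // fsubsetDl.
rewrite (ktot_split _ _ (outside F)) setU0 (ktot_avoid_outside FL AL) // addnC.
congr addn.
  congr (ktot _ _ _); rewrite fsetIUl (fsetIidPl A1F).
  suff -> : A2 `&` edges_in G F = fset0 by rewrite fsetU0.
  apply/fsetP => e; rewrite in_fsetI in_fset0; apply/negP => /andP[/(fsubsetP A2L)].
  by rewrite in_fsetD => /andP[/negPf ->].
have A'A : edges_in G K `|` A2 `<=` A1 `|` A2 by rewrite fsubUset KA fsubsetUr.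
apply/eqP; rewrite eqn_leq (knum_anti _ _ A'A AL) andTb.
apply: leq_knum_conn; first exact: fsubset_trans A'A AL.
move=> u v Uu [Uv|//] uv.
have AF e x y : e \in A1 -> val e = [fset x; y] -> x \in F /\ y \in F.
  move=> /(fsubsetP A1F); rewrite in_edges_in => /fsubsetP eF exy.
  by split; apply: eF; rewrite exy ?fset21 ?fset22.
have Kconn x y : inner_bd F x -> inner_bd F y -> conn (edges_in G K `|` A2) x y.
  by move=> /FK xK /FK yK; apply: (conn_connected Kc) => //; exact: fsubsetUl.
have outbd x : outside F x -> x \in F -> inner_bd F x.
  by move=> [xF|//]; rewrite (negPf xF).
(* The invariant along the walk from [u]: inside F, only some inner boundary vertex connected to [u]
   is remembered; when the walk comes out again, K links that vertex to the exit. *)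
suff : (outside F v -> conn (edges_in G K `|` A2) u v) /\
    (v \in F -> exists2 h, inner_bd F h & conn (edges_in G K `|` A2) u h) by case; auto.
elim: uv {Uv} => [|x y e _ [IHo IHi] eA exy].
  by split=> [_|/(outbd _ Uu) ubd]; [exact: conn_refl|exists u => //; exact: conn_refl].
have toF : y \in F -> outside F y ->
    (exists2 h, inner_bd F h & conn (edges_in G K `|` A2) u h) ->
    conn (edges_in G K `|` A2) u y.
  by move=> yF Uy [h hbd uh]; apply: conn_trans uh (Kconn _ _ hbd (outbd _ Uy yF)).
move: (eA); rewrite in_fsetU => /orP[eA1|eA2].
  have [xF yF] := AF _ _ _ eA1 exy.
  have uh := IHi xF.
  by split=> [Uy|_ //]; exact: toF.
have eF : e \notin edges_in G F by move/(fsubsetP A2L): eA2; rewrite in_fsetD => /andP[].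
have Ux : outside F x.
  apply: contrapT => /not_orP[/negP]; rewrite negbK => xF xbd.
  by move: eF; rewrite (inner_edge A1 xF xbd exy).
have uy : conn (edges_in G K `|` A2) u y.
  by apply: conn_step (IHo Ux) _ exy; rewrite in_fsetU eA2 orbT.
split=> // yF; exists y => //; apply: outbd => //.
apply: contrapT => /not_orP[_ ybd]; move: eF.
have eyx : val e = [fset y; x] by rewrite fsetUC.
by rewrite (inner_edge A1 yF ybd eyx).
Qed.

End Decompositions.

(** * Finite-volume random-cluster measures *)

Section Weights.
Local Open Scope fset_scope.
Context (R : realFieldType) (p q : R) (p01 : 0 <= p <= 1) (q1 : 1 <= q).

Definition bern (K : choiceType) (X A : {fset K}) : R :=
  p ^+ #|` A| * (1 - p) ^+ #|` X `\` A|.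

Lemma bern_ge0 (K : choiceType) (X A : {fset K}) : 0 <= bern X A.
Proof. by have /andP[? ?] := p01; rewrite mulr_ge0 // exprn_ge0 // subr_ge0. Qed.

Lemma bernU (K : choiceType) (X Y A B : {fset K}) : [disjoint X & Y] ->
  A `<=` X -> B `<=` Y -> bern (X `|` Y) (A `|` B) = bern X A * bern Y B.
Proof.
move=> XY AX BY; rewrite /bern.
have AB : [disjoint A & B] := fdisjointWl AX (fdisjointWr BY XY).
have -> : (X `|` Y) `\` (A `|` B) = (X `\` A) `|` (Y `\` B).
  apply/fsetP => x; rewrite !in_fsetD !in_fsetU !in_fsetD negb_or.
  have [xA|xA] := boolP (x \in A); have [xB|xB] := boolP (x \in B) => //=.
    by rewrite (negPf (fdisjointP XY x (fsubsetP AX _ xA))).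
  have xX : x \notin X.
    by apply/negP => /(fdisjointP XY); rewrite (fsubsetP BY _ xB).
  by rewrite (negPf xX).
have cardU (C D : {fset K}) : [disjoint C & D] -> #|` C `|` D| = (#|` C| + #|` D|)%N.
  by move=> /eqP CD; rewrite -cardfsUI CD cardfs0 addn0.
rewrite !cardU // ?exprD.
  by move: (p ^+ _) (p ^+ _) ((1 - p) ^+ _) ((1 - p) ^+ _) => *; ring.
apply: fdisjointWl (fsubsetDl _ _) _; exact: fdisjointWr (fsubsetDl _ _) XY.
Qed.

Lemma sum_bern (K : choiceType) (X : {fset K}) :
  \sum_(A <- fpowerset X) bern X A = 1.
Proof.
elim/fset1U_rect: X => [|x X xX IH].
  by rewrite fpowerset0 big_seq_fset1 /bern fsetDv cardfs0 !expr0 mulr1.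
rewrite big_fpowersetU1 // -IH !big_seq; apply: eq_bigr => A.
rewrite fpowersetE => AX.
have dX : [disjoint [fset x] & X] by rewrite fdisjoint1X.
have := bernU dX (fsub0set _) AX; rewrite fset0U => ->.
have := bernU dX (fsubset_refl _) AX => ->.
by rewrite /bern fsetD0 fsetDv !cardfs1 cardfs0; ring.
Qed.

Lemma bern_modular (K : choiceType) (X A B : {fset K}) : A `<=` X -> B `<=` X ->
  bern X A * bern X B = bern X (A `|` B) * bern X (A `&` B).
Proof.
move=> AX BX; rewrite /bern fsetDUr fsetDIr.
have e1 := cardfsUI A B; have e2 := cardfsUI (X `\` A) (X `\` B).
have -> : forall a b c d : nat, p ^+ a * (1 - p) ^+ c * (p ^+ b * (1 - p) ^+ d) =
   p ^+ (a + b) * (1 - p) ^+ (c + d) by move=> *; rewrite !exprD; ring.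
by rewrite -e1 -e2 !exprD [X in _ * X]mulrC mulrACA.
Qed.

Context (V : choiceType) (G : sgraph V).
Implicit Types (A : {fset edge G}) (L F : {fset V}) (e : edge G).

Definition bdy (wired : bool) L : set V := if wired then inner_bd G L else set0.

(* From here on a configuration in L is the finite set A of its open edges. *)
Definition rcw (wired : bool) L A : R :=
  bern (edges_in G L) A * q ^+ ktot A L (bdy wired L).

Lemma q_gt0 : 0 < q. Proof. exact: lt_le_trans ltr01 q1. Qed.

Lemma rcw_ge0 i L A : 0 <= rcw i L A.
Proof. by rewrite mulr_ge0 ?bern_ge0 // exprn_ge0 // ltW // q_gt0. Qed.

(** The Bernoulli factor is modular, and q >= 1 turns supermodularity of the cluster count into the
    FKG lattice condition. *)
Lemma rcw_supermodular i L : log_supermodular (edges_in G L) (rcw i L).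
Proof.
move=> A B AL BL; rewrite /rcw mulrACA [X in _ <= X]mulrACA.
rewrite -bern_modular //; apply: ler_wpM2l; first by rewrite mulr_ge0 ?bern_ge0.
by rewrite -!exprD ler_weXn2l // ktot_setUI.
Qed.

Definition rcZ i L : R := \sum_(A <- fpowerset (edges_in G L)) rcw i L A.

Lemma rcZ_ge1 i L : 1 <= rcZ i L.
Proof.
rewrite -(sum_bern (edges_in G L)); apply: ler_sum => A _.
by rewrite ler_peMr ?bern_ge0 // exprn_ege1.
Qed.

Lemma rcZ_gt0 i L : 0 < rcZ i L.
Proof. exact: lt_le_trans ltr01 (rcZ_ge1 i L). Qed.

Definition rcE i L (f : {fset edge G} -> R) : R :=
  (\sum_(A <- fpowerset (edges_in G L)) rcw i L A * f A) / rcZ i L.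

Lemma rcE_sum i L f :
  \sum_(A <- fpowerset (edges_in G L)) rcw i L A * f A = rcE i L f * rcZ i L.
Proof. by rewrite /rcE mulfVK // gt_eqF // rcZ_gt0. Qed.

Lemma edges_inS F L : F `<=` L -> edges_in G F `<=` edges_in G L.
Proof.
by move=> FL; apply/fsubsetP => e; rewrite !in_edges_in => /fsubset_trans; apply.
Qed.

Lemma edges_in_split F L : F `<=` L ->
  edges_in G L = edges_in G F `|` (edges_in G L `\` edges_in G F).
Proof.
move=> FL; apply/fsetP => e; rewrite in_fsetU in_fsetD.
by case: (boolP (e \in edges_in G F)) => //= /(fsubsetP (edges_inS FL)) ->.
Qed.

Lemma disjoint_edges_in F L :
  [disjoint edges_in G F & edges_in G L `\` edges_in G F].
Proof. by apply/fdisjointP => e eF; rewrite in_fsetD eF. Qed.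

Lemma sum_factor F L (W w1 c : {fset edge G} -> R) : F `<=` L ->
  (forall A1 A2, A1 `<=` edges_in G F -> A2 `<=` edges_in G L `\` edges_in G F ->
     W (A1 `|` A2) = w1 A1 * c A2) ->
  \sum_(A <- fpowerset (edges_in G L)) W A =
  (\sum_(A <- fpowerset (edges_in G F)) w1 A) *
  (\sum_(A <- fpowerset (edges_in G L `\` edges_in G F)) c A).
Proof.
move=> FL WE; rewrite {1}(edges_in_split FL) big_fpowersetU ?disjoint_edges_in //.
rewrite mulr_suml big_seq [RHS]big_seq; apply: eq_bigr => A1; rewrite fpowersetE => A1F.
rewrite mulr_sumr big_seq [RHS]big_seq; apply: eq_bigr => A2; rewrite fpowersetE => A2L.
exact: WE.
Qed.

Lemma mem_split F L A1 A2 e : val e `<=` F -> A2 `<=` edges_in G L `\` edges_in G F ->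
  (e \in A1 `|` A2) = (e \in A1).
Proof.
rewrite -in_edges_in => eF A2L; rewrite in_fsetU orbC.
have -> // : e \in A2 = false.
by apply/negP => /(fsubsetP A2L); rewrite in_fsetD eF.
Qed.

(** The domain Markov property without normalization: when the crossing edges are closed, the weight
    is the free weight of F times a factor that depends on the remaining edges only. *)
Lemma sum_no_crossing i F L (f : {fset edge G} -> R) : F `<=` L ->
  (forall x, x \in F -> ~ bdy i L x) ->
  (forall A1 A2, A1 `<=` edges_in G F -> A2 `<=` edges_in G L `\` edges_in G F ->
     f (A1 `|` A2) = f A1) ->
  \sum_(A <- fpowerset (edges_in G L))
     rcw i L A * (f A * [disjoint A & crossing G L F]%:R) =
  rcE false F f *
  \sum_(A <- fpowerset (edges_in G L)) rcw i L A * [disjoint A & crossing G L F]%:R.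
Proof.
move=> FL FB ff.
have crF : [disjoint edges_in G F & crossing G L F].
  apply/fdisjointP => e; rewrite in_edges_in in_crossing => ->.
  by rewrite !andbF.
pose c A := bern (edges_in G L `\` edges_in G F) A *
  q ^+ ktot A (L `\` F) (bdy i L) * [disjoint A & crossing G L F]%:R.
have factor g : (forall A1 A2, A1 `<=` edges_in G F ->
     A2 `<=` edges_in G L `\` edges_in G F -> g (A1 `|` A2) = g A1) ->
    \sum_(A <- fpowerset (edges_in G L))
      rcw i L A * (g A * [disjoint A & crossing G L F]%:R) =
    (\sum_(A <- fpowerset (edges_in G F)) rcw false F A * g A) *
    (\sum_(A <- fpowerset (edges_in G L `\` edges_in G F)) c A).
  move=> gg; apply: sum_factor => // A1 A2 A1F A2L; rewrite /c gg //.
  have -> : [disjoint A1 `|` A2 & crossing G L F] = [disjoint A2 & crossing G L F].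
    by rewrite fdisjointUX (fdisjointWl A1F crF).
  case: (boolP [disjoint A2 & crossing G L F]%fset) => [A2c|_]; last by rewrite !mulr0.
  rewrite /rcw (edges_in_split FL) bernU ?disjoint_edges_in //.
  rewrite -(edges_in_split FL) (ktot_no_crossing FL A1F A2L A2c FB) exprD.
  move: (bern _ _) (bern _ _) (q ^+ _) (q ^+ _) (g _) (_%:R) => *; ring.
rewrite factor // rcE_sum -mulrA; congr (_ * _).
(* The same factorization with f = 1 identifies the outside sum through the mass of the event. *)
have := factor (fun=> 1) (fun _ _ _ _ => erefl).
under eq_bigr do rewrite mul1r.
under [in RHS]eq_bigr do rewrite mulr1.
by move=> ->.
Qed.

End Weights.

(** * Comparison inequalities and finite energy in finite volume *)

Section FiniteVolume.
Local Open Scope fset_scope.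
Context (R : realFieldType) (p q : R) (p01 : 0 <= p <= 1) (q1 : 1 <= q).
Context (V : choiceType) (G : sgraph V).
Implicit Types (A : {fset edge G}) (L F K : {fset V}) (e : edge G).
Notation rcw := (rcw p q).
Notation rcE := (rcE p q).
Notation rcZ := (rcZ p q G).
Notation bern := (bern p).

Lemma sum_no_crossing_gt0 F L : p < 1 ->
  0 < \sum_(A <- fpowerset (edges_in G L))
    rcw false L A * [disjoint A & crossing G L F]%:R.
Proof.
move=> p1; rewrite (big_fsetD1 fset0) /=; last by rewrite fpowersetE fsub0set.
apply: ltr_pwDl; last by apply: sumr_ge0 => A _; rewrite mulr_ge0 ?rcw_ge0.
rewrite fdisjoint0X mulr1 mulr_gt0 //; last by rewrite exprn_gt0 // q_gt0.
by rewrite /bern cardfs0 mul1r exprn_gt0 // subr_gt0.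
Qed.

(** On the edges of F the free measure of F is that of L conditioned on the crossing edges being
    closed, a decreasing event; FKG gives the inequality, and p < 1 gives the event positive
    mass. *)
Lemma rcE_free_le F L e : p < 1 -> F `<=` L -> val e `<=` F ->
  rcE false F (fun A => (e \in A)%:R) <= rcE false L (fun A => (e \in A)%:R).
Proof.
move=> p1 FL eF.
have gt0 := sum_no_crossing_gt0 F L p1.
have Bd x : x \in F -> ~ bdy G false L x by move=> _ [].
have := @sum_no_crossing _ _ _ p01 q1 _ _ false F L (fun A => (e \in A)%:R) FL Bd.
rewrite -(ler_pM2r gt0) => <-; last first.
  by move=> A1 A2 A1F A2L; rewrite (mem_split _ eF A2L).
rewrite -(ler_pM2r (rcZ_gt0 p01 q1 G false L)).
apply: le_trans (@fkg_decreasing _ _ _ (rcw false L) (fun A => (e \in A)%:R)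
  (fun A => [disjoint A & crossing G L F]%:R) _ _ _ _ _ _) _ => //.
- exact: rcw_ge0.
- by move=> A; case: (fdisjoint _ _); rewrite ler01 lexx.
- exact: rcw_supermodular.
- by move=> A B /fsubsetP AB _; rewrite ler_nat; case: (boolP (e \in A)) => // /AB ->.
- move=> A B AB _; rewrite ler_nat.
  by case: (boolP [disjoint B & crossing G L F]%fset) => // /(fdisjointWl AB) ->.
by rewrite rcE_sum // mulrAC.
Qed.

Lemma rcE_free_le_wired L (f : {fset edge G} -> R) :
  (forall A, 0 <= f A) -> increasing_on (edges_in G L) f ->
  rcE false L f <= rcE true L f.
Proof.
(* The wired weight is the free one times q to the power minus the number of
   clusters meeting the boundary, an increasing function. *)
move=> f0 fi; pose g A : R := q^-1 ^+ knum A L (inner_bd G L) set0.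
have wg h : \sum_(A <- fpowerset (edges_in G L)) rcw true L A * h A =
            \sum_(A <- fpowerset (edges_in G L)) rcw false L A * (h A * g A).
  apply: eq_bigr => A _; rewrite /g /rcw (ktot_split A L (inner_bd G L) set0) setU0 exprD.
  have qn : q ^+ knum A L (inner_bd G L) set0 * q^-1 ^+ knum A L (inner_bd G L) set0 = 1.
    by rewrite -exprMn mulfV ?expr1n // gt_eqF // q_gt0.
  move: qn; move: (q ^+ _) (q^-1 ^+ _) (bern _ _) (q ^+ _) (h _) => a b c d x ab.
  by rewrite -[LHS]mul1r -ab; ring.
have ZE : rcZ true L = \sum_(A <- fpowerset (edges_in G L)) rcw false L A * g A.
  transitivity (\sum_(A <- fpowerset (edges_in G L)) rcw true L A * 1).
    by apply: eq_bigr => A _; rewrite mulr1.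
  by rewrite (wg (fun=> 1)); apply: eq_bigr => A _; rewrite mul1r.
rewrite /rcE ler_pdivrMr ?rcZ_gt0 // mulrAC ler_pdivlMr ?rcZ_gt0 //.
rewrite wg ZE; apply: fkg => //.
- exact: rcw_ge0.
- by move=> A; rewrite exprn_ge0 // invr_ge0 ltW // q_gt0.
- exact: rcw_supermodular.
move=> A B AB BL; apply: ler_wiXn2l; rewrite ?invr_ge0 ?invf_le1 ?q_gt0 //.
  by rewrite ltW // q_gt0.
exact: knum_anti.
Qed.

Lemma rcE_wired_le F L e : F `<=` L -> val e `<=` F ->
  rcE true L (fun A => (e \in A)%:R) <= rcE true F (fun A => (e \in A)%:R).
Proof.
(* Forgetting the clusters that are not contained in the interior of F turns
   the wired measure of L into that of F times independent percolation. *)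
move=> FL eF; pose g A : R := q^-1 ^+ knum A L (outside G F) (inner_bd G L).
have wg (h : {fset edge G} -> R) :
    (forall A1 A2, A1 `<=` edges_in G F -> A2 `<=` edges_in G L `\` edges_in G F ->
     h (A1 `|` A2) = h A1) ->
    \sum_(A <- fpowerset (edges_in G L)) rcw true L A * (h A * g A) =
    \sum_(A <- fpowerset (edges_in G F)) rcw true F A * h A.
  move=> hh; rewrite -[RHS]mulr1 -(sum_bern p (edges_in G L `\` edges_in G F)).
  apply: sum_factor => // A1 A2 A1F A2L; rewrite hh // /rcw /g.
  have AL : A1 `|` A2 `<=` edges_in G L.
    by rewrite (edges_in_split G FL) fsetUSS.
  rewrite (ktot_wired_split FL AL) exprD.
  set k := knum _ _ _ _.
  have -> : (A1 `|` A2) `&` edges_in G F = A1.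
    apply/fsetP => f; rewrite in_fsetI in_fsetU.
    case: (boolP (f \in A1)) => [/(fsubsetP A1F) -> //|_] /=.
    apply/negP => /andP[/(fsubsetP A2L)]; rewrite in_fsetD => /andP[/negPf -> //].
  have qn : q ^+ k * q^-1 ^+ k = 1.
    by rewrite -exprMn mulfV ?expr1n // gt_eqF // q_gt0.
  rewrite (edges_in_split G FL) bernU ?disjoint_edges_in // -(edges_in_split G FL).
  move: qn; rewrite -[inner_bd G F]/(bdy G true F); move: (q ^+ k) (q^-1 ^+ k) (bern _ _) (bern _ _) (q ^+ _) (h _).
  by move=> a b c d x y ab; rewrite -[RHS]mul1r -ab; ring.
have ZE : \sum_(A <- fpowerset (edges_in G L)) rcw true L A * g A = rcZ true F.
  transitivity (\sum_(A <- fpowerset (edges_in G L)) rcw true L A * (1 * g A)).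
    by apply: eq_bigr => A _; rewrite mul1r.
  by rewrite (wg (fun=> 1)) //; apply: eq_bigr => A _; rewrite mulr1.
rewrite /rcE ler_pdivrMr ?rcZ_gt0 // mulrAC ler_pdivlMr ?rcZ_gt0 //.
rewrite -wg -?ZE; last by move=> A1 A2 A1F A2L; rewrite (mem_split _ eF A2L).
apply: fkg => //.
- exact: rcw_ge0.
- by move=> A; rewrite exprn_ge0 // invr_ge0 ltW // q_gt0.
- exact: rcw_supermodular.
- by move=> A B /fsubsetP AB _; rewrite ler_nat; case: (boolP (e \in A)) => // /AB ->.
move=> A B AB BL; apply: ler_wiXn2l; rewrite ?invr_ge0 ?invf_le1 ?q_gt0 //.
  by rewrite ltW // q_gt0.
exact: knum_anti.
Qed.

(** Once the edges of K are open, the weight is the wired weight of F times an outside factor. K may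
    overlap F: its edges inside F ([H1]) remain as a condition, which is increasing and is removed
    by FKG for the wired measure of F. *)
Lemma sum_connected_open F L K e : F `<=` L -> val e `<=` F ->
  connected_on G [set` K] -> (inner_bd G F `<=` [set` K])%classic ->
  rcE true F (fun A => (e \in A)%:R) *
  (\sum_(A <- fpowerset (edges_in G L)) rcw false L A * (edges_in G K `<=` A)%:R) <=
  \sum_(A <- fpowerset (edges_in G L))
     rcw false L A * ((e \in A)%:R * (edges_in G K `<=` A)%:R).
Proof.
move=> FL eF Kc FK.
pose H1 := edges_in G K `&` edges_in G F.
pose H2 := edges_in G K `\` edges_in G F.
pose c A : R := bern (edges_in G L `\` edges_in G F) A *
  q ^+ knum (edges_in G K `|` A) L (outside G F) set0 * (H2 `<=` A)%:R.
have factor (g : {fset edge G} -> R) :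
    (forall A1 A2, A1 `<=` edges_in G F ->
     A2 `<=` edges_in G L `\` edges_in G F -> g (A1 `|` A2) = g A1) ->
    \sum_(A <- fpowerset (edges_in G L))
      rcw false L A * (g A * (edges_in G K `<=` A)%:R) =
    (\sum_(A <- fpowerset (edges_in G F)) rcw true F A * (g A * (H1 `<=` A)%:R)) *
    (\sum_(A <- fpowerset (edges_in G L `\` edges_in G F)) c A).
  move=> gg; apply: sum_factor => // A1 A2 A1F A2L; rewrite /c gg //.
  have -> : (edges_in G K `<=` A1 `|` A2) = (H1 `<=` A1) && (H2 `<=` A2).
    apply/idP/andP => [/fsubsetP KA|[/fsubsetP HA1 /fsubsetP HA2]].
      split; apply/fsubsetP => f; rewrite ?in_fsetI ?in_fsetD => /andP[].
        move=> /KA; rewrite in_fsetU => /orP[//|/(fsubsetP A2L)].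
        by rewrite in_fsetD => /andP[/negPf ->].
      move=> fF /KA; rewrite in_fsetU => /orP[/(fsubsetP A1F)|//].
      by rewrite (negPf fF).
    apply/fsubsetP => f fK; rewrite in_fsetU.
    have [fF|fF] := boolP (f \in edges_in G F).
      by rewrite HA1 // in_fsetI fK fF.
    by rewrite (HA2 f) ?orbT // in_fsetD fK fF.
  case: (boolP (H1 `<=` A1)) => [HA1|_]; last by rewrite !(mulr0, mul0r).
  case: (boolP (H2 `<=` A2)) => [HA2|_]; last by rewrite !(mulr0, mul0r).
  have KA : edges_in G K `<=` A1 `|` A2.
    apply/fsubsetP => f fK; rewrite in_fsetU.
    have [fF|fF] := boolP (f \in edges_in G F).
      by rewrite (fsubsetP HA1) // in_fsetI fK fF.
    by rewrite (fsubsetP HA2 f) ?orbT // in_fsetD fK fF.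
  rewrite /rcw (edges_in_split G FL) bernU ?disjoint_edges_in //.
  rewrite -(edges_in_split G FL) (ktot_connected_open FL A1F A2L Kc FK KA) exprD.
  rewrite -[(true && true)%:R]/(1 : R) -[inner_bd G F]/(bdy G true F).
  move: (bern _ _) (bern _ _) (q ^+ _) (q ^+ _) (g _) => *; ring.
have mem_e (A1 A2 : {fset edge G}) : A1 `<=` edges_in G F ->
    A2 `<=` edges_in G L `\` edges_in G F -> (e \in A1 `|` A2)%:R = (e \in A1)%:R :> R.
  by move=> A1F A2L; rewrite (mem_split _ eF A2L).
have c0 : 0 <= \sum_(A <- fpowerset (edges_in G L `\` edges_in G F)) c A.
  apply: sumr_ge0 => A _; rewrite mulr_ge0 // mulr_ge0 ?bern_ge0 //.
  by rewrite exprn_ge0 // ltW // q_gt0.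
have := factor (fun=> 1) (fun _ _ _ _ => erefl).
under eq_bigr do rewrite mul1r.
under [in RHS]eq_bigr do rewrite mul1r.
move=> ->; rewrite factor // mulrA; apply: ler_wpM2r => //.
rewrite /rcE mulrAC ler_pdivrMr ?rcZ_gt0 //; apply: fkg => //.
- exact: rcw_ge0.
- exact: rcw_supermodular.
- by move=> A B /fsubsetP AB _; rewrite ler_nat; case: (boolP (e \in A)) => // /AB ->.
- move=> A B AB _; rewrite ler_nat.
  by case: (boolP (H1 `<=` A)) => // /fsubset_trans /(_ AB) ->.
Qed.

(** Finite energy. Resetting the edges of [D] to the state [Dstar] is at most 2^|D| to one, leads to
    T = 1, and multiplies the weight by at least [c]. *)
Lemma sum_event_lb (E D Dstar : {fset edge G}) (w T : {fset edge G} -> R) (c : R) :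
  (forall A, 0 <= w A) -> (forall A, 0 <= T A) -> 0 <= c ->
  D `<=` E -> Dstar `<=` D ->
  (forall A1 A2, A1 `<=` D -> A2 `<=` E `\` D ->
    T (Dstar `|` A2) = 1 /\ c * w (A1 `|` A2) <= w (Dstar `|` A2)) ->
  c / 2 ^+ #|` D| * (\sum_(A <- fpowerset E) w A) <=
  \sum_(A <- fpowerset E) w A * T A.
Proof.
move=> w0 T0 c0 DE DsD H.
have EE : E = D `|` (E `\` D).
  apply/fsetP => e; rewrite in_fsetU in_fsetD.
  by case: (boolP (e \in D)) => //= /(fsubsetP DE).
have dis : [disjoint D & E `\` D] by apply/fdisjointP => e eD; rewrite in_fsetD eD.
rewrite EE !big_fpowersetU //.
apply: (@le_trans _ _ (\sum_(A2 <- fpowerset (E `\` D)) w (Dstar `|` A2) * T (Dstar `|` A2))).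
  rewrite mulrAC ler_pdivrMr ?exprn_gt0 // exchange_big /= mulr_sumr mulr_suml.
  rewrite big_seq [leRHS]big_seq; apply: ler_sum => A2; rewrite fpowersetE => A2E.
  have [-> _] := H D A2 (fsubset_refl _) A2E; rewrite mulr1.
  have -> : (2 : R) ^+ #|` D| = \sum_(A1 <- fpowerset D) 1.
    by rewrite -natrX -card_fpowerset card_fset_sum1 natr_sum.
  rewrite !mulr_sumr big_seq [leRHS]big_seq; apply: ler_sum => A1; rewrite fpowersetE => A1D.
  by rewrite mulr1; have [] := H _ _ A1D A2E.
rewrite [leRHS](big_fsetD1 Dstar) /=; last by rewrite fpowersetE.
rewrite lerDl; apply: sumr_ge0 => A _; apply: sumr_ge0 => B _.
by rewrite mulr_ge0.
Qed.

(** Closing edges cannot lower the cluster count, so only a factor 1 - p per edge is lost besides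
    the 2 from counting preimages. *)
Lemma closed_lb i L (D : {fset edge G}) : D `<=` edges_in G L ->
  ((1 - p) / 2) ^+ #|` D| * rcZ i L <=
  \sum_(A <- fpowerset (edges_in G L)) rcw i L A * [disjoint A & D]%:R.
Proof.
move=> DE; rewrite exprMn exprVn; have /andP[p0 p1] := p01.
have p1' : 0 <= 1 - p by rewrite subr_ge0.
apply: (@sum_event_lb _ _ fset0) => //.
- exact: rcw_ge0.
- exact: exprn_ge0.
move=> A1 A2 A1D A2E; rewrite fset0U.
have dis : [disjoint A2 & D].
  by apply/fdisjointP => e /(fsubsetP A2E); rewrite in_fsetD => /andP[].
have A2L : A2 `<=` edges_in G L := fsubset_trans A2E (fsubsetDl _ _).
have AL : A1 `|` A2 `<=` edges_in G L by rewrite fsubUset A2L (fsubset_trans A1D).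
rewrite dis; split=> //; rewrite /rcw mulrA; apply: ler_pM.
- by rewrite mulr_ge0 ?bern_ge0 // exprn_ge0.
- by rewrite exprn_ge0 // ltW // q_gt0.
- rewrite /bern mulrCA -exprD.
  apply: ler_pM; rewrite ?exprn_ge0 //.
    by apply: ler_wiXn2l => //; apply: fsubset_leq_card; exact: fsubsetUr.
  apply: ler_wiXn2l => //; first lra.
  rewrite -(cardfsID D (edges_in G L `\` A2)); apply: leq_add.
    by apply: fsubset_leq_card; exact: fsubsetIr.
  apply: fsubset_leq_card; apply/fsubsetP => e; rewrite !in_fsetD in_fsetU negb_or.
  move=> /andP[eD /andP[e2 ->]]; rewrite e2 !andbT.
  by apply: contra eD; apply: (fsubsetP A1D).
- by apply: ler_weXn2l => //; apply: knum_anti => //; exact: fsubsetUr.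
Qed.

(** Each opened edge merges at most two clusters, hence the additional factor 1 / q per edge. *)
Lemma open_lb L (D : {fset edge G}) : D `<=` edges_in G L ->
  (p / q / 2) ^+ #|` D| * rcZ false L <=
  \sum_(A <- fpowerset (edges_in G L)) rcw false L A * (D `<=` A)%:R.
Proof.
move=> DE; rewrite exprMn exprVn; have /andP[p0 p1] := p01.
have p1' : 0 <= 1 - p by rewrite subr_ge0.
have qge0 : 0 <= q by rewrite ltW // q_gt0.
apply: (@sum_event_lb _ _ D) => //.
- exact: rcw_ge0.
- by rewrite exprn_ge0 // divr_ge0.
move=> A1 A2 A1D A2E; rewrite fsubsetUl; split=> //.
have A2L : A2 `<=` edges_in G L := fsubset_trans A2E (fsubsetDl _ _).
have AL : A1 `|` A2 `<=` edges_in G L by rewrite fsubUset A2L (fsubset_trans A1D).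
have DA : D `|` (A1 `|` A2) = D `|` A2 by rewrite fsetUA (fsetUidPl _ _ A1D).
rewrite exprMn exprVn -mulrA mulrCA mulrC ler_pdivrMr ?exprn_gt0 ?q_gt0 //.
rewrite /rcw mulrA -[leRHS]mulrA -exprD; apply: ler_pM.
- by rewrite mulr_ge0 ?bern_ge0 // exprn_ge0.
- by rewrite exprn_ge0.
- rewrite /bern mulrA -exprD; apply: ler_pM; rewrite ?exprn_ge0 //.
    apply: ler_wiXn2l => //; rewrite -DA; apply: leq_trans (leq_card_fsetU _ _) _.
    by [].
  apply: ler_wiXn2l => //; first lra.
  by apply: fsubset_leq_card; apply: fsetDS; exact: fsetUSS.
by apply: ler_weXn2l => //; rewrite -DA; exact: leq_ktot_add.
Qed.

End FiniteVolume.

(** * Configurations as functions and as finite sets of open edges *)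

Section Translation.
Local Open Scope fset_scope.
Context (V : choiceType) (G : sgraph V).
Implicit Types (A : {fset edge G}) (L F K : {fset V}) (e : edge G).

Definition supp (L : {fset V}) (w : {ffun edges_in G L -> bool}) : {fset edge G} :=
  [fset e in edges_in G L | extend false w e].

Lemma in_supp L (w : {ffun edges_in G L -> bool}) e :
  (e \in supp w) = (e \in edges_in G L) && extend false w e.
Proof. by rewrite /supp inE. Qed.

Lemma supp_val L (w : {ffun edges_in G L -> bool}) (e : edges_in G L) :
  (val e \in supp w) = w e.
Proof. by rewrite in_supp (valP e) /= /extend valK. Qed.

Lemma supp_sub L (w : {ffun edges_in G L -> bool}) : supp w `<=` edges_in G L.
Proof. by apply/fsubsetP => e; rewrite in_supp => /andP[]. Qed.

Lemma extend_supp (i : bool) L (w : {ffun edges_in G L -> bool}) e :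
  e \in edges_in G L -> extend i w e = (e \in supp w).
Proof. by move=> eL; rewrite in_supp eL /extend insubT. Qed.

Lemma supp_inj L : injective (@supp L).
Proof. by move=> w w' ww'; apply/ffunP => e; rewrite -!supp_val ww'. Qed.

Lemma big_supp (M : nmodType) L (F : {fset edge G} -> M) :
  \sum_(w : {ffun edges_in G L -> bool}) F (supp w) =
  \sum_(A <- fpowerset (edges_in G L)) F A.
Proof.
rewrite -(big_map (@supp L) xpredT F); apply: perm_big; apply: uniq_perm.
- by rewrite map_inj_uniq ?index_enum_uniq //; exact: supp_inj.
- exact: fset_uniq.
move=> A; rewrite fpowersetE; apply/mapP/idP => [[w _ ->]|AL]; first exact: supp_sub.
exists [ffun e => val e \in A]; first exact: mem_index_enum.
apply/fsetP => e; rewrite in_supp; apply/idP/andP => [eA|[eL]].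
  have eL := fsubsetP AL _ eA; split=> //.
  by rewrite /extend insubT /= ffunE.
by rewrite /extend insubT /= ffunE.
Qed.

Lemma card_supp L (w : {ffun edges_in G L -> bool}) :
  #|[set e | w e]%SET| = #|` supp w|.
Proof.
have -> : supp w = [fset val e | e in [set e | w e]%SET].
  apply/fsetP => e; rewrite in_supp; apply/andP/imfsetP => [[eL]|[x /= xw ->]].
    by rewrite /extend insubT /= => we; exists (Sub e eL) => //=; rewrite inE.
  by rewrite (valP x); split=> //; rewrite /extend valK /=; rewrite inE in xw.
by rewrite card_imfset ?cardE //; exact: val_inj.
Qed.

Lemma card_suppN L (w : {ffun edges_in G L -> bool}) :
  #|[set e | ~~ w e]%SET| = #|` edges_in G L `\` supp w|.
Proof.
have -> : edges_in G L `\` supp w = [fset val e | e in [set e | ~~ w e]%SET].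
  apply/fsetP => e; rewrite in_fsetD in_supp negb_and; apply/andP/imfsetP.
    move=> [/orP[/negPf -> //|] + eL].
    by rewrite /extend insubT /= => we; exists (Sub e eL) => //=; rewrite inE.
  move=> [x /= xw ->]; rewrite (valP x); split=> //.
  by rewrite /extend valK /=; rewrite inE in xw.
by rewrite card_imfset ?cardE //; exact: val_inj.
Qed.

Lemma connect_conn L (w : {ffun edges_in G L -> bool}) (u v : L) :
  reflect (conn (supp w) (val u) (val v)) (connect (open_adj w) u v).
Proof.
apply: (iffP idP) => [/connectP[s + ->] {v}|].
  elim: s u => [|x s IH] u /=; first by move=> _; exact: conn_refl.
  move=> /andP[/existsP[e /andP[we /eqP ee]] /IH]; apply: conn_trans.
  by apply: conn1 ee; rewrite supp_val.
move=> uv; suff H z : conn (supp w) (val u) z -> forall zL : z \in L,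
    connect (open_adj w) u [` zL].
  by have := H _ uv (valP v); congr connect; exact: val_inj.
elim=> [uL|x y e ux IH eA exy yL].
  by have -> : [` uL] = u by exact: val_inj.
have xL : x \in L by apply: conn_in (supp_sub w) (valP u) ux.
apply: connect_trans (IH xL) _; apply: connect1; apply/existsP.
exists [` fsubsetP (supp_sub w) _ eA]; rewrite -supp_val /= eA /=.
by apply/eqP.
Qed.

Lemma num_clustersE (i : bool) L (w : {ffun edges_in G L -> bool}) :
  num_clusters i w = ktot (supp w) L (bdy G i L).
Proof.
pose h (C : {set L}) : set V := [set x | exists2 u : L, u \in C & val u = x].
have hE C (u : L) : h C (val u) <-> u \in C.
  by split=> [[v vC /val_inj <-]//|uC]; exists u.
have h_inj : injective h.
  by move=> C D CD; apply/setP => u; apply/idP/idP; rewrite -!hE CD.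
have hcl (u : L) : h [set v | connect (open_adj w) u v]%SET = component (supp w) (val u).
  apply/seteqP; split=> [_ [v vC <-]|x ux].
    by apply/connect_conn; rewrite inE in vC.
  have xL : x \in L by apply: conn_in (supp_sub w) (valP u) ux.
  by exists [` xL] => //; rewrite inE; apply/connect_conn.
have bdE (C : {set L}) : (i ==> [disjoint C & inner_boundary G L]) <->
    (h C `&` bdy G i L = set0)%classic.
  case: i => /=; last by rewrite setI0.
  split=> [/pred0P CB|CB].
    rewrite -subset0 => _ [[u uC <-] [_ uB]]; have /= := CB u.
    by rewrite uC inE /=; move/negbT/asboolPn; apply.
  apply/pred0P => u /=; apply/negP => /andP[uC]; rewrite inE => /asboolP uB.
  have : (h C `&` inner_bd G L)%classic (val u) by split; [exact/hE|split=> //; exact: valP].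
  by rewrite CB.
rewrite /num_clusters ktotE; set S := [set C in _ | _]%SET; set X := [fset C in _ | _].
have -> : X = [fset h C | C in S].
  apply/fsetP => C; rewrite !inE; apply/andP/imfsetP.
    move=> [/components_inP[u uL ->] /asboolP uB].
    exists [set v | connect (open_adj w) [` uL] v]%SET => /=; last by rewrite hcl.
    rewrite inE; apply/andP; split; first by apply/imsetP; exists [` uL].
    by apply/bdE; rewrite hcl.
  move=> [D /=]; rewrite inE => /andP[/imsetP[u _ DE] /bdE DB] ->; split.
    by apply/components_inP; exists (val u); [exact: valP|rewrite DE hcl].
  exact/asboolP.
by rewrite card_imfset ?cardE.
Qed.

Context (R : realType) (p q : R) (p01 : 0 <= p <= 1) (q1 : 1 <= q).

Lemma rc_weightE i L (w : {ffun edges_in G L -> bool}) :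
  rc_weight i p q w = rcw p q i L (supp w).
Proof. by rewrite /rc_weight card_supp card_suppN num_clustersE. Qed.

(** The two sides extend a configuration beyond L differently; a function of the edges in [D] does
    not see this. *)
Lemma rc_meanE i L (D : {fset edge G}) (f : (edge G -> bool) -> R) :
  D `<=` edges_in G L ->
  (forall w w', (forall e, e \in D -> w e = w' e) -> f w = f w') ->
  rc_mean i p q L f = rcE p q i L (fun A => f (fun e => e \in A)).
Proof.
move=> DL fD; rewrite /rcE -big_supp mulr_suml; apply: eq_bigr => w _.
rewrite /rc_prob rc_weightE mulrAC; congr (_ * _ / _).
  by apply: fD => e /(fsubsetP DL); exact: extend_supp.
by rewrite /rcZ -big_supp; apply: eq_bigr => w' _; rewrite rc_weightE.
Qed.

End Translation.

(** * Invariance of the finite-volume measures under automorphisms *)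

Section Automorphisms.
Local Open Scope fset_scope.

Lemma in_imfset_inj (K K' : choiceType) (h : K -> K') (X : {fset K}) x :
  injective h -> (h x \in h @` X) = (x \in X).
Proof. by move=> hi; rewrite mem_imfset. Qed.

Lemma card_imfset_inj (K K' : choiceType) (h : K -> K') (X : {fset K}) :
  injective h -> #|` h @` X| = #|` X|.
Proof. by move=> hi; rewrite card_imfset. Qed.

Lemma imfset_inj (K K' : choiceType) (h : K -> K') : injective h ->
  injective (fun X : {fset K} => h @` X).
Proof.
by move=> hi X Y /= XY; apply/fsetP => x; rewrite -(in_imfset_inj X x hi) XY in_imfset_inj.
Qed.

Lemma imfsetD_inj (K K' : choiceType) (h : K -> K') (X Y : {fset K}) : injective h ->
  h @` (X `\` Y) = h @` X `\` h @` Y.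
Proof.
move=> hi; apply/fsetP => y; rewrite in_fsetD; apply/imfsetP/andP => /=.
  move=> [x]; rewrite in_fsetD => /andP[xY xX] ->.
  by rewrite !in_imfset_inj.
move=> [+ /imfsetP[x /= xX ye]]; rewrite ye in_imfset_inj // => xY.
by exists x => //; rewrite in_fsetD xY.
Qed.

Lemma big_fpowerset_img (M : nmodType) (K K' : choiceType) (h : K -> K')
    (X : {fset K}) (F : {fset K'} -> M) : injective h ->
  \sum_(A <- fpowerset (h @` X)) F A = \sum_(A <- fpowerset X) F (h @` A).
Proof.
move=> hi; rewrite -(big_map (fun A : {fset K} => h @` A) xpredT F).
apply: perm_big; apply: uniq_perm.
- exact: fset_uniq.
- by rewrite map_inj_uniq ?fset_uniq //; exact: imfset_inj.
move=> A; rewrite fpowersetE; apply/fsubsetP/mapP => [AX|[B]].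
  exists [fset x in X | h x \in A].
    by rewrite fpowersetE; apply/fsubsetP => x; rewrite !inE => /andP[].
  apply/fsetP => y; apply/idP/imfsetP => /=.
    by move=> yA; have /imfsetP[x /= xX ye] := AX _ yA; exists x => //; rewrite !inE /= xX -ye.
  by move=> [x]; rewrite !inE => /andP[xX hxA] ->.
rewrite fpowersetE => /fsubsetP BX -> y /imfsetP[x /= xB ->].
by rewrite in_imfset_inj // BX.
Qed.

Context (V : choiceType) (G : sgraph V) (f : V -> V) (fG : automorphism G f).
Implicit Types (A : {fset edge G}) (L : {fset V}) (e : edge G).

Lemma automorphism_inj : injective f.
Proof. by case: fG => /bij_inj. Qed.

Lemma is_edge_img e : is_edge G (f @` val e).
Proof.
have [u [v [uv ->]]] := edgeP e.
have -> : f @` [fset u; v] = [fset f u; f v].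
  by rewrite imfsetU !imfset_fset1.
have fuv : G (f u) (f v) by rewrite fG.2.
have fuNv : f u != f v by apply/eqP => fE; move: fuv; rewrite fE adj_irr.
rewrite /is_edge cardfs2 fuNv eqxx /=; apply/'forall_forallP => a b.
apply/implyP => ab; move: (valP a) (valP b); rewrite !inE.
move=> /orP[/eqP aE|/eqP aE] /orP[/eqP bE|/eqP bE]; rewrite ?aE ?bE //.
- by move: ab; rewrite -val_eqE /= aE bE eqxx.
- by rewrite adj_sym.
- by move: ab; rewrite -val_eqE /= aE bE eqxx.
Qed.

Definition edge_map e : edge G := Sub (f @` val e) (is_edge_img e).

Lemma edge_map_inj : injective edge_map.
Proof.
by move=> e e' /(congr1 val) /(imfset_inj automorphism_inj) /val_inj.
Qed.

Lemma preimage_edge e' (u v : V) : val e' = [fset f u; f v] ->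
  exists2 e, val e = [fset u; v] & e' = edge_map e.
Proof.
move=> e'E.
have uv : G u v.
  have [x [y [xy xyE]]] := edgeP e'; rewrite -fG.2.
  rewrite xyE in e'E.
  have xNy : x != y by apply/eqP => xE; move: xy; rewrite xE adj_irr.
  have /fset2P[xE|xE] : x \in [fset f u; f v] by rewrite -e'E fset21.
    have /fset2P[yE|yE] : y \in [fset f u; f v] by rewrite -e'E fset22.
      by move: xNy; rewrite xE yE eqxx.
    by rewrite -xE -yE.
  have /fset2P[yE|yE] : y \in [fset f u; f v] by rewrite -e'E fset22.
    by rewrite -xE -yE adj_sym.
  by move: xNy; rewrite xE yE eqxx.
have uvE : is_edge G [fset u; v].
  have uNv : u != v by apply/eqP => uE; move: uv; rewrite uE adj_irr.
  rewrite /is_edge cardfs2 uNv eqxx /=; apply/'forall_forallP => a b.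
  apply/implyP => ab; move: (valP a) (valP b); rewrite !inE.
  move=> /orP[/eqP aE|/eqP aE] /orP[/eqP bE|/eqP bE]; rewrite ?aE ?bE //.
  - by move: ab; rewrite -val_eqE /= aE bE eqxx.
  - by rewrite adj_sym.
  - by move: ab; rewrite -val_eqE /= aE bE eqxx.
exists (Sub [fset u; v] uvE) => //; apply: val_inj => /=.
by rewrite e'E imfsetU !imfset_fset1.
Qed.

Lemma edges_in_img L : edges_in G (f @` L) = edge_map @` edges_in G L.
Proof.
apply/fsetP => e'; rewrite in_edges_in; apply/fsubsetP/imfsetP => /=.
  have [x [y [_ e'E]]] := edgeP e' => eL.
  have /imfsetP[u /= uL xE] : x \in f @` L by apply: eL; rewrite e'E fset21.
  have /imfsetP[v /= vL yE] : y \in f @` L by apply: eL; rewrite e'E fset22.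
  rewrite xE yE in e'E; have [e eE ->] := preimage_edge e'E.
  exists e => //; rewrite in_edges_in eE; apply/fsubsetP => z.
  by rewrite !inE => /orP[/eqP ->|/eqP ->].
move=> [e]; rewrite in_edges_in => /fsubsetP eL -> _ /imfsetP[z /= /eL zL ->].
by rewrite in_imfset_inj //; exact: automorphism_inj.
Qed.

Lemma conn_img A u v : conn A u v -> conn (edge_map @` A) (f u) (f v).
Proof.
elim=> [|x y e _ IH eA exy]; first exact: conn_refl.
apply: (conn_step (e := edge_map e) IH); first by rewrite in_imfset_inj //; exact: edge_map_inj.
by rewrite /= exy imfsetU !imfset_fset1.
Qed.

Lemma conn_img_inv A u y : conn (edge_map @` A) (f u) y ->
  exists2 v, y = f v & conn A u v.
Proof.
elim=> [|x {}y e' _ [v -> uv] e'A exy]; first by exists u => //; exact: conn_refl.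
have [f' fK f'K] := fG.1.
rewrite -[y]f'K in exy *; have [e eE e'E] := preimage_edge exy.
exists (f' y) => //; apply: conn_step uv _ eE.
by move: e'A; rewrite e'E in_imfset_inj //; exact: edge_map_inj.
Qed.

Lemma component_img A u : component (edge_map @` A) (f u) = (f @` component A u)%classic.
Proof.
apply/seteqP; split=> [y /conn_img_inv[v -> uv]|_ [v uv <-]]; first by exists v.
exact: conn_img.
Qed.

Lemma inner_bd_img L v : inner_bd G (f @` L) (f v) <-> inner_bd G L v.
Proof.
have fi := automorphism_inj; have [f' fK f'K] := fG.1.
rewrite /inner_bd /=; split=> -[]; rewrite in_imfset_inj // => vL [w wL vw]; split; rewrite ?in_imfset_inj //.
  by exists (f' w); rewrite -1?fG.2 ?f'K // -(in_imfset_inj L _ fi) f'K.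
by exists (f w); rewrite ?fG.2 // in_imfset_inj.
Qed.

Lemma ktot_img i A L :
  ktot (edge_map @` A) (f @` L) (bdy G i (f @` L)) = ktot A L (bdy G i L).
Proof.
have fi := automorphism_inj.
have img_inj : injective (fun C : set V => (f @` C)%classic).
  move=> C D CD; apply/seteqP; split=> x Cx.
    by have [y Dy /fi <-] : (f @` D)%classic (f x) by rewrite -CD; exists x.
  by have [y Dy /fi <-] : (f @` C)%classic (f x) by rewrite CD; exists x.
rewrite !ktotE -[RHS](card_imfset_inj _ img_inj); congr size; congr enum_fset.
have avoid u : (component (edge_map @` A)%fset (f u) `&` bdy G i (f @` L)%fset = set0)%classic <->
    (component A u `&` bdy G i L = set0)%classic.
  rewrite component_img; case: i => /=; last by rewrite !setI0.
  split=> av; rewrite -subset0 => x.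
    move=> [ux xb]; have : (f @` component A u `&` inner_bd G (f @` L)%fset)%classic (f x).
      by split; [exists x|apply/inner_bd_img].
    by rewrite av.
  move=> [[y uy <-] /inner_bd_img yb].
  by have : (component A u `&` inner_bd G L)%classic y by []; rewrite av.
apply/fsetP => C; rewrite !inE; apply/andP/imfsetP => /=.
  move=> [/components_inP[x /imfsetP[u /= uL ->] ->] /asboolP /avoid av].
  exists (component A u); last exact: component_img.
  by rewrite !inE /=; apply/andP; split; [apply/components_inP; exists u|exact/asboolP].
move=> [D]; rewrite !inE => /andP[/components_inP[u uL ->] /asboolP /avoid av] ->.
rewrite -component_img; split; last exact: av.
by apply/components_inP; exists (f u) => //; rewrite in_imfset_inj.
Qed.

Lemma rcE_img (R : realFieldType) (p q : R) i L e :
  rcE p q i (f @` L) (fun A => (edge_map e \in A)%:R) =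
  rcE p q i L (fun A => (e \in A)%:R).
Proof.
have gi := edge_map_inj.
have wE A : rcw p q i (f @` L) (edge_map @` A) = rcw p q i L A.
  rewrite /rcw ktot_img edges_in_img /bern -imfsetD_inj //.
  by rewrite !card_imfset_inj.
rewrite /rcE /rcZ edges_in_img !big_fpowerset_img //; congr (_ / _).
  by apply: eq_bigr => A _; rewrite wE in_imfset_inj.
by apply: eq_bigr => A _; rewrite wE.
Qed.

End Automorphisms.

(** * An exponential lower bound by tilting, and the counting of edges *)

Section Tilting.
Local Open Scope fset_scope.
Context (R : realType).

(* The tangent-line bound expR x >= 1 + x stands in for Jensen's inequality
   under the weight w conditioned on the event T. *)
Lemma tilt_lb (K : choiceType) (I : eqType) (E : {fset K}) (w T : {fset K} -> R)
    (S : seq I) (n : I -> {fset K} -> R) (a : I -> R) (t : R) :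
  0 <= t -> (forall A, 0 <= w A) -> (forall A, 0 <= T A <= 1) ->
  (forall i, i \in S -> \sum_(A <- fpowerset E) w A * (n i A * T A) <=
     a i * \sum_(A <- fpowerset E) w A * T A) ->
  expR (- t * \sum_(i <- S) a i) * (\sum_(A <- fpowerset E) w A * T A) <=
  \sum_(A <- fpowerset E) w A * expR (- t * \sum_(i <- S) n i A).
Proof.
move=> t0 w0 T01 na; set m := \sum_(i <- S) a i; set W := \sum_(A <- _) w A * T A.
have W0 : 0 <= W.
  by apply: sumr_ge0 => A _; rewrite mulr_ge0 //; case/andP: (T01 A).
pose N A := \sum_(i <- S) n i A.
have sumN : \sum_(A <- fpowerset E) w A * (N A * T A) <= m * W.
  rewrite /m mulr_suml.
  under eq_bigr do rewrite /N mulr_suml mulr_sumr.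
  rewrite exchange_big /=.
  elim: S na {m N} => [|i S IH] na; first by rewrite !big_nil.
  rewrite !big_cons lerD ?IH //; first by apply: na; rewrite mem_head.
  by move=> j jS; apply: na; rewrite inE jS orbT.
apply: (@le_trans _ _ (expR (- t * m) * \sum_(A <- fpowerset E) w A * (T A * (1 - t * (N A - m))))).
  apply: ler_wpM2l; first exact: expR_ge0.
  have -> : \sum_(A <- fpowerset E) w A * (T A * (1 - t * (N A - m))) =
      (1 + t * m) * W - t * \sum_(A <- fpowerset E) w A * (N A * T A).
    rewrite /W [in RHS]mulr_sumr [X in _ - X]mulr_sumr -sumrB; apply: eq_bigr => A _.
    by move: (m) (N A) (T A) (w A) => *; ring.
  have := ler_wpM2l t0 sumN; lra.
rewrite mulr_sumr; apply: ler_sum => A _; rewrite mulrCA; apply: ler_wpM2l => //.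
have -> : expR (- t * \sum_(i <- S) n i A) = expR (- t * m) * expR (- t * (N A - m)).
  by rewrite -expRD -mulrDr addrC subrK.
apply: ler_wpM2l; first exact: expR_ge0.
have /andP[T0 T1] := T01 A.
have h1 := expR_ge1Dx (- t * (N A - m)); have h2 := expR_ge0 (- t * (N A - m)).
(* A nonnegative tangent is only decreased by T <= 1; a negative one times T >= 0 lies below the
   positive exponential. *)
have [h|h] := leP 0 (1 - t * (N A - m)); nra.
Qed.

End Tilting.

Section Counting.
Local Open Scope fset_scope.
Context (V : choiceType) (G : sgraph V) (Delta : nat) (nb : V -> {fset V}).
Context (nbE : forall u v, G u v -> v \in nb u).
Context (nb_card : forall u, (#|` nb u| <= Delta)%N).

Lemma card_edges_touching (D : {fset edge G}) (K : {fset V}) :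
  (forall e, e \in D -> exists2 u, u \in K & u \in val e) ->
  (#|` D| <= Delta * #|` K|)%N.
Proof.
move=> DK; pose s := [seq [fset u; v] | u <- enum_fset K, v <- enum_fset (nb u)].
apply: (@leq_trans (size s)).
  rewrite -(card_imfset_inj D (val_inj : injective (val : edge G -> {fset V}))).
  apply: uniq_leq_size; first exact: fset_uniq.
  move=> _ /imfsetP[e /= eD ->]; have [u uK ue] := DK _ eD.
  have [x [y [xy eE]]] := edgeP e.
  move: ue; rewrite eE => /fset2P[ux|uy]; subst u.
    by apply/allpairsPdep; exists x, y; split=> //; exact: nbE.
  rewrite eE fsetUC; apply/allpairsPdep; exists y, x; split=> //.
  by apply: nbE; rewrite adj_sym.
rewrite size_allpairs_dep sumnE big_map mulnC.
apply: (@leq_trans (\sum_(u <- enum_fset K) Delta)%N); first exact: leq_sum.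
by rewrite big_const_seq count_predT iter_addn_0 mulnC.
Qed.

End Counting.

(** * Infinite-volume limits *)

Section Exhaustion.
Context (V : choiceType).

Lemma exhaustion_filter : ProperFilter (@exhaustion V).
Proof.
apply: filter_from_proper; last by move=> A _; exists A => /=; exact: fsubset_refl.
apply: filter_from_filter; first by exists fset0.
move=> A B _ _; exists (A `|` B)%fset => // L /=.
by rewrite fsubUset => /andP[].
Qed.

Lemma exhaustion_near (P : {fset V} -> Prop) L0 :
  (forall L, (L0 `<=` L)%fset -> P L) -> \forall L \near @exhaustion V, P L.
Proof. by move=> H; exists L0. Qed.

End Exhaustion.
#[global] Existing Instance exhaustion_filter.

Section Limits.
Local Open Scope fset_scope.
Context (R : realType) (V : choiceType) (G : sgraph V).
Implicit Types (D : {fset edge G}) (e : edge G).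

Definition local_on D (f : (edge G -> bool) -> R) :=
  forall w w', (forall e, e \in D -> w e = w' e) -> f w = f w'.

Lemma local_continuous D (f : {ptws edge G -> bool} -> R) :
  local_on D f -> continuous f.
Proof.
move=> fD w.
have near_eq : \forall w' \near w, forall e, e \in D -> w' e = w e.
  have H e : \forall w' \near (w : {ptws edge G -> bool}), w' e = w e.
    have h := @proj_continuous (edge G) (fun=> bool) e w.
    exact: (h [set w e]%classic (discrete_set1 _)).
  have : \forall w' \near (w : {ptws edge G -> bool}), forall e : D, w' (val e) = w (val e).
    apply: (@filter_forall _ D (fun (e : D) (w' : {ptws edge G -> bool}) =>
      w' (val e) = w (val e)) (nbhs w) (nbhs_filter w)) => e; exact: H.
  by apply: filterS => w' H' e eD; exact: (H' [` eD]).
apply: cvg_near_cst; near=> w'; apply: fD.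
by near: w'; exact: near_eq.
Unshelve. all: by end_near.
Qed.

Context (p q : R) (p01 : 0 <= p <= 1) (q1 : 1 <= q).
Context (phi : bool -> probability (config (edge G) bool) R).
Context (phi_rc : forall i, is_rc_measure i p q (phi i)).
Let E i (f : (edge G -> bool) -> R) : R := Rintegral (phi i) setT f.

Definition verts_of D : {fset V} := \bigcup_(e <- D) val e.

Lemma verts_ofP D L : verts_of D `<=` L -> D `<=` edges_in G L.
Proof.
move=> DL; apply/fsubsetP => e eD; rewrite in_edges_in; apply: fsubset_trans DL.
exact: bigfcup_sup.
Qed.

Lemma rcE_cvg i D f : local_on D f ->
  rcE p q i L (fun A => f (fun e => e \in A)) @[L --> @exhaustion V] --> E i f.
Proof.
move=> fD; have := @phi_rc i _ (local_continuous fD).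
apply: cvg_trans; apply: near_eq_cvg; apply: (@exhaustion_near _ _ (verts_of D)) => L.
by move=> /verts_ofP DL; rewrite (rc_meanE p q i DL).
Qed.

End Limits.

(** * Edge probabilities and monotonicity in infinite volume *)

Section EdgeProbabilities.
Local Open Scope fset_scope.
Context (R : realType) (V : choiceType) (G : sgraph V).
Implicit Types (D A B : {fset edge G}) (e : edge G).

Definition edge_prob (P : probability (config (edge G) bool) R) e : R :=
  Rintegral P setT (fun w : config (edge G) bool => (w e)%:R).

Context (p q : R) (p01 : 0 <= p <= 1) (q1 : 1 <= q).
Context (phi : bool -> probability (config (edge G) bool) R).
Context (phi_rc : forall i, is_rc_measure i p q (phi i)).
Let E i (f : (edge G -> bool) -> R) : R := Rintegral (phi i) setT f.

Lemma local_on1 e : local_on [fset e] (fun w : edge G -> bool => (w e)%:R : R).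
Proof. by move=> w w' ww'; rewrite ww' // inE. Qed.

Lemma edge_prob_cvg i e :
  rcE p q i L (fun A => (e \in A)%:R) @[L --> @exhaustion V] --> edge_prob (phi i) e.
Proof. exact: rcE_cvg (@local_on1 e). Qed.

Lemma rcE_free_le_edge_prob F e : p < 1 -> val e `<=` F ->
  rcE p q false F (fun A => (e \in A)%:R) <= edge_prob (phi false) e.
Proof.
move=> p1 eF; apply: (cvgr_to_ge (@edge_prob_cvg false e)).
by apply: (@exhaustion_near _ _ F) => L FL; exact: rcE_free_le.
Qed.

Lemma edge_prob_le_rcE_wired F e : val e `<=` F ->
  edge_prob (phi true) e <= rcE p q true F (fun A => (e \in A)%:R).
Proof.
move=> eF; apply: (cvgr_to_le (@edge_prob_cvg true e)).
by apply: (@exhaustion_near _ _ F) => L FL; exact: rcE_wired_le.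
Qed.

(** An automorphism maps the exhaustion to itself, so both probabilities are limits of the same
    finite-volume values. *)
Lemma edge_prob_automorphism f (fG : automorphism G f) i e :
  edge_prob (phi i) (edge_map fG e) = edge_prob (phi i) e.
Proof.
have img_cvg : (fun L : {fset V} => f @` L) @ @exhaustion V --> @exhaustion V.
  move=> S [L0 _ L0S]; have [f' fK f'K] := fG.1.
  exists (f' @` L0) => // L /= /fsubsetP L0L; apply: L0S => /=.
  apply/fsubsetP => x xL0; apply/imfsetP; exists (f' x) => /=; last by rewrite f'K.
  by apply: L0L; apply/imfsetP; exists x.
have h1 := cvg_comp _ _ img_cvg (@edge_prob_cvg i (edge_map fG e)).
have h2 := @edge_prob_cvg i e.
apply: (@cvg_unique _ (@Rhausdorff R) _ _ _ _ h1).
apply: cvg_trans h2; apply: near_eq_cvg; apply: nearW => L /=.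
by rewrite rcE_img.
Qed.

Lemma E_mono D f : local_on D f ->
  (forall A, 0 <= f (fun e => e \in A)) ->
  (forall A B, A `<=` B -> f (fun e => e \in A) <= f (fun e => e \in B)) ->
  E false f <= E true f.
Proof.
move=> fD f0 fi.
have h0 := rcE_cvg phi_rc (i := false) fD.
have h1 := rcE_cvg phi_rc (i := true) fD.
rewrite -subr_ge0; apply: (cvgr_to_ge (cvgB h1 h0)).
apply: (@exhaustion_near _ _ fset0) => L _ /=; rewrite subr_ge0.
by apply: rcE_free_le_wired => // A B AB _; exact: fi.
Qed.

Definition all_open A (w : edge G -> bool) : bool := [forall e : A, w (val e)].

Lemma all_openP A (w : edge G -> bool) : reflect (forall e, e \in A -> w e) (all_open A w).
Proof.
by apply: (iffP forallP) => [H e eA|H e]; [exact: (H [` eA])|exact/H/valP].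
Qed.

Lemma all_open_local A : local_on A (fun w => (all_open A w)%:R : R).
Proof.
move=> w w' ww'; congr (nat_of_bool _)%:R; apply/all_openP/all_openP => H e eA.
  by rewrite -ww' // H.
by rewrite ww' // H.
Qed.

(* The sum of the spins over A minus their product is increasing. *)
Lemma all_open_le A : A != fset0 ->
  E true (fun w => (all_open A w)%:R) - E false (fun w => (all_open A w)%:R) <=
  \sum_(e <- A) (edge_prob (phi true) e - edge_prob (phi false) e).
Proof.
move=> /fset0Pn[e0 e0A].
pose f (w : edge G -> bool) : R := \sum_(e <- A) (w e)%:R - (all_open A w)%:R.
have f_local : local_on A f.
  move=> w w' ww'; rewrite /f (all_open_local ww'); congr (_ - _).
  by rewrite !big_seq; apply: eq_bigr => e eA; rewrite ww'.
have sum1 (w : edge G -> bool) e : e \in A -> \sum_(e' <- A) (w e')%:R =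
    ((w e)%:R + \sum_(e' <- (A `\ e)%fset) (w e')%:R)%R :> R.
  by move=> eA; rewrite (big_fsetD1 e).
have f0 w : 0 <= f w.
  rewrite /f subr_ge0; case: (all_openP A w) => [wA|_]; last first.
    by apply: sumr_ge0 => e _; exact: ler0n.
  by rewrite (sum1 _ e0 e0A) wA // lerDl; apply: sumr_ge0 => e _; exact: ler0n.
have fi B C : B `<=` C -> f (fun e => e \in B) <= f (fun e => e \in C).
  move=> /fsubsetP BC; have leBC e : (e \in B)%:R <= (e \in C)%:R :> R.
    by rewrite ler_nat; case: (boolP (e \in B)) => // /BC ->.
  rewrite /f; case: (all_openP A (fun e => e \in B)) => [BA|/existsNP[e /not_implyP[eA /negP eB]]].
    rewrite (introT (all_openP A _)) => [|e /BA /BC //].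
    by rewrite lerD2r; apply: ler_sum.
  case: (all_openP A (fun e => e \in C)) => [CA|_]; last by rewrite lerD2r; apply: ler_sum.
  (* The edge [e], closed in [B] and open in [C], adds 1 to the sum and pays for the product rising
     from 0 to 1. *)
  rewrite !(sum1 _ e eA) (negPf eB) CA //.
  rewrite add0r subr0 addrAC subrr add0r; exact: ler_sum.
have Ef i : E i f = \sum_(e <- A) edge_prob (phi i) e - E i (fun w => (all_open A w)%:R).
  have h := rcE_cvg phi_rc (i := i) f_local.
  apply: (@cvg_unique _ (@Rhausdorff R) _ _ _ _ h).
  have h1 := rcE_cvg phi_rc (i := i) (@all_open_local A).
  have h2 : (\sum_(e <- A) rcE p q i L (fun B => (e \in B)%:R)) @[L --> @exhaustion V] -->
      \sum_(e <- A) edge_prob (phi i) e.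
    elim: (enum_fset A) => [|e s IH].
      by under eq_cvg do rewrite big_nil; rewrite big_nil; exact: cvg_cst.
    under eq_cvg do rewrite big_cons; rewrite big_cons.
    by apply: cvgD => //; exact: edge_prob_cvg.
  have h12 : (\sum_(e <- A) rcE p q i L (fun B => (e \in B)%:R) -
      rcE p q i L (fun B => (all_open A (fun e => e \in B))%:R))
      @[L --> @exhaustion V] --> \sum_(e <- A) edge_prob (phi i) e -
        E i (fun w => (all_open A w)%:R) by apply: cvgB.
  rewrite (_ : (fun L => rcE p q i L (fun B => f (fun e => e \in B))) =
    (fun L => \sum_(e <- A) rcE p q i L (fun B => (e \in B)%:R) -
      rcE p q i L (fun B => (all_open A (fun e => e \in B))%:R))) //.
  apply/funext => L.
  rewrite /f /rcE -mulr_suml -mulrBl; congr (_ / _).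
  under [LHS]eq_bigr do rewrite mulrBr.
  rewrite sumrB; congr (_ - _); rewrite exchange_big /=.
  by apply: eq_bigr => B _; rewrite mulr_sumr.
have := @E_mono A f f_local (fun B => f0 _) fi.
rewrite !Ef sumrB; lra.
Qed.

End EdgeProbabilities.

(** * Existence of an edge with a gap, and lower bounds for Laplace transforms *)

Section Gap.
Local Open Scope fset_scope.
Context (R : realType) (V : choiceType) (G : sgraph V).
Implicit Types (D A B : {fset edge G}) (e : edge G).

Lemma measurable_coord (W : choiceType) d (T : measurableType d) (w : W) :
  measurable_fun setT (fun y : config W T => y w).
Proof.
move=> _ B mB; rewrite setTI; apply: sub_sigma_algebra.
by exists w; exists B.
Qed.

Definition open_cylinders : set (set (config (edge G) bool)) :=
  [set C | exists A, C = [set w | all_open A w]].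

Lemma measurable_all_open A :
  measurable [set w : config (edge G) bool | all_open A w].
Proof.
have -> : [set w : config (edge G) bool | all_open A w] =
    (\bigcap_(e in [set` A]) [set w : config (edge G) bool | w e])%classic.
  by apply/seteqP; split=> w /=; [move=> /all_openP wA e /= /wA|move=> wA; apply/all_openP].
apply: fin_bigcap_measurable => // e _.
have := @measurable_coord (edge G) _ bool e measurableT [set true]%classic.
rewrite setTI; have -> : (fun w : config (edge G) bool => w e) @^-1` [set true]%classic =
    [set w : config (edge G) bool | w e] by apply/seteqP; split.
by apply.
Qed.

Lemma measurable_open_cylinders :
  @measurable _ (config (edge G) bool) = <<s open_cylinders >>%classic.
Proof.
apply/seteqP; split; last first.
  apply: smallest_sub; first exact: sigma_algebra_measurable.
  by move=> _ [A ->]; exact: measurable_all_open.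
apply: smallest_sub; first exact: smallest_sigma_algebra.
have mC C : open_cylinders C ->
    @measurable _ (g_sigma_algebraType open_cylinders) C by exact: sub_sigma_algebra.
move=> _ [e [B _ ->]].
have me : @measurable _ (g_sigma_algebraType open_cylinders)
    [set w : config (edge G) bool | w e].
  apply: mC; exists [fset e]; apply/seteqP; split=> w /=.
    by move=> we; apply/all_openP => f; rewrite inE => /eqP ->.
  by move=> /all_openP; apply; rewrite inE.
rewrite -[X in X _]/(@measurable _ (g_sigma_algebraType open_cylinders)).
have [Bt|Bt] := pselect (B true); have [Bf|Bf] := pselect (B false).
- suff -> : [set y : config (edge G) bool | B (y e)] = setT by exact: measurableT.
  by apply/seteqP; split=> // y _ /=; case: (y e).
- suff -> : [set y : config (edge G) bool | B (y e)] = [set w | w e] by [].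
  by apply/seteqP; split=> y /=; case: (y e).
- suff -> : [set y : config (edge G) bool | B (y e)] = (~` [set w | w e])%classic.
    exact: measurableC.
  by apply/seteqP; split=> y /=; case: (y e).
- suff -> : [set y : config (edge G) bool | B (y e)] = set0 by exact: measurable0.
  by apply/seteqP; split=> // y /=; case: (y e).
Qed.

Lemma Rintegral_all_open (P : probability (config (edge G) bool) R) A :
  Rintegral P setT (fun w : config (edge G) bool => (all_open A w)%:R) =
  fine (P [set w | all_open A w]).
Proof.
rewrite /Rintegral; congr fine.
transitivity (P ([set w : config (edge G) bool | all_open A w] `&` setT)%classic); last by rewrite setIT.
rewrite -integral_indic //; last exact: measurable_all_open.
apply: eq_integral => w _; congr (_%:E); rewrite indicE; congr (nat_of_bool _)%:R.
by apply/idP/idP; rewrite inE.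
Qed.

(** The events that a given finite set is fully open are stable under intersection and generate the
    product sigma-algebra. *)
Lemma eq_probability_all_open (P Q : probability (config (edge G) bool) R) :
  (forall A, Rintegral P setT (fun w : config (edge G) bool => (all_open A w)%:R : R) =
    Rintegral Q setT (fun w : config (edge G) bool => (all_open A w)%:R)) ->
  forall C, measurable C -> P C = Q C.
Proof.
move=> PQ; apply: (measure_unique open_cylinders (fun=> setT)).
- exact: measurable_open_cylinders.
- move=> _ _ [A ->] [B ->]; exists (A `|` B); apply/seteqP; split=> w /=.
    move=> [/all_openP wA /all_openP wB]; apply/all_openP => e.
    by rewrite inE => /orP[/wA|/wB].
  move=> /all_openP wAB; split; apply/all_openP => e eA; apply: wAB;
  by rewrite inE eA ?orbT.
- move=> _; exists fset0; apply/seteqP; split=> w // _.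
  by apply/all_openP.
- by apply/seteqP; split=> // w _; exists 0%N.
- move=> _ [A ->]; have := PQ A; rewrite !Rintegral_all_open => PQA.
  have fP := fin_num_measure P _ (measurable_all_open A).
  have fQ := fin_num_measure Q _ (measurable_all_open A).
  by move/(congr1 (@EFin R)): PQA; rewrite (fineK fP) (fineK fQ).
- by move=> _; rewrite -ge0_fin_numE ?measure_ge0 // fin_num_measure.
Qed.

Context (p q : R) (p01 : 0 <= p <= 1) (q1 : 1 <= q).
Context (phi : bool -> probability (config (edge G) bool) R).
Context (phi_rc : forall i, is_rc_measure i p q (phi i)).
Let E i (f : (edge G -> bool) -> R) : R := Rintegral (phi i) setT f.

(** Without a gap at any edge, [all_open_le] and monotonicity give equal probabilities to all
    increasing cylinders [all_open A], and these determine the law. *)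
Lemma exists_gap_edge :
  (exists2 C, measurable C & phi false C <> phi true C) ->
  exists e, edge_prob (phi false) e < edge_prob (phi true) e.
Proof.
move=> [C mC neC]; apply: contrapT => /forallNP nogap; apply: neC.
apply: eq_probability_all_open mC => A; apply/eqP; rewrite eq_le.
have H := E_mono p01 q1 phi_rc (@all_open_local R V G A); rewrite H /=.
- have [->|A0] := eqVneq A fset0.
    have E1 w : (all_open (G := G) fset0 w)%:R = 1 :> R.
      by have -> : all_open (G := G) fset0 w by exact/all_openP.
    rewrite (_ : (fun w => _) = (fun=> 1)); last by apply/funext.
    by rewrite !Rintegral_cst // /mscale /= !probability_setT.
  have := all_open_le p01 q1 phi_rc A0.
  have : \sum_(e <- A) (edge_prob (phi true) e - edge_prob (phi false) e) <= 0.
    apply: sumr_le0 => e _; rewrite subr_le0 leNgt; apply/negP; exact: nogap.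
  lra.
- by move=> B; exact: ler0n.
- move=> B B' /fsubsetP BB'; rewrite ler_nat.
  case: (all_openP A (fun e => e \in B)) => // BA.
  by rewrite (introT (all_openP A _)) => // e /BA /BB'.
Qed.

Lemma bern_p1 (X A : {fset edge G}) e : e \in X -> e \notin A -> p = 1 -> bern p X A = 0.
Proof.
move=> eX eA ->; rewrite /bern subrr expr0n cardfs_eq0.
have -> : (X `\` A == fset0) = false; last by rewrite mulr0.
by apply/negP => /eqP XA; have := in_fset0 e; rewrite -XA in_fsetD eX eA.
Qed.

Lemma bern_p0 (X A : {fset edge G}) e : e \in A -> p = 0 -> bern p X A = 0.
Proof.
move=> eA ->; rewrite /bern expr0n cardfs_eq0.
have -> : (A == fset0) = false; last by rewrite mul0r.
by apply/negP => /eqP A0; move: eA; rewrite A0.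
Qed.

Lemma edge_prob_ge0 i e : 0 <= edge_prob (phi i) e.
Proof.
apply: (cvgr_to_ge (@edge_prob_cvg _ _ _ _ _ _ phi_rc i e)).
apply: (@exhaustion_near _ _ fset0) => L _.
apply: divr_ge0; last by rewrite ltW // rcZ_gt0.
by apply: sumr_ge0 => A _; rewrite mulr_ge0 ?rcw_ge0.
Qed.

Lemma edge_prob_le1 i e : edge_prob (phi i) e <= 1.
Proof.
apply: (cvgr_to_le (@edge_prob_cvg _ _ _ _ _ _ phi_rc i e)).
apply: (@exhaustion_near _ _ fset0) => L _.
rewrite /rcE ler_pdivrMr ?rcZ_gt0 // mul1r; apply: ler_sum => A _.
by rewrite ler_piMr ?rcw_ge0 // lern1 leq_b1.
Qed.

(** Together with [edge_prob_p0] this rules out a gap at the parameters where the finite-energy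
    constants vanish. *)
Lemma edge_prob_p1 i e : p = 1 -> edge_prob (phi i) e = 1.
Proof.
move=> p_1; apply/eqP; rewrite eq_le edge_prob_le1 /=.
apply: (cvgr_to_ge (@edge_prob_cvg _ _ _ _ _ _ phi_rc i e)).
apply: (@exhaustion_near _ _ (val e)) => L eL.
rewrite /rcE ler_pdivlMr ?rcZ_gt0 // mul1r; apply: ler_sum => A _.
case: (boolP (e \in A)) => eA; first by rewrite mulr1.
by rewrite /rcw (@bern_p1 _ _ e) ?in_edges_in // !mul0r.
Qed.

Lemma edge_prob_p0 i e : p = 0 -> edge_prob (phi i) e = 0.
Proof.
move=> p_0; apply/eqP; rewrite eq_le edge_prob_ge0 andbT.
apply: (cvgr_to_le (@edge_prob_cvg _ _ _ _ _ _ phi_rc i e)).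
apply: (@exhaustion_near _ _ (val e)) => L eL.
rewrite /rcE ler_pdivrMr ?rcZ_gt0 // mul0r big_seq big1 // => A _.
case: (boolP (e \in A)) => eA; last by rewrite mulr0.
by rewrite /rcw (@bern_p0 _ _ e) // !mul0r.
Qed.

Context (Delta : nat) (nb : V -> {fset V}).
Context (nbE : forall u v, G u v -> v \in nb u).
Context (nb_card : forall u, (#|` nb u| <= Delta)%N).

(** The state [s] is the one counted: open for the wired measure, closed for the free one. This lets
    both cases share the upper bound. *)
Definition laplace (s : bool) (t : R) (S : {fset edge G}) (w : edge G -> bool) : R :=
  expR (- t * \sum_(e <- S) (w e == s)%:R).

Lemma laplace_local s t S : local_on S (laplace s t S).
Proof.
move=> w w' ww'; rewrite /laplace; congr (expR (_ * _)).
by rewrite !big_seq; apply: eq_bigr => e eS; rewrite ww'.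
Qed.

(** Tilting is applied to the event that the crossing edges are closed. Every such edge has an
    endpoint in the inner boundary of F, so [Delta * #|K|] bounds their number, and on the event the
    means are those of the free measure of F. *)
Lemma laplace_wired_lb (F K : {fset V}) (S : {fset edge G}) (t : R) :
  0 <= t -> p < 1 -> (inner_bd G F `<=` [set` K])%classic -> S `<=` edges_in G F ->
  ((1 - p) / 2) ^+ (Delta * #|` K|) *
    expR (- t * \sum_(e <- S) edge_prob (phi false) e) <=
  E true (laplace true t S).
Proof.
move=> t0 p1 FK SF.
apply: (cvgr_to_ge (rcE_cvg phi_rc (i := true) (@laplace_local true t S))).
(* Once L contains the neighbours of F, its inner boundary misses F, as [sum_no_crossing] requires
   in the wired case. *)
apply: (@exhaustion_near _ _ (F `|` \bigcup_(u <- F) nb u)) => L.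
rewrite fsubUset => /andP[FL nbL].
have FB x : x \in F -> ~ bdy G true L x.
  move=> xF /= [_ [v vL xv]]; move/negP: vL; apply; apply: (fsubsetP nbL).
  apply/bigfcupP; exists x; [by rewrite xF|exact: nbE].
have DK : (#|` crossing G L F| <= Delta * #|` K|)%N.
  apply: (card_edges_touching nbE nb_card) => e; rewrite in_crossing.
  move=> /and3P[_ /fset0Pn[x]]; rewrite in_fsetI => /andP[xe xF].
  move=> /fsubsetPn[y ye yF]; exists x => //.
  have [a [b [ab eE]]] := edgeP e.
  apply: FK; split=> //; exists y => //.
  have xNy : x != y by apply/eqP => xE; move: yF; rewrite -xE xF.
  move: xe ye xNy; rewrite eE => /fset2P[->|->] /fset2P[->|->]; rewrite ?eqxx //.
  by rewrite adj_sym.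
rewrite /rcE ler_pdivlMr ?rcZ_gt0 // mulrAC.
have tilt := @tilt_lb R _ (edge G) (edges_in G L) (rcw p q true L)
  (fun A => [disjoint A & crossing G L F]%:R) S
  (fun e A => (e \in A)%:R) (fun e => edge_prob (phi false) e) t t0.
apply: le_trans (le_trans (tilt _ _ _) _).
- rewrite mulrC; apply: ler_wpM2l; first exact: expR_ge0.
  apply: le_trans (closed_lb p01 q1 true (D := crossing G L F) _); last first.
    by apply/fsubsetP => e; rewrite in_crossing in_edges_in => /andP[].
  apply: ler_wpM2r; first by rewrite ltW // rcZ_gt0.
  by have /andP[p0 _] := p01; apply: ler_wiXn2l => //; lra.
- exact: rcw_ge0.
- by move=> A; case: (fdisjoint _ _); rewrite ?lexx ler01.
- move=> e eS; have eF := fsubsetP SF _ eS; rewrite in_edges_in in eF.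
  rewrite (sum_no_crossing p01 q1 FL FB); last first.
    by move=> A1 A2 A1F A2L; rewrite (mem_split _ eF A2L).
  apply: ler_wpM2r; last exact: rcE_free_le_edge_prob.
  by apply: sumr_ge0 => A _; rewrite mulr_ge0 ?rcw_ge0.
apply: ler_sum => A _; rewrite /laplace.
by under [X in _ <= _ * expR (_ * X)]eq_bigr do rewrite eqb_id.
Qed.

(** The event is now that all edges of K are open. On it, an edge of [S] is closed with probability
    at most that under the wired measure of F, which is at most its infinite-volume value. *)
Lemma laplace_free_lb (F K : {fset V}) (S : {fset edge G}) (t : R) :
  0 <= t -> 0 < p -> connected_on G [set` K] ->
  (inner_bd G F `<=` [set` K])%classic -> S `<=` edges_in G F ->
  (p / q / 2) ^+ (Delta * #|` K|) *
    expR (- t * \sum_(e <- S) (1 - edge_prob (phi true) e)) <=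
  E false (laplace false t S).
Proof.
move=> t0 p0 Kc FK SF.
apply: (cvgr_to_ge (rcE_cvg phi_rc (i := false) (@laplace_local false t S))).
apply: (@exhaustion_near _ _ (F `|` K)) => L.
rewrite fsubUset => /andP[FL KL].
have DK : (#|` edges_in G K| <= Delta * #|` K|)%N.
  apply: (card_edges_touching nbE nb_card) => e; rewrite in_edges_in => /fsubsetP eK.
  have [a [b [ab eE]]] := edgeP e.
  have ae : a \in val e by rewrite eE fset21.
  by exists a => //; exact: eK.
rewrite /rcE ler_pdivlMr ?rcZ_gt0 // mulrAC.
have tilt := @tilt_lb R _ (edge G) (edges_in G L) (rcw p q false L)
  (fun A => (edges_in G K `<=` A)%:R) S
  (fun e A => 1 - (e \in A)%:R) (fun e => 1 - edge_prob (phi true) e) t t0.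
apply: le_trans (le_trans (tilt _ _ _) _).
- rewrite mulrC; apply: ler_wpM2l; first exact: expR_ge0.
  apply: le_trans (open_lb p01 q1 (D := edges_in G K) _); last exact: edges_inS.
  apply: ler_wpM2r; first by rewrite ltW // rcZ_gt0.
  have /andP[_ p1] := p01; have q0 := q_gt0 q1.
  have pq0 : 0 <= p / q by rewrite divr_ge0 // ltW.
  have pq1 : p / q <= 1 by rewrite ler_pdivrMr // mul1r (le_trans p1).
  by apply: ler_wiXn2l => //; lra.
- exact: rcw_ge0.
- by move=> A; case: (fsubset _ _); rewrite ?lexx ler01.
- move=> e eS; have eF := fsubsetP SF _ eS; rewrite in_edges_in in eF.
  have h := sum_connected_open p01 q1 FL eF Kc FK.
  have h2 := edge_prob_le_rcE_wired p01 q1 phi_rc eF.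
  set W := \sum_(A <- _) _ * _ in h *.
  have W0 : 0 <= W by apply: sumr_ge0 => A _; rewrite mulr_ge0 ?rcw_ge0.
  have -> : \sum_(A <- fpowerset (edges_in G L)) rcw p q false L A *
      ((1 - (e \in A)%:R) * (edges_in G K `<=` A)%:R) =
    W - \sum_(A <- fpowerset (edges_in G L)) rcw p q false L A *
      ((e \in A)%:R * (edges_in G K `<=` A)%:R).
    by rewrite /W -sumrB; apply: eq_bigr => A _; rewrite mulrBl mul1r mulrBr.
  rewrite mulrBl mul1r lerD2l lerN2; apply: le_trans h.
  by apply: ler_wpM2r.
apply: ler_sum => A _; rewrite /laplace.
under [X in _ <= _ * expR (_ * X)]eq_bigr do rewrite eqbF_neg.
rewrite (_ : \sum_(i <- S) (1 - (i \in A)%:R) = \sum_(i <- S) (i \notin A)%:R :> R) //.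
by apply: eq_bigr => e _; case: (e \in A); rewrite ?subrr ?subr0.
Qed.

End Gap.

(** * Separated translates of an edge in a Folner set *)

Section FiniteRange.

(** Uniformity from finitely many orbits: [h] will send a point to its orbit, and a bound at one
    point serves its whole orbit. Degrees, the density of an orbit and the coding radius are all
    bounded this way. *)
Lemma finite_range_bound (T : Type) (U : choiceType) (h : T -> U) (P : T -> nat -> Prop) :
  finite_set (range h) -> (forall x, exists n, P x n) ->
  (forall x n m, (n <= m)%N -> P x n -> P x m) ->
  (forall x y n, h x = h y -> P x n -> P y n) ->
  exists n, forall x, P x n.
Proof.
move=> /finite_seqP[s hs] exP mP iP.
suff H (s' : seq U) : exists n, forall x, h x \in s' -> P x n.
  have [n Pn] := H s; exists n => x; apply: Pn.
  have : range h (h x) by exists x.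
  by rewrite hs.
elim: s' => [|c s' [n Pn]]; first by exists 0%N.
have [[x hx]|nx] := pselect (exists x, h x = c); last first.
  exists n => y; rewrite inE => /orP[/eqP yc|/Pn //].
  by case: nx; exists y.
have [m Pm] := exP x; exists (maxn m n) => y; rewrite inE => /orP[/eqP yc|/Pn].
  by apply: (mP _ m); [exact: leq_maxl|apply: iP Pm; rewrite hx yc].
by apply: mP; exact: leq_maxr.
Qed.

End FiniteRange.

Section Walks.
Context (W : eqType) (H : rel W).

(** The combinatorial form of [gdist] being at most n, free of extended reals. *)
Definition within n u v := exists s, [/\ path H u s, last u s = v & (size s <= n)%N].

Lemma within_refl n u : within n u u. Proof. by exists [::]. Qed.

Lemma within1 u v : H u v -> within 1 u v.
Proof. by move=> uv; exists [:: v]; rewrite /= uv. Qed.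

Lemma within_leq m n u v : (m <= n)%N -> within m u v -> within n u v.
Proof. by move=> mn [s [? ? sm]]; exists s; split=> //; exact: leq_trans mn. Qed.

Lemma within_trans m n u v w : within m u v -> within n v w -> within (m + n) u w.
Proof.
move=> [s [us <- sm]] [t [vt <- tn]]; exists (s ++ t).
by rewrite cat_path us vt last_cat size_cat leq_add.
Qed.

Lemma within_sym n u v : symmetric H -> within n u v -> within n v u.
Proof.
move=> Hs [s [us uv sn]]; exists (rev (belast u s)); split.
- by rewrite -uv rev_path (eq_path (e' := H)) // => x y; exact: Hs.
- by case: s us uv sn => [|x s] //= _ _ _; rewrite rev_cons last_rcons.
- by rewrite size_rev size_belast.
Qed.

Lemma within_morph f n u v : (forall x y, H (f x) (f y) = H x y) ->
  within n u v -> within n (f u) (f v).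
Proof.
move=> Hf [s [us <- sn]]; exists (map f s).
split; [|by rewrite last_map|by rewrite size_map].
by rewrite path_map; rewrite (eq_path (e' := H)).
Qed.

Lemma gdist_within (R : realType) n u v : (gdist R H u v <= (n%:R)%:E)%E -> within n u v.
Proof.
apply: contraPP => nw; apply/negP; rewrite -ltNge.
apply: (@lt_le_trans _ _ (n.+1%:R)%:E); first by rewrite lte_fin ltr_nat.
apply: le_ereal_inf_tmp => _ [s [us uv] <-].
rewrite lee_fin ler_nat ltnNge; apply/negP => sn.
by apply: nw; exists s.
Qed.

Lemma within_gdist (R : realType) n u v : within n u v -> (gdist R H u v <= (n%:R)%:E)%E.
Proof.
move=> [s [us uv sn]]; apply: (@le_trans _ _ (size s)%:R%:E); last by rewrite lee_fin ler_nat.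
by apply: ereal_inf_lbound; exists s.
Qed.

End Walks.

Section Boundary.
Context (R : realType) (V : choiceType) (G : sgraph V).

Lemma vboundary_sub (F : {fset V}) : vboundary R G [set` F] `<=` [set` F].
Proof.
move=> u ub /=; apply/negPn/negP => uF.
have : (gdist_set R G u (~` [set` F]) <= 0)%E.
  apply: (@le_trans _ _ (gdist R G u u)).
    by apply: ereal_inf_lbound; exists u => //=; apply/negP.
  exact: (@within_gdist _ _ _ 0 _ _ (within_refl _ _ _)).
by move: ub; rewrite /vboundary /= => ->; rewrite lee_fin ler10.
Qed.

Lemma inner_bd_vboundary (F : {fset V}) : inner_bd G F `<=` vboundary R G [set` F].
Proof.
move=> u [uF [v vF uv]]; apply/eqP; rewrite eq_le; apply/andP; split.
  apply: (@le_trans _ _ (gdist R G u v)).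
    by apply: ereal_inf_lbound; exists v => //=; apply/negP.
  exact: (@within_gdist _ _ _ 1 _ _ (within1 uv)).
apply: le_ereal_inf_tmp => _ [w wF <-]; apply: le_ereal_inf_tmp => _ [s [us uw] <-].
rewrite lee_fin ler1n; case: s us uw => //= _ uw.
by case: wF; rewrite /= -uw.
Qed.

Lemma inner_bd_fset_vboundary (F : {fset V}) :
  inner_bd G F `<=` [set` fset_set (vboundary R G [set` F])].
Proof.
move=> u ub /=; have fin : finite_set (vboundary R G [set` F]).
  by apply: sub_finite_set (@vboundary_sub F) _; exact: finite_fset.
by rewrite in_fset_set //; apply/mem_set/inner_bd_vboundary.
Qed.

End Boundary.

Section Geometry.
Local Open Scope fset_scope.
Context (V : choiceType) (G : sgraph V).
Context (G_connected : connected_on G [set: V]) (G_lf : locally_finite G)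
  (G_qt : quasi_transitive G).
Implicit Types (F K U : {fset V}) (e : edge G).

Lemma automorphism_id : automorphism G id.
Proof. by split=> //; exists id. Qed.

Lemma automorphism_comp f g : automorphism G f -> automorphism G g -> automorphism G (f \o g).
Proof.
move=> [fb fG] [gb gG]; split; first exact: bij_comp.
by move=> u v /=; rewrite fG gG.
Qed.

Let orbit_eq u v :
  [set w | exists2 f, automorphism G f & f u = w]%classic =
  [set w | exists2 f, automorphism G f & f v = w]%classic ->
  exists2 f, automorphism G f & f u = v.
Proof.
move=> uv; have : [set w | exists2 f, automorphism G f & f v = w]%classic v.
  by exists id => //; exact: automorphism_id.
by rewrite -uv.
Qed.

Definition nbrs u : {fset V} := fset_set [set v | G u v]%classic.

Lemma in_nbrs u v : (v \in nbrs u) = G u v.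
Proof. by rewrite in_fset_set; [apply/idP/idP; rewrite inE|exact: G_lf]. Qed.

Lemma nbrs_bound : exists Delta, forall u, (#|` nbrs u| <= Delta)%N.
Proof.
apply: (finite_range_bound G_qt) => [x|x n m|x y n /orbit_eq[f fG <-]].
- by exists #|` nbrs x|.
- by move=> nm /leq_trans; apply.
have -> : nbrs (f x) = f @` nbrs x.
  have [f' fK f'K] := fG.1; apply/fsetP => z; rewrite in_nbrs.
  apply/idP/imfsetP => /= [fxz|[w + ->]]; last by rewrite in_nbrs fG.2.
  by exists (f' z); rewrite ?f'K // in_nbrs -fG.2 f'K.
by rewrite card_imfset_inj //; exact: automorphism_inj fG.
Qed.

Fixpoint fball n u : {fset V} :=
  if n is n'.+1 then fball n' u `|` \bigcup_(v <- fball n' u) nbrs v else [fset u].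

Lemma card_bigcup_le (X : {fset V}) (f : V -> {fset V}) m :
  (forall u, (#|` f u| <= m)%N) -> (#|` \bigcup_(v <- X) f v| <= #|` X| * m)%N.
Proof.
move=> fm; have -> : (#|` X| * m = \sum_(v <- X) m)%N.
  by rewrite big_const_seq count_predT iter_addn_0 mulnC.
elim/big_ind2: _ => [|X1 n1 X2 n2 h1 h2|v _]; [by rewrite cardfs0| |exact: fm].
by apply: leq_trans (leq_card_fsetU _ _) _; exact: leq_add.
Qed.

Lemma card_fball Delta n u : (forall u, (#|` nbrs u| <= Delta)%N) ->
  (#|` fball n u| <= Delta.+1 ^ n)%N.
Proof.
move=> nbD; elim: n => [|n IH] /=; first by rewrite cardfs1.
apply: leq_trans (leq_card_fsetU _ _) _.
apply: (@leq_trans (#|` fball n u| + #|` fball n u| * Delta)%N).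
  by rewrite leq_add2l; exact: card_bigcup_le.
by rewrite -mulnS expnSr leq_mul2r IH orbT.
Qed.

Lemma fballS n u v w : v \in fball n u -> G v w -> w \in fball n.+1 u.
Proof.
move=> vu vw /=; rewrite in_fsetU; apply/orP; right.
by apply/bigfcupP; exists v; rewrite ?vu // in_nbrs.
Qed.

Lemma fball_sub m n u : (m <= n)%N -> fball m u `<=` fball n u.
Proof.
move=> /subnK <-; elim: (n - m)%N => [|k IH]; first exact: fsubset_refl.
exact: fsubset_trans IH (fsubsetUl _ _).
Qed.

Lemma within_fball n u v : within G n u v -> v \in fball n u.
Proof.
move=> [s [us <- sn]]; apply: (fsubsetP (fball_sub u sn)) => {sn}.
elim/last_ind: s us => [|s x IH]; first by rewrite /= inE.
rewrite rcons_path last_rcons size_rcons => /andP[us sx].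
exact: fballS (IH us) sx.
Qed.

Lemma orbit_dense x0 : exists D, forall u, exists2 f, automorphism G f & within G D u (f x0).
Proof.
apply: (finite_range_bound G_qt) => [x|x n m nm [f fG xf]|x y n /orbit_eq[g gG <-] [f fG xf]].
- have [s [xs sx _]] := @G_connected x x0 I I.
  by exists (size s), id; [exact: automorphism_id|exists s].
- by exists f => //; exact: within_leq xf.
exists (g \o f); first exact: automorphism_comp.
by apply: within_morph xf; exact: gG.2.
Qed.

(** A walk of n steps in the line graph visits n + 1 edges, consecutive ones share a vertex, and
    each costs at most one step in G. *)
Lemma within_line n e e' x y : within (line_graph (G := G)) n e e' ->
  x \in val e -> y \in val e' -> within G n.+1 x y.
Proof.
have edge1 (f : edge G) a b : a \in val f -> b \in val f -> within G 1 a b.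
  have [u [v [uv ->]]] := edgeP f.
  move=> /fset2P[->|->] /fset2P[->|->]; try exact: within_refl.
    exact: within1.
  by apply: within1; rewrite adj_sym.
move=> [s [es se' sn]] xe ye'; apply: (@within_leq _ _ (size s).+1) => // {sn n}.
elim: s e x es se' xe => [|f s IH] e x /=.
  by move=> _ -> xe; exact: edge1 xe ye'.
move=> /andP[/andP[_ /fset0Pn[z]]]; rewrite in_fsetI => /andP[ze zf] fs sE xe.
by have := within_trans (edge1 _ _ _ xe ze) (IH _ _ fs sE zf); rewrite add1n.
Qed.

(** A walk can leave F only by a step from an inner boundary vertex; its last vertex makes no step
    and is therefore exempt. *)
Lemma walk_inside F u s : path G u s -> u \in F ->
  (forall x, x \in belast u s -> ~ inner_bd G F x) -> forall x, x \in s -> x \in F.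
Proof.
elim: s u => [//|y s IH] u /= /andP[uy ys] uF nbd x.
have yF : y \in F.
  apply/negPn/negP => yF; apply: (nbd u); first exact: mem_head.
  by split=> //; exists y.
rewrite inE => /orP[/eqP -> //|]; apply: IH ys yF _ x => z zs.
by apply: nbd; rewrite inE zs orbT.
Qed.

(** Greedy choice: each chosen vertex discards only its own m-ball, hence at most [M] vertices of
    [U]. *)
Lemma greedy_separated m M U : (forall u, (#|` fball m u| <= M)%N) ->
  exists U', [/\ U' `<=` U,
    forall u v, u \in U' -> v \in U' -> u != v -> ~ within G m u v &
    (#|` U| <= M * #|` U'|)%N].
Proof.
move=> ballM; have [k] := ubnP #|` U|; elim: k U => // k IH U Uk.
have [->|/fset0Pn[u uU]] := eqVneq U fset0.
  by exists fset0; split=> //; rewrite cardfs0.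
have uu : u \in fball m u by apply: within_fball; exact: within_refl.
have [|U' [U'U sep cardU]] := IH (U `\` fball m u).
  have : (0 < #|` U `&` fball m u|)%N.
    by rewrite cardfs_gt0; apply/fset0Pn; exists u; rewrite in_fsetI uU.
  by move: Uk; rewrite -(cardfsID (fball m u) U); move: (#|` _|) (#|` _|) => *; lia.
have notball v : v \in U' -> v \notin fball m u.
  by move=> /(fsubsetP U'U); rewrite in_fsetD => /andP[].
exists (u |` U'); split.
- by rewrite fsubUset fsub1set uU (fsubset_trans U'U) // fsubsetDl.
- move=> v w; rewrite !in_fset1U => /orP[/eqP ->|vU'] /orP[/eqP ->|wU'].
  + by rewrite eqxx.
  + by move=> _ /within_fball; apply/negP; exact: notball.
  + move=> _ /(within_sym (adj_sym G)) /within_fball; apply/negP; exact: notball.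
  + exact: sep.
- rewrite cardfsU1; have -> : u \notin U' by apply/negP => /notball; rewrite uu.
  rewrite add1n mulnS -(cardfsID (fball m u) U) leq_add //.
  by apply: leq_trans (ballM u); apply: fsubset_leq_card; exact: fsubsetIr.
Qed.

(** Vertices near K are charged to K. To each remaining vertex of F belongs a translate of [e0]
    close to it, hence inside F, and a separated family of these vertices gives translates with
    disjoint r-balls. *)
Lemma separated_edges e0 r : exists M, forall F K, (inner_bd G F `<=` [set` K])%classic ->
  exists S : {fset edge G}, [/\ S `<=` edges_in G F,
    forall e, e \in S -> exists f (fG : automorphism G f), e = edge_map fG e0,
    forall e e' w, e \in S -> e' \in S -> e != e' ->
      within (line_graph (G := G)) r e w -> ~ within (line_graph (G := G)) r e' w &
    (#|` F| <= M * (#|` K| + #|` S|))%N].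
Proof.
have [Delta nbD] := nbrs_bound.
have [x0 [y0 [xy0 e0E]]] := edgeP e0.
have [D dense] := orbit_dense x0.
(* If two r-balls of the line graph meet, the edges are at line distance at most r + r, so their
   marked endpoints are within (r + r) + 1 in G; each endpoint is within [D] of its vertex. *)
pose m := (D + ((r + r).+1 + D))%N.
exists (maxn (Delta.+1 ^ D.+1) (Delta.+1 ^ m)) => F K FK.
(* From a vertex of F outside [bad], a walk of length at most [D] followed by one more edge stays in
   F. *)
pose bad : {fset V} := \bigcup_(k <- K) fball D.+1 k.
have sdense u : {f | automorphism G f /\ within G D u (f x0)}.
  by apply: cid; have [f fG uf] := dense u; exists f.
pose g u := sval (sdense u).
have gG u : automorphism G (g u) by have [] := svalP (sdense u).
have gu u : within G D u (g u x0) by have [] := svalP (sdense u).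
pose ed u := edge_map (gG u) e0.
have edE u : val (ed u) = [fset g u x0; g u y0].
  by rewrite /= e0E imfsetU !imfset_fset1.
have [U' [U'U sep cardU]] := @greedy_separated m _ (F `\` bad) (fun u => card_fball m u nbD).
have ed_sep u v w : u \in U' -> v \in U' -> u != v ->
    within (line_graph (G := G)) r (ed u) w -> ~ within (line_graph (G := G)) r (ed v) w.
  move=> uU vU uv uw vw; apply: (sep _ _ uU vU uv).
  have line_sym : symmetric (line_graph (G := G)).
    by move=> e e'; rewrite /line_graph eq_sym fsetIC.
  have uvL := within_trans uw (within_sym line_sym vw).
  have xu : g u x0 \in val (ed u) by rewrite edE fset21.
  have xv : g v x0 \in val (ed v) by rewrite edE fset21.
  apply: within_trans (gu u) _; apply: within_trans (within_line uvL xu xv) _.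
  by apply: within_sym (gu v); exact: adj_sym.
have ed_inj : {in U' &, injective ed}.
  move=> u v uU vU euv; apply/eqP/negPn/negP => uv.
  apply: (ed_sep u v (ed u) uU vU uv); first exact: within_refl.
  by rewrite euv; exact: within_refl.
exists (ed @` U'); split.
- apply/fsubsetP => _ /imfsetP[u /= uU ->]; rewrite in_edges_in.
  move: (fsubsetP U'U _ uU); rewrite in_fsetD => /andP[ubad uF].
  have [s [us sx sD]] := gu u.
  have nbd x : x \in u :: s -> ~ inner_bd G F x.
    move=> xs /FK xK; move/negP: ubad; apply; apply/bigfcupP; exists x; first by rewrite xK.
    apply: within_fball; apply: within_sym; first exact: adj_sym.
        case/splitPl: xs us sx sD => s1 s2 xE; rewrite cat_path size_cat.
    move=> /andP[us1 _] _ sD; exists s1; split=> //.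
    by apply: leq_trans (leq_trans (leq_addr _ _) sD) (leqnSn _).
  have inF : forall x, x \in rcons s (g u y0) -> x \in F.
    apply: (@walk_inside F u).
    - by rewrite rcons_path us sx (gG u).2.
    - exact: uF.
    - by move=> x; rewrite belast_rcons; exact: nbd.
  rewrite edE; apply/fsubsetP => z /fset2P[->|->]; last by apply: inF; rewrite mem_rcons mem_head.
  case: s us sx sD nbd inF => [_ <- //|y s _ <- _ _ inF].
  by apply: inF; rewrite mem_rcons inE /= mem_last orbT.
- by move=> _ /imfsetP[u /= uU ->]; exists (g u), (gG u).
- move=> _ _ w /imfsetP[u /= uU ->] /imfsetP[v /= vU ->] uv.
  by apply: ed_sep => //; apply: contra uv => /eqP ->.
have -> : #|` ed @` U'| = #|` U'| by rewrite card_in_imfset.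
rewrite -(cardfsID bad F) mulnDr; apply: leq_add.
  apply: (@leq_trans #|` bad|); first by apply: fsubset_leq_card; exact: fsubsetIr.
  apply: leq_trans (card_bigcup_le _ (fun k => card_fball D.+1 k nbD)) _.
  by rewrite mulnC leq_mul2r leq_maxl orbT.
by apply: leq_trans cardU _; rewrite leq_mul2r leq_maxr orbT.
Qed.

End Geometry.

(** * Finitary codings *)

Section Resampling.
Context (R : realType) (W : choiceType) (d : measure_display) (T : measurableType d).
Implicit Types (B : set W) (F : {fset W}) (y z : config W T).

Definition glue B y z : config W T := fun w => if `[< B w >] then y w else z w.

Lemma glue_in B y z w : B w -> glue B y z w = y w.
Proof. by move=> Bw; rewrite /glue asboolT. Qed.

Lemma glue_out B y z w : ~ B w -> glue B y z w = z w.
Proof. by move=> Bw; rewrite /glue asboolF. Qed.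

Lemma measurable_config d' (X : measurableType d') (f : X -> config W T) :
  (forall w, measurable_fun setT (fun x => f x w)) -> measurable_fun setT f.
Proof.
move=> mf; apply: (@measurability _ _ X (config W T) setT f (@coord_events W d T) erefl).
move=> _ [_ [w [A mA ->]] <-]; rewrite setTI.
by have := mf w measurableT A mA; rewrite setTI.
Qed.

Lemma measurable_glue B :
  measurable_fun setT (fun yz : config W T * config W T => glue B yz.1 yz.2).
Proof.
apply: measurable_config => w.
have [Bw|Bw] := pselect (B w).
  rewrite (_ : (fun x => _) = (fun y : config W T => y w) \o fst).
    by apply: measurableT_comp; [exact: measurable_coord|exact: measurable_fst].
  by apply/funext => x /=; rewrite glue_in.
rewrite (_ : (fun x => _) = (fun y : config W T => y w) \o snd).
  by apply: measurableT_comp; [exact: measurable_coord|exact: measurable_snd].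
by apply/funext => x /=; rewrite glue_out.
Qed.

Definition rectangle F (A : W -> set T) : set (config W T) :=
  [set y | forall w, w \in F -> A w (y w)].

Definition rectangles : set (set (config W T)) :=
  [set C | exists F A, (forall w, measurable (A w)) /\ C = rectangle F A].

Lemma measurable_rectangle F A : (forall w, measurable (A w)) ->
  measurable (rectangle F A).
Proof.
move=> mA; have -> : rectangle F A =
    \bigcap_(w in [set` F]) [set y : config W T | A w (y w)].
  by apply/seteqP; split=> y H w /=; exact: H.
apply: fin_bigcap_measurable => // w _.
by have := @measurable_coord W d T w measurableT _ (mA w); rewrite setTI.
Qed.

Lemma measurable_rectangles : @measurable _ (config W T) = <<s rectangles >>.
Proof.
apply/seteqP; split; last first.
  apply: smallest_sub; first exact: sigma_algebra_measurable.
  by move=> _ [F [A [mA ->]]]; exact: measurable_rectangle.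
apply: smallest_sub; first exact: smallest_sigma_algebra.
move=> _ [w [A mA ->]]; apply: sub_sigma_algebra.
exists [fset w]%fset, (fun=> A); split=> //; apply/seteqP; split=> y /=.
  by move=> Ay v; rewrite inE => /eqP ->.
by apply; rewrite inE.
Qed.

Lemma setI_rectangles : setI_closed rectangles.
Proof.
move=> _ _ [F [A [mA ->]]] [F' [A' [mA' ->]]].
exists (F `|` F')%fset, (fun w => (if w \in F then A w else setT) `&`
  (if w \in F' then A' w else setT)); split.
  by move=> w; apply: measurableI; case: ifP.
apply/seteqP; split=> y /=.
  by move=> [yA yA'] w wF; split; [case: ifP => // /yA|case: ifP => // /yA'].
move=> H; split=> w wF.
  by have [+ _] := H w (fsubsetP (fsubsetUl _ _) _ wF); rewrite wF.
by have [_ +] := H w (fsubsetP (fsubsetUr _ _) _ wF); rewrite wF.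
Qed.

Context (mu : probability (config W T) R) (mu_iid : iid mu).
Local Open Scope ereal_scope.

Lemma glue_rectangle B F A : (forall w, measurable (A w)) ->
  (mu \x mu) ((fun yz => glue B yz.1 yz.2) @^-1` rectangle F A) = mu (rectangle F A).
Proof.
move=> mA; pose FB := [fset w | w in F & `[< B w >]]%fset.
pose FC := [fset w | w in F & ~~ `[< B w >]]%fset.
have -> : (fun yz => glue B yz.1 yz.2) @^-1` rectangle F A =
    rectangle FB A `*` rectangle FC A.
  apply/seteqP; split=> -[y z] /=.
    move=> H; split=> w; rewrite !inE /= => /andP[wF Bw]; have := H w wF.
      by rewrite /glue Bw.
    by rewrite /glue (negPf Bw).
  move=> [yA zA] w wF; rewrite /glue; case: ifPn => Bw.
    by apply: yA; rewrite !inE wF.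
  by apply: zA; rewrite !inE wF.
rewrite product_measure1E; try exact: measurable_rectangle.
have muR F' : mu (rectangle F' A) = \prod_(w <- F') mu [set y | A w (y w)].
  exact: mu_iid.2.
rewrite !muR // [RHS](big_fsetID _ (fun w => `[< B w >]) F) /=.
congr (_ * _); first by rewrite (perm_big (enum_fset FB)).
by rewrite (perm_big (enum_fset FC)).
Qed.

(** Resampling outside [B]: two independent copies glued along [B] have law mu again. On rectangles
    this is the product formula in [iid], and rectangles form a generating pi-system. *)
Lemma glue_law B C : measurable C ->
  (mu \x mu) ((fun yz => glue B yz.1 yz.2) @^-1` C) = mu C.
Proof.
move=> mC.
pose m := measure_function_pushforward__canonical__measure_function_Measure
  (mu \x mu) (measurable_glue B).
apply: (measure_unique rectangles (fun=> setT) _ _ _ _ m mu) => //.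
- exact: measurable_rectangles.
- exact: setI_rectangles.
- move=> _; exists fset0, (fun=> setT); split=> //.
  by apply/seteqP; split.
- by apply/seteqP; split=> // y _; exists 0%N.
- by move=> _ [F [A [mA ->]]]; exact: glue_rectangle.
move=> _; rewrite /m /= /pushforward preimage_setT -setXTT product_measure1E //.
apply: (@le_lt_trans _ _ (1 * 1)); last by rewrite mule1 ltry.
by apply: lee_pmul => //; exact: probability_le1.
Qed.

(** Since a set is a [Prop]-valued function, this applies to events as well as to random
    variables. *)
Definition depends_on (U : Type) B (f : (W -> T) -> U) :=
  forall y y' : W -> T, (forall w, B w -> y w = y' w) -> f y = f y'.

Lemma integral_glue B (f : config W T -> \bar R) :
  measurable_fun setT f -> (forall y, 0 <= f y) ->
  \int[mu]_y f y = \int[mu]_y \int[mu]_z f (glue B y z).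
Proof.
move=> mf f0; pose h (yz : config W T * config W T) := glue B yz.1 yz.2.
have mh : measurable_fun setT h := measurable_glue B.
transitivity (\int[pushforward (mu \x mu) h]_y f y).
  pose m := measure_function_pushforward__canonical__measure_function_Measure
    (mu \x mu) mh.
  apply: (@eq_measure_integral _ _ _ _ m) => A mA _.
  by rewrite /m /= /pushforward glue_law.
rewrite ge0_integral_pushforward // preimage_setT.
have mfh : measurable_fun setT (f \o h) by apply: measurableT_comp mf mh.
exact: (@fubini_tonelli1 _ _ _ _ _ mu mu (f \o h) mfh (fun x => f0 (h x))).
Qed.

(** After resampling, Tonelli gives a double integral in which f sees only the copy used on [B] and
    g only the other one. *)
Lemma integral_indep B (f g : config W T -> \bar R) :
  measurable_fun setT f -> measurable_fun setT g ->
  (forall y, 0 <= f y) -> (forall y, 0 <= g y) ->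
  depends_on B f -> depends_on (~` B) g ->
  \int[mu]_y (f y * g y) = (\int[mu]_y f y) * (\int[mu]_y g y).
Proof.
move=> mf mg f0 g0 fB gB.
rewrite (@integral_glue B (fun y => f y * g y)); last 2 first.
- exact: emeasurable_funM.
- by move=> y; exact: mule_ge0.
rewrite -ge0_integralZr //; last by apply: integral_ge0 => y _.
apply: eq_integral => y _; rewrite -ge0_integralZl //.
apply: eq_integral => z _; congr (_ * _).
  by apply: fB => w Bw; rewrite glue_in.
by apply: gB => w Bw; rewrite glue_out.
Qed.

Lemma integral_prod_indep (I : eqType) (s : seq I) (B : I -> set W)
    (f : I -> config W T -> R) :
  uniq s -> (forall i, measurable_fun setT (f i)) -> (forall i y, (0 <= f i y)%R) ->
  (forall i, i \in s -> depends_on (B i) (f i)) ->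
  (forall i j w, i \in s -> j \in s -> i != j -> B i w -> ~ B j w) ->
  \int[mu]_y (\prod_(i <- s) f i y)%:E = \prod_(i <- s) \int[mu]_y (f i y)%:E.
Proof.
move=> + mf f0; elim: s => [|i s IH] /=.
  move=> _ _ _; rewrite big_nil; under eq_integral do rewrite big_nil.
  by rewrite integral_cst // mul1e; exact: probability_setT.
move=> /andP[iNs us] fB disj; rewrite big_cons.
under eq_integral do rewrite big_cons EFinM.
have mprod : measurable_fun setT (fun y => \prod_(i <- s) f i y)%R.
  exact: measurable_prod.
rewrite (@integral_indep (B i)).
- rewrite IH // => [j js|j k w js ks]; first by apply: fB; rewrite inE js orbT.
  by apply: disj; rewrite inE ?js ?ks orbT.
- exact/measurable_EFinP.
- exact/measurable_EFinP.
- by move=> y; rewrite lee_fin.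
- by move=> y; rewrite lee_fin; exact: prodr_ge0.
- by move=> y y' yy'; congr (_%:E); apply: fB => //; exact: mem_head.
move=> y y' yy'; congr (_%:E); rewrite !big_seq; apply: eq_bigr => j js.
apply: fB; first by rewrite inE js orbT.
move=> w Bjw; apply: yy'; apply: (disj j i w) => //.
- by rewrite inE js orbT.
- exact: mem_head.
- by apply: contra iNs => /eqP <-.
Qed.

End Resampling.

(** * Approximation of coded events by local ones *)

Section Core.
Context (R : realType) (W : choiceType) (d : measure_display) (T : measurableType d).
Context (mu : probability (config W T) R) (mu_iid : iid mu).
Implicit Types (B : set W) (C E : set (config W T)) (y z : config W T).
Local Open Scope ereal_scope.

Lemma xsection_glue B C y :
  xsection ((fun yz => glue B yz.1 yz.2) @^-1` C) y = [set z | C (glue B y z)].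
Proof. by apply/seteqP; split=> z; rewrite /xsection /= inE. Qed.

Lemma measurable_section B C y : measurable C -> measurable [set z | C (glue B y z)].
Proof.
move=> mC; rewrite -xsection_glue; apply: measurable_xsection.
by rewrite -[X in measurable X]setTI; exact: measurable_glue.
Qed.

Lemma measurable_resample B C : measurable C ->
  measurable_fun setT (fun y => mu [set z | C (glue B y z)]).
Proof.
move=> mC.
have mpre : measurable ((fun yz : config W T * config W T => glue B yz.1 yz.2) @^-1` C).
  by rewrite -[X in measurable X]setTI; exact: measurable_glue.
have := @measurable_fun_xsection _ _ _ _ R mu _ mpre.
rewrite (_ : mu \o xsection _ = fun y => mu [set z | C (glue B y z)]) //.
by apply/funext => y /=; rewrite xsection_glue.
Qed.

Lemma resample_law B C : measurable C ->
  \int[mu]_y mu [set z | C (glue B y z)] = mu C.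
Proof.
move=> mC; rewrite -(glue_law mu_iid B mC).
by apply: eq_integral => y _ /=; rewrite xsection_glue.
Qed.

Lemma resample_null B C : measurable C -> mu C = 0 ->
  {ae mu, forall y, mu [set z | C (glue B y z)] = 0}.
Proof.
move=> mC muC0.
have := (@ae_eq_integral_abs _ _ R mu setT measurableT _ (measurable_resample B mC)).1.
under eq_integral do rewrite gee0_abs //.
move=> /(_ _); rewrite resample_law // => /(_ muC0).
by apply: filterS => y /(_ I).
Qed.

(* The configurations whose values on B decide E up to a null set. This replaces
   the event that the coding radius is at most r, which need not be measurable. *)
Definition core B E : set (config W T) := [set y | mu [set z | ~ E (glue B y z)] = 0].

Lemma measurable_core B E : measurable E -> measurable (core B E).
Proof.
move=> mE; have := measurable_resample B (measurableC mE).
move=> /(_ measurableT [set 0] (emeasurable_set1 _)).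
by rewrite setTI.
Qed.

Lemma core_depends B E : depends_on B (core B E).
Proof.
move=> y y' yy'; rewrite /core /=; congr (mu _ = 0).
have -> // : glue B y = glue B y'.
apply/funext => z; apply/funext => w; rewrite /glue.
by case: asboolP => // /yy'.
Qed.

(** Resample outside [B]. If y is in the core, E fails with probability zero by definition;
    otherwise no resampled point is in the core, which depends on [B] only. *)
Lemma core_sub B E : measurable E -> mu (core B E `\` E) = 0.
Proof.
move=> mE; rewrite -(resample_law B); last exact: measurableD (measurable_core B mE) mE.
rewrite integral0_eq // => y _.
have [yB|yB] := pselect (core B E y).
  apply: (@subset_measure0 _ _ _ mu _ [set z | ~ E (glue B y z)]) => //.
  - apply: measurable_section; exact: measurableD (measurable_core B mE) mE.
  - exact: (measurable_section B y (measurableC mE)).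
  by move=> z [].
rewrite (_ : [set z | _] = set0) ?measure0 //.
apply/seteqP; split=> // z [+ _].
suff -> : core B E (glue B y z) = core B E y by [].
by apply: (@core_depends B) => w Bw; rewrite glue_in.
Qed.

(** An approximation from inside: up to a null set the indicator of [D] bounds that of [E] from
    below, the direction needed to bound a Laplace transform from above. *)
Variant approx_event B (eps : R) E (D : set (config W T)) : Prop :=
  ApproxEvent of measurable D & depends_on B D & mu (D `\` E) = 0 &
    mu E <= mu D + eps%:E.

Lemma approx_eventS B B' eps E D : B `<=` B' -> approx_event B eps E D ->
  approx_event B' eps E D.
Proof.
move=> BB' [mD dD DE ED]; split=> // y y' yy'; apply: dD => w /BB'; exact: yy'.
Qed.

Lemma core_approx (B : nat -> set W) E (eps : R) : (0 < eps)%R ->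
  (forall m n, (m <= n)%N -> B m `<=` B n) -> measurable E ->
  {ae mu, forall y, E y -> exists r, core (B r) E y} ->
  exists r D, approx_event (B r) eps E D.
Proof.
move=> eps0 Bmono mE aeE.
(* Taking unions makes the sequence increasing by construction; it still depends on [B n] only, as
   the sets [B r] increase. Continuity from below then yields n. *)
pose D n := \bigcup_(r in [set r | (r <= n)%N]) core (B r) E.
have mD n : measurable (D n) by apply: bigcup_measurable => r _; exact: measurable_core.
have DE n : mu (D n `\` E) = 0.
  apply: measure_negligible; first exact: measurableD.
  rewrite /D setD_bigcupl.
  apply: (@negligibleS _ _ _ mu (\bigcup_r (core (B r) E `\` E))).
    by move=> y [r _ ry]; exists r.
  apply: negligible_bigcup => r; apply/negligibleP; last exact: core_sub.
  exact: measurableD (measurable_core _ mE) mE.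
have depD n : depends_on (B n) (D n).
  move=> y y' yy'; apply/propext; split=> -[r /= rn yr]; exists r => //.
    by rewrite -(@core_depends (B r) E y y') // => w /(Bmono _ _ rn); exact: yy'.
  by rewrite (@core_depends (B r) E y y') // => w /(Bmono _ _ rn); exact: yy'.
pose F n := E `&` D n.
have mF n : measurable (F n) by exact: measurableI.
have ndF : nondecreasing_seq F.
  move=> m n mn; apply/subsetPset => y [Ey [r /= rm yr]]; split=> //.
  by exists r => //=; exact: leq_trans mn.
pose U := \bigcup_n F n.
have mU : measurable U by exact: bigcup_measurable.
have UE : U `<=` E by move=> y [n _ []].
have muEU : mu U = mu E.
  have e := measureDI mu mE mU; rewrite (setIidr UE) in e.
  apply: etrans (esym e); rewrite -[LHS]add0e; congr (_ + _); apply/esym.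
  apply: measure_negligible; first exact: measurableD.
  apply: negligibleS aeE => y [Ey Uy] /(_ Ey)[r ry]; apply: Uy.
  by exists r => //; split=> //; exists r => /=.
have Efin : mu E \is a fin_num by exact: fin_num_measure.
suff [n En] : exists n, mu E <= mu (D n) + eps%:E.
  by exists n, (D n); split.
apply: contrapT => /forallNP En.
have cvgF : mu \o F @ \oo --> mu U by exact: nondecreasing_cvg_mu.
have : mu U <= mu E - eps%:E.
  apply: (cvge_to_le cvgF); apply: nearW => n /=.
  apply: (@le_trans _ _ (mu (D n))).
    by apply: le_measure; rewrite ?inE // => y [].
  by rewrite EFinN leeBrDr //; have /negP := En n; rewrite -ltNge => /ltW.
rewrite muEU -(fineK Efin) -EFinB lee_fin; lra.
Qed.

Context (H : rel W) (phi : config W T -> config W bool).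

(** If the radius of [phi'] at y is at most r, resampling outside the r-ball preserves the spin of
    [phi']. The null set [N] where [phi'] and [phi] may differ stays null under resampling, for
    almost every y and all of the countably many r. *)
Lemma finitary_core (phi' : config W T -> config W bool) (v : W) (s : bool) :
  measurable [set y | phi y v = s] ->
  {ae mu, forall y, phi' y = phi y} ->
  {ae mu, forall y, coding_radius (R := R) H phi' v y < +oo} ->
  {ae mu, forall y, phi y v = s ->
     exists r, core [set w | within H r v w] [set y | phi y v = s] y}.
Proof.
move=> mE phiE Rfin; have [N [mN muN0 subN]] := phiE.
have phiN y : ~ N y -> phi' y = phi y.
  by move=> Ny; apply: contrapT => neq; apply: Ny; apply: subN.
have aeN : {ae mu, forall y, forall r,
    mu [set z | N (glue [set w | within H r v w] y z)] = 0}.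
  by apply: ae_foralln => r; exact: resample_null.
apply: filterS3 phiE Rfin aeN => y yE + yN ys.
rewrite /coding_radius; set S := (X in ereal_inf X) => Sfin.
have [_ [r /= rad _]] : S !=set0.
  by apply/set0P/eqP => S0; move: Sfin; rewrite S0 ereal_inf0 ltxx.
exists r; apply: (@subset_measure0 _ _ _ mu _
    [set z | N (glue [set w | within H r v w] y z)]) => //.
- exact: (measurable_section [set w | within H r v w] y (measurableC mE)).
- exact: measurable_section.
move=> z /= nE; apply: contrapT => /phiN zE; apply: nE.
rewrite -zE -(rad (glue [set w | within H r v w] y z)) ?yE // => w vw.
by rewrite glue_in //; exact: gdist_within vw.
exact: yN.
Qed.

End Core.

(** * Uniform local approximation and the upper bound for the Laplace transform *)

Section CodingBound.
Context (R : realType) (W : choiceType) (H : rel W) (Gam : groupType)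
  (act : Gam -> W -> W) (d : measure_display) (T : measurableType d).
Context (mu : probability (config W T) R) (P : probability (config W bool) R)
  (phi : config W T -> config W bool).
Context (mu_iid : iid mu) (act_aut : acts_by_automorphisms act H)
  (act_qt : acts_quasi_transitively act) (cod : coding act mu P phi)
  (fin : finitary (R := R) H mu phi).
Local Open Scope ereal_scope.
Let ball r v : set W := [set w | within H r v w].
Let E v s : set (config W T) := [set y | phi y v = s].

Let mphi : measurable_fun setT phi. Proof. by case: cod. Qed.

Lemma measurable_spin v s : measurable [set w : config W bool | w v = s].
Proof.
have := @measurable_coord W _ bool v measurableT [set s].
by rewrite setTI; apply.
Qed.

Lemma measurable_coded_spin v s : measurable (E v s).
Proof. by have := mphi measurableT (measurable_spin v s); rewrite setTI. Qed.

Lemma coded_spin_law v s : mu (E v s) = P [set w | w v = s].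
Proof. by case: cod => _ _ _ law _; rewrite -law //; exact: measurable_spin. Qed.

Lemma measurable_config_act d' (T' : measurableType d') g :
  measurable_fun setT (config_act act g : config W T' -> config W T').
Proof. by apply: measurable_config => w; exact: measurable_coord. Qed.

(** The radius is independent of v because an approximating event can be carried along a
    [Gam]-orbit: the coding is equivariant, both laws are invariant, and the action maps r-balls to
    r-balls. *)
Lemma coding_approx s (eps : R) : (0 < eps)%R ->
  exists r, forall v, exists D, approx_event mu (ball r v) eps (E v s) D.
Proof.
move=> eps0; have [act1 actM actA] := act_aut.
have [mu_inv P_inv _ _ [Om [Om_inv Om_ae Om_eq]]] := cod.
have [phi' phiE radius] := fin.
apply: (finite_range_bound act_qt) => [v|v m n mn [D DA]|v w n vw [D [mD dD nD leD]]].
- apply: (core_approx mu_iid (B := fun r => ball r v)) => //.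
  + by move=> m n mn w; exact: within_leq.
  + exact: measurable_coded_spin.
  + by apply: (finitary_core mu_iid _ phiE (radius v)); exact: measurable_coded_spin.
- by exists D; apply: approx_eventS DA => w; exact: within_leq.
have [g _ gvw] : [set act g v | g in [set: Gam]] w.
  by rewrite vw; exists 1%g.
have actE (U : Type) (y : W -> U) u : config_act act g^-1%g y u = y (act g u).
  by rewrite /config_act invgK.
pose D' : set (config W T) := config_act act g^-1%g @^-1` D.
have mD' : measurable D'.
  by have := @measurable_config_act _ T g^-1%g measurableT _ mD; rewrite setTI.
exists D'; split=> //.
- move=> y y' yy' /=; apply: dD => u vu; rewrite !actE; apply: yy'.
  by rewrite -gvw; apply: within_morph vu; have [_] := actA g.
- apply: measure_negligible; first exact: measurableD (measurable_coded_spin _ _).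
  (* Equivariance holds on [Om] only; the complement of [Om] enters as a second null set. *)
  pose DE : set (config W T) := config_act act g^-1%g @^-1` (D `\` E v s).
  apply: (@negligibleS _ _ _ mu ((~` Om) `|` DE)).
    move=> y [Dy nEy]; have [Oy|Oy] := pselect (Om y); last by left.
    right; split=> // Ey; apply: nEy; rewrite /E /= -gvw -actE -Om_eq //.
  apply: negligibleU; first exact: Om_ae.
  have mDE : measurable (D `\` E v s) by apply: measurableD => //; exact: measurable_coded_spin.
  apply/negligibleP; last by apply: etrans nD; exact: mu_inv.
  by have := @measurable_config_act _ T g^-1%g measurableT _ mDE; rewrite setTI.
have -> : mu D' = mu D by exact: mu_inv.
rewrite coded_spin_law; apply: le_trans leD; rewrite coded_spin_law.
have <- : P [set x | x w = s] = P [set x | x v = s]; last by [].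
rewrite -(P_inv g^-1%g _ (measurable_spin v s)); congr (P _).
by apply/seteqP; split=> y /=; rewrite actE gvw.
Qed.

Lemma integral_expR_indic (D : set (config W T)) (t : R) : measurable D -> (0 <= t)%R ->
  \int[mu]_y (expR (- t * (\1_D y)))%:E = (1 - (1 - expR (- t)) * fine (mu D))%:E.
Proof.
move=> mD t0; have e1 : (expR (- t) <= 1)%R by rewrite expR_le1 oppr_le0.
under eq_integral => y _.
  rewrite (_ : expR (- t * \1_D y) = expR (- t) + (1 - expR (- t)) * \1_(~` D) y)%R; last first.
    rewrite !indicE in_setC; case: (y \in D) => /=.
      by rewrite mulr1 mulr0 addr0.
    by rewrite mulr0 expR0 mulr1 addrC subrK.
  rewrite EFinD; over.
have mD' : measurable (~` D) by exact: measurableC.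
rewrite ge0_integralD //=.
- rewrite integral_cst //.
  under eq_integral do rewrite EFinM.
  rewrite ge0_integralZl_EFin ?subr_ge0 //=.
  + have -> : \int[mu]_y (\1_(~` D) y)%:E = 1 - mu D.
      by rewrite integral_indic // setIT; exact: probability_setC.
    have -> : mu setT = 1 by exact: probability_setT.
    rewrite -(fineK (fin_num_measure mu _ mD)) mule1 -EFinB -EFinM -EFinD.
    by congr (_%:E); ring.
  + by apply/measurable_EFinP; exact: measurable_indic.
- by move=> y _; rewrite lee_fin mulr_ge0 // subr_ge0.
- apply/measurable_EFinP; apply: measurable_funM => //; exact: measurable_indic.
Qed.

Lemma coding_laplace_ub s (t eps : R) r (S : seq W) (D : W -> set (config W T)) :
  (0 <= t)%R -> uniq S ->
  (forall v, approx_event mu (ball r v) eps (E v s) (D v)) ->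
  (forall v w u, v \in S -> w \in S -> v != w -> within H r v u -> ~ within H r w u) ->
  (Rintegral P setT (fun w : config W bool => expR (- t * \sum_(v <- S) (w v == s)%:R)) <=
  \prod_(v <- S) (1 - (1 - expR (- t)) * (fine (P [set w | w v = s]) - eps)))%R.
Proof.
move=> t0 uS DA disj.
have e1 : (0 <= 1 - expR (- t))%R by rewrite subr_ge0 expR_le1 oppr_le0.
pose f (w : config W bool) : R := (\prod_(v <- S) expR (- t * (w v == s)%:R))%R.
have fE w : expR (- t * \sum_(v <- S) (w v == s)%:R) = f w.
  by rewrite mulr_sumr expR_sum.
have f0 w : (0 <= f w)%R by apply: prodr_ge0 => v _; exact: expR_ge0.
have mf : measurable_fun setT f.
  apply: measurable_prod => v _.
  apply: (@measurableT_comp _ _ _ _ _ _ (fun b : bool => expR (- t * (b == s)%:R)) _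
    (fun w : config W bool => w v)); last exact: measurable_coord.
  by [].
pose g v (y : config W T) : R := expR (- t * \1_(D v) y).
have mD v : measurable (D v) by case: (DA v).
have mg v : measurable_fun setT (g v).
  apply: measurableT_comp; first exact: measurable_expR.
  by apply: measurable_funM => //; exact: measurable_indic.
(* Each [D v] implies its spin event up to a null set; as [S] is finite, this holds almost surely
   for all of [S] at once. *)
have aeS : {ae mu, forall y, forall v, v \in S -> D v y -> phi y v = s}.
  elim: (S) => [|v S' IH]; first by apply: nearW.
  have aev : {ae mu, forall y, D v y -> phi y v = s}.
    apply: (@negligibleS _ _ _ mu (D v `\` E v s)).
      by move=> y /not_implyP.
    apply/negligibleP; last by case: (DA v).
    exact: measurableD (mD v) (measurable_coded_spin _ _).
  apply: filterS2 aev IH => y yv IHy w; rewrite inE => /orP[/eqP ->|] //.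
  exact: IHy.
have ub : \int[P]_w (f w)%:E <=
    (\prod_(v <- S) (1 - (1 - expR (- t)) * fine (mu (D v))))%:E.
  have -> : \int[P]_w (f w)%:E = \int[pushforward mu phi]_w (f w)%:E.
    pose m := measure_function_pushforward__canonical__measure_function_Measure mu mphi.
    apply: (@eq_measure_integral _ _ _ _ m) => A mA _.
    by case: cod => _ _ _ law _; rewrite /m /= law.
  have mfE : measurable_fun setT (fun w => (f w)%:E) by exact/measurable_EFinP.
  rewrite ge0_integral_pushforward //; last by move=> w _; rewrite lee_fin.
  rewrite preimage_setT.
  apply: (@le_trans _ _ (\int[mu]_y (\prod_(v <- S) g v y)%:E)).
    apply: ae_ge0_le_integral => //.
    - by move=> y _; rewrite lee_fin.
    - by apply/measurable_EFinP; exact: measurableT_comp.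
    - by move=> y _; rewrite lee_fin; apply: prodr_ge0 => v _; exact: expR_ge0.
    - by apply/measurable_EFinP; exact: measurable_prod.
    apply: filterS aeS => y yS _; rewrite lee_fin /f /=.
    rewrite big_seq [leRHS]big_seq; apply: ler_prod => v vS; rewrite expR_ge0 /=.
    rewrite ler_expR !mulNr lerN2 ler_wpM2l // indicE ler_nat.
    by case: (boolP (y \in D v)) => //; rewrite inE => /(yS _ vS) ->; rewrite eqxx.
  rewrite (integral_prod_indep mu_iid (B := fun v => ball r v)) //.
  - rewrite -prodEFin (eq_bigr (fun v => (1 - (1 - expR (- t)) * fine (mu (D v)))%:E)) //.
    by move=> v _; exact: integral_expR_indic.
  - by move=> v y; exact: expR_ge0.
  - move=> v _ y y' yy'; rewrite /g !indicE; congr (expR (_ * (nat_of_bool _)%:R)).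
    case: (DA v) => _ dD _ _; have yE := dD _ _ yy'.
    by apply/idP/idP; rewrite !inE yE.
rewrite /Rintegral; under eq_integral do rewrite fE.
apply: (@le_trans _ _ (\prod_(v <- S) (1 - (1 - expR (- t)) * fine (mu (D v))))%R).
  rewrite -lee_fin fineK // ge0_fin_numE; first exact: le_lt_trans ub (ltry _).
  by apply: integral_ge0 => w _; rewrite lee_fin.
apply: ler_prod => v _.
have fP := fin_num_measure P _ (measurable_spin v s).
have fD := fin_num_measure mu _ (mD v).
have D1 : (fine (mu (D v)) <= 1)%R by rewrite -lee_fin fineK //; exact: probability_le1.
have D0 : (0 <= fine (mu (D v)))%R by exact: fine_ge0.
have PD : (fine (P [set w | w v = s]) <= fine (mu (D v)) + eps)%R.
  rewrite -lee_fin EFinD !fineK // -coded_spin_law.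
  by case: (DA v).
have e2 := expR_ge0 (- t); apply/andP; split; nra.
Qed.

End CodingBound.

(** * Conflict of the two exponential bounds along a Folner sequence *)

Section Contradiction.
Context (R : realType) (V : choiceType) (G : sgraph V).
Context (G_connected : connected_on G [set: V]) (G_lf : locally_finite G)
  (G_qt : quasi_transitive G).
Implicit Types (e : edge G).

Lemma edge_probE (P : probability (config (edge G) bool) R) e :
  edge_prob P e = fine (P [set w | w e = true]).
Proof.
rewrite /edge_prob /Rintegral; congr fine.
transitivity (P ([set w : config (edge G) bool | w e = true] `&` setT)); last by rewrite setIT.
rewrite -integral_indic //; last exact: measurable_spin.
apply: eq_integral => w _; congr (_%:E); rewrite indicE; congr (nat_of_bool _)%:R.
by apply/idP/idP; rewrite inE.
Qed.

Lemma edge_prob_false (P : probability (config (edge G) bool) R) e :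
  fine (P [set w | w e = false]) = 1 - edge_prob P e.
Proof.
rewrite edge_probE; have mt := @measurable_spin (edge G) e true.
rewrite (_ : [set w : config (edge G) bool | w e = false] = ~` [set w | w e = true]).
  have -> : P (~` [set w | w e = true]) = (1 - P [set w | w e = true])%E.
    exact: probability_setC.
  by rewrite -{1}(fineK (fin_num_measure P _ mt)) -EFinB.
by apply/seteqP; split=> w /=; [move=> -> //|move=> /negP/negbTE].
Qed.

(** The common form of both cases: [b] is the true probability of state [s] at the translates of
    [e0], [a] the smaller one that can be imposed inside F at a cost [c] for each of at most
    [C * #|K n|] edges. *)
Lemma not_ffiid (P : probability (config (edge G) bool) R) (s : bool) (e0 : edge G)
    (a b c : R) (C : nat) (F K : nat -> {fset V})
    (Gam : groupType) (act : Gam -> edge G -> edge G) :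
  0 <= a -> a < b -> b <= 1 -> 0 < c ->
  (forall f (fG : automorphism G f), fine (P [set w | w (edge_map fG e0) = s]) = b) ->
  (forall n, F n != fset0) ->
  (forall n, inner_bd G (F n) `<=` [set` K n]) ->
  (fun n => #|` K n|%:R / #|` F n|%:R : R) @ \oo --> (0 : R) ->
  (forall n (S : {fset edge G}) t, 0 <= t -> (S `<=` edges_in G (F n))%fset ->
    (forall e, e \in S -> exists f (fG : automorphism G f), e = edge_map fG e0) ->
    c ^+ (C * #|` K n|) * expR (- t * (#|` S|%:R * a)) <=
    Rintegral P setT (laplace s t S)) ->
  acts_by_automorphisms act (line_graph (G := G)) -> acts_quasi_transitively act ->
  ~ ffiid (line_graph (G := G)) act P.
Proof.
move=> a0 ab b1 c0 Pb F0 FK KF lb act_aut act_qt [d [T [mu [phi [_ mu_iid cod fin]]]]].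
(* From 1 - exp(-t) >= t / (1 + t) one gets (1 + t) delta >= t (b - eps - a - a t), and with these
   choices the bracket equals (b - a)(3/4 - a/2), which is positive as a < 1. *)
pose t := (b - a) / 2; pose eps := (b - a) / 4%:R.
have t0 : 0 < t by rewrite /t; lra.
have eps0 : 0 < eps by rewrite /eps; lra.
have [r approx] := coding_approx mu_iid act_aut act_qt cod fin s eps0.
have sD v : {D | approx_event mu [set w | within (line_graph (G := G)) r v w] eps
    [set y | phi y v = s] D} by apply: cid; exact: approx.
have [M sep] := separated_edges G_connected G_lf G_qt e0 r.
pose theta := (1 - expR (- t)) * (b - eps); pose delta := theta - t * a.
have delta0 : 0 < delta.
  have h1 : expR (- t) * (1 + t) <= 1.
    have e : expR (- t) * expR t = 1 by rewrite -expRD addNr expR0.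
    by rewrite -[leRHS]e ler_wpM2l ?expR_ge0 // expR_ge1Dx.
  have h2 : 0 < t * ((b - eps) - a - a * t).
    rewrite mulr_gt0 // /eps /t; have : 0 <= (b - a) * (1 - a) by rewrite mulr_ge0; lra.
    lra.
  have h3 : 0 <= (1 - expR (- t) * (1 + t)) * (b - eps).
    by rewrite mulr_ge0 // ?subr_ge0 // /eps; lra.
  have h4 : 0 < (1 + t) * delta.
    rewrite /delta /theta; move: (expR (- t)) h1 h2 h3 => E h1 h2 h3; lra.
  by move: h4; rewrite pmulr_rgt0 //; lra.
have theta1 : theta <= 1.
  have h1 := expR_ge0 (- t).
  have h2 : expR (- t) <= 1 by rewrite expR_le1; lra.
  have h3 : 0 <= b - eps <= 1 by rewrite /eps; apply/andP; split; lra.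
  by rewrite /theta; move: (expR (- t)) h1 h2 (b - eps) h3 => E E0 E1 x /andP[x0 x1]; nra.
(* The two bounds give delta |S| <= C |K| (- ln c); inserted in delta |F| <= M delta (|K| + |S|)
   this produces [kappa]. *)
pose kappa := M%:R * (delta + C%:R * - ln c).
have bound n : delta <= kappa * (#|` K n|%:R / #|` F n|%:R).
  have [S [SF Sorb Ssep FMS]] := sep (F n) (K n) (FK n).
  have ub := coding_laplace_ub mu_iid cod (ltW t0) (fset_uniq S)
    (fun v => svalP (sD v)) Ssep.
  have := le_trans (lb n S t (ltW t0) SF Sorb) ub.
  have -> : \prod_(v <- S) (1 - (1 - expR (- t)) * (fine (P [set w | w v = s]) - eps)) =
      (1 - theta) ^+ #|` S|.
    rewrite big_seq (eq_bigr (fun=> 1 - theta)); last first.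
      by move=> e eS; have [f [fG ->]] := Sorb e eS; rewrite Pb.
    by rewrite -big_seq big_const_seq count_predT iter_mulr_1.
  move=> h.
  (* Use 1 - theta <= exp(-theta), where theta <= 1 keeps the base nonnegative, and cancel exp(-t a
     |S|). *)
  have h2 : c ^+ (C * #|` K n|) <= expR (- (delta * #|` S|%:R)).
    rewrite -(ler_pM2r (expR_gt0 (- t * (#|` S|%:R * a)))); apply: le_trans h _.
    rewrite -expRD [X in _ <= expR X](_ : _ = - theta * #|` S|%:R); last first.
      by rewrite /delta; move: (theta) (#|` S|%:R) => *; ring.
    rewrite expRM_natr lerXn2r // ?nnegrE ?expR_ge0 ?subr_ge0 //.
    exact: expR_ge1Dx.
  have h3 : delta * #|` S|%:R <= (C * #|` K n|)%:R * - ln c.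
    rewrite -lerN2 mulrN opprK mulr_natl -lnXn //.
    by rewrite -[leRHS]expRK ler_ln ?posrE ?expR_gt0 // exprn_gt0.
  have Fpos : 0 < #|` F n|%:R :> R by rewrite ltr0n cardfs_gt0.
  rewrite mulrA ler_pdivlMr //.
  have FMS' : #|` F n|%:R <= M%:R * (#|` K n|%:R + #|` S|%:R) :> R.
    by rewrite -natrD -natrM ler_nat.
  have := ler_wpM2l (ltW delta0) FMS'.
  have := ler_wpM2l (ler0n R M) h3; rewrite /kappa natrM.
  move: (#|` F n|%:R) (#|` K n|%:R) (#|` S|%:R) (M%:R) (C%:R) (ln c) => *; lra.
have : delta <= kappa * 0.
  apply: (cvgr_to_ge (F := \oo) (f := fun n => kappa * (#|` K n|%:R / #|` F n|%:R))).
    exact: cvgMl_tmp.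
  by apply: nearW => n; exact: bound.
by rewrite mulr0 leNgt delta0.
Qed.

End Contradiction.

Theorem theorem2 (R : realType) (V : choiceType) (G : sgraph V)
  (G_infinite : infinite_set [set: V])
  (G_connected : connected_on G [set: V])
  (G_locally_finite : locally_finite G)
  (G_quasi_transitive : quasi_transitive G)
  (p q : R) (p01 : 0 <= p <= 1) (q1 : 1 <= q)
  (phi0 phi1 : probability (config (edge G) bool) R)
  (phi0_free : is_rc_measure false p q phi0)
  (phi1_wired : is_rc_measure true p q phi1) :
  (amenable R G ->
   (exists2 A, measurable A & phi0 A <> phi1 A) ->
   forall (Gam : groupType) (act : Gam -> edge G -> edge G),
     acts_by_automorphisms act (line_graph (G:=G)) ->
     acts_quasi_transitively act ->
     ~ ffiid (line_graph (G:=G)) act phi1)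
  /\
  (c_amenable R G ->
   (exists2 A, measurable A & phi0 A <> phi1 A) ->
   forall (Gam : groupType) (act : Gam -> edge G -> edge G),
     acts_by_automorphisms act (line_graph (G:=G)) ->
     acts_quasi_transitively act ->
     ~ ffiid (line_graph (G:=G)) act phi0).
Proof.
pose phi (i : bool) := if i then phi1 else phi0.
have phi_rc i : is_rc_measure i p q (phi i) by case: i.
have [Delta nbD] := nbrs_bound G_locally_finite G_quasi_transitive.
have nbE u v : G u v -> v \in nbrs G u by rewrite in_nbrs.
have prob_inv := edge_prob_automorphism phi_rc.
have prob0 := edge_prob_ge0 p01 q1 phi_rc; have prob1 := edge_prob_le1 p01 q1 phi_rc.
have /andP[p0 p1] := p01.
have orbit_sum (S : {fset edge G}) (e0 : edge G) (g : edge G -> R) :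
    (forall e, e \in S -> exists f (fG : automorphism G f), e = edge_map fG e0) ->
    (forall f (fG : automorphism G f), g (edge_map fG e0) = g e0) ->
    \sum_(e <- S) g e = #|` S|%:R * g e0.
  move=> Sorb ginv; rewrite big_seq (eq_bigr (fun=> g e0)); last first.
    by move=> e eS; have [f [fG ->]] := Sorb e eS.
  by rewrite -big_seq big_const_seq count_predT iter_addr_0 mulr_natl.
split=> [[F [F0 KF]]|[F [K [FK0 Kc bdK KF]]]] neq Gam act act_aut act_qt;
  have [e0 gap] := exists_gap_edge p01 q1 phi_rc neq.
(* A gap excludes p = 1, so closing edges has a positive cost factor. Here the set K is the vertex
   boundary of F itself. *)
- have p_lt1 : p < 1.
    rewrite lt_neqAle p1 andbT; apply/eqP => p_1.
    by move: gap; rewrite !(edge_prob_p1 p01 q1 phi_rc) // ltxx.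
  apply: (@not_ffiid R V G G_connected G_locally_finite G_quasi_transitive phi1 true e0
    (edge_prob phi0 e0) (edge_prob phi1 e0) ((1 - p) / 2) Delta F
    (fun n => fset_set (vboundary R G [set` F n]))) => //.
  + exact: (prob0 false).
  + exact: (prob1 true).
  + by rewrite divr_gt0 // subr_gt0.
  + by move=> f fG; rewrite -edge_probE (prob_inv f fG true).
  + by move=> n; exact: inner_bd_fset_vboundary.
  move=> n S t t0 SF Sorb.
  rewrite -(orbit_sum S e0 (edge_prob phi0)) //; last by move=> f fG; exact: (prob_inv f fG false).
  apply: (laplace_wired_lb p01 q1 phi_rc nbE nbD) => //; last exact: SF.
  exact: inner_bd_fset_vboundary.
have p_gt0 : 0 < p.
  rewrite lt_neqAle p0 andbT; apply/eqP => /esym p_0.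
  by move: gap; rewrite !(edge_prob_p0 p01 q1 phi_rc) // ltxx.
have bdK' n : inner_bd G (F n) `<=` [set` K n].
  by move=> u /(@inner_bd_vboundary R V G _) /bdK.
(* Counting closed edges reverses the gap: the wired measure has the smaller density 1 -
   [edge_prob phi1 e0], and [p / q / 2] is the cost of opening an edge. *)
apply: (@not_ffiid R V G G_connected G_locally_finite G_quasi_transitive phi0 false e0
  (1 - edge_prob phi1 e0) (1 - edge_prob phi0 e0) (p / q / 2) Delta F K) => //.
- by rewrite subr_ge0; exact: (prob1 true).
- by rewrite ltrD2l ltrN2.
- by have := prob0 false e0; rewrite /phi /=; lra.
- by rewrite !divr_gt0 // (q_gt0 q1).
- by move=> f fG; rewrite edge_prob_false (prob_inv f fG false).
- by move=> n; case: (FK0 n).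
move=> n S t t0 SF Sorb.
rewrite -(orbit_sum S e0 (fun e => 1 - edge_prob phi1 e)) //; last first.
  by move=> f fG; congr (1 - _); exact: (prob_inv f fG true).
by apply: (laplace_free_lb p01 q1 phi_rc nbE nbD) => //; exact: SF.
Qed.
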